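(* Suppose Assumptions (A) and (C) below hold. If $p=m^{-\beta}$ with $\beta\in(0,1]$, $n\le m^{\gamma_2}$ for some $\gamma_2>0$, and $\delta$ is bounded from above and such that $\log\delta=o(\log m)$, then the step-up (BH) and the step-down (SD) procedures at FDR level $\alpha\propto n^{-1/2}$ are ABOS.
   Context: Setting. All quantities are indexed by $m$ and all limits are for $m\to\infty$; the index $m$ is suppressed. $n=n_m\in\mathbb N$, $p=p_m\in(0,1)$, $\delta_0,\delta_A>0$ may depend on $m$; $\sigma>0$ and $\nu$ are fixed, where $\nu$ is a probability measure on $\mathbb R$ with $\nu(\{0\})=0$, $\nu(-\infty,0)>0$, $\nu(0,\infty)>0$. The effects $\mu_1,\dots,\mu_m$ are i.i.d. with law $(1-p)d_0+p\nu$ ($d_0$ = Dirac measure at $0$); given them, $X_{ji}$ ($1\le j\le n$, $1\le i\le m$) are independent with $X_{ji}\sim N(\mu_i,\sigma^2)$, and $\bar X_i=\frac1n\sum_{j=1}^nX_{ji}$. One tests $H_{0i}:\mu_i=0$ against $\mu_i\ne0$, $i=1,\dots,m$. Put $\delta=\delta_0/\delta_A$, $f=(1-p)/p$. The risk $R$ of a multiple testing rule is $\delta_0$ times the expected number of false rejections plus $\delta_A$ times the expected number of false non-rejections. Bayes oracle: for large $n$ it accepts $H_{0i}$ iff $\bar X_i\in(a_n,b_n)$, where $a_n<0<b_n$ are the unique solutions $a$ of $(1-p)\delta_0=p\,\delta_A\int_{\mathbb R}\exp\left(n\left(a\frac{\mu}{\sigma^2}-\frac{\mu^2}{2\sigma^2}\right)\right)d\nu(\mu)$;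 it minimizes the risk, and its risk is $R^B$. A rule with risk $R$ is ABOS (asymptotically Bayes optimal under sparsity) if $R/R^B\to1$. Assumption (A): $n\to\infty$, $\delta f\to c\in(0,\infty]$, and $\frac{2\log(\delta f)}{n}\to C$ with $0\le C<\infty$. Assumption (C): with $T:=\sigma\sqrt C$, there is $\epsilon>0$ such that $\nu$ has a positive bounded density $\rho$ w.r.t. Lebesgue measure on $[-T-\epsilon,-T+\epsilon]$ and $[T-\epsilon,T+\epsilon]$; if $C=0$, moreover $\rho(0^-)=\lim_{\mu\uparrow0}\rho(\mu)$ and $\rho(0^+)=\lim_{\mu\downarrow0}\rho(\mu)$ exist and are finite and positive. Procedures: with $Z_i=\sqrt n\,\bar X_i/\sigma$ let $p_i=2(1-\Phi(|Z_i|))$ ($\Phi$ = standard normal cdf) and let $p_{[1]}\le\dots\le p_{[m]}$ be the ordered p-values. BH at level $\alpha$: let $k_F=\max\{i:p_{[i]}\le i\alpha/m\}$ and reject the $k_F$ hypotheses with p-values $\le p_{[k_F]}$ (no rejection if the set is empty). SD at level $\alpha$: let $k_G=\min\{i:p_{[i]}>i\alpha/m\}$ and reject the $k_G-1$ hypotheses with p-values smaller than $p_{[k_G]}$ (all are rejected if the set is empty). $g\propto h$ means that $g/h$ converges to a constant in $(0,\infty)$; levels satisfy $\alpha\in(0,1)$. *)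

(* Defs.v *)
From HB Require Import structures.
From mathcomp Require Import all_boot all_order all_algebra.
From mathcomp Require Import all_classical all_reals all_analysis.

Set Implicit Arguments.
Unset Strict Implicit.
Unset Printing Implicit Defensive.
Import Order.TTheory GRing.Theory Num.Theory.
Import numFieldNormedType.Exports.
Local Open Scope classical_set_scope.
Local Open Scope ring_scope.

Section model.
Context {R : realType}.

(* The mixture (1-p) d_0 + p nu, as a set function. *)
Definition effect_law (p : R) (nu : probability (measurableTypeR R) R)
    (A : set R) : \bar R :=
  ((1 - p)%:E * \d_(0%R : R) A + p%:E * nu A)%E.

(* The first clause says that the mu_i are i.i.d. with law effect_law p nu; the
   second that, given the effects, the X_ji are independent with
   X_ji ~ N(mu_i, sigma^2): it disintegrates the joint law of effects and
   observations on measurable rectangles.  The second parameter of normal_prob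
   is the standard deviation. *)
Definition two_groups_model (m n : nat) (p sigma : R)
    (nu : probability (measurableTypeR R) R)
    (d : measure_display) (Omega : measurableType d) (P : probability Omega R)
    (mu : 'I_m -> {RV P >-> R}) (X : 'I_n -> 'I_m -> {RV P >-> R}) : Prop :=
  (forall A : 'I_m -> set R, (forall i, measurable (A i)) ->
     P [set w | forall i, A i (mu i w)]
     = (\prod_(i < m) effect_law p nu (A i))%E) /\
  (forall (A : 'I_m -> set R) (B : 'I_n -> 'I_m -> set R),
     (forall i, measurable (A i)) -> (forall j i, measurable (B j i)) ->
     P [set w | (forall i, A i (mu i w)) /\ (forall j i, B j i (X j i w))]
     = (\int[P]_(w in [set w | forall i, A i (mu i w)])
          \prod_(i < m) \prod_(j < n) normal_prob (mu i w) sigma (B j i))%E).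

(* A multiple testing rule maps the observations x j i (replicate j, test i)
   to the set of rejected hypotheses. *)
Definition testing_rule (m n : nat) := ('I_n -> 'I_m -> R) -> {set 'I_m}.

Definition risk (m n : nat) (delta0 deltaA : R)
    (d : measure_display) (Omega : measurableType d) (P : probability Omega R)
    (mu : 'I_m -> {RV P >-> R}) (X : 'I_n -> 'I_m -> {RV P >-> R})
    (phi : testing_rule m n) : R :=
  let rejected w := phi (fun j i => X j i w) in
  delta0 * fine 'E_P[fun w =>
    #|[set i | (mu i w == 0) && (i \in rejected w)]%SET|%:R] +
  deltaA * fine 'E_P[fun w =>
    #|[set i | (mu i w != 0) && (i \notin rejected w)]%SET|%:R].

Definition sample_mean (m n : nat) (x : 'I_n -> 'I_m -> R) (i : 'I_m) : R :=
  n%:R^-1 * \sum_(j < n) x j i.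

Definition oracle_equation (n : nat) (p delta0 deltaA sigma : R)
    (nu : probability (measurableTypeR R) R) (a : R) : Prop :=
  ((1 - p) * delta0)%:E =
  ((p * deltaA)%:E * \int[nu]_t
     (expR (n%:R * (a * (t / sigma ^+ 2) - t ^+ 2 / (2 * sigma ^+ 2))))%:E)%E.

(* When n is large the equation has exactly two solutions, of opposite signs,
   so these conditions determine a and b. *)
Definition oracle_cutoffs (n : nat) (p delta0 deltaA sigma : R)
    (nu : probability (measurableTypeR R) R) (a b : R) : Prop :=
  [/\ a < 0, 0 < b, oracle_equation n p delta0 deltaA sigma nu a
    & oracle_equation n p delta0 deltaA sigma nu b].

Definition bayes_oracle (m n : nat) (a b : R) : testing_rule m n :=
  fun x => [set i | ~~ (a < sample_mean x i < b)]%SET.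

Definition std_normal_cdf (x : R) : R := fine (normal_prob 0 1 `]-oo, x]).

Definition pvalue (m n : nat) (sigma : R) (x : 'I_n -> 'I_m -> R)
    (i : 'I_m) : R :=
  2 * (1 - std_normal_cdf `|Num.sqrt n%:R * sample_mean x i / sigma|).

(* The k-th smallest of the pv i, meaningful for 1 <= k <= m. *)
Definition ordered (m : nat) (pv : 'I_m -> R) (k : nat) : R :=
  nth 0 (sort <=%R [seq pv i | i : 'I_m]) k.-1.

(* kF = 0 encodes the case where no index satisfies the bound. *)
Definition BH_rule (m n : nat) (sigma alpha : R) : testing_rule m n :=
  fun x =>
    let pv := pvalue sigma x in
    let kF := (\max_(1 <= k < m.+1 |
                 (ordered pv k <= k%:R * alpha / m%:R)%R) k)%N in
    [set i | (0 < kF)%N && (pv i <= ordered pv kF)]%SET.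

(* find returns a 0-based position in 1, ..., m, or m if there is none; hence
   kG is the least index exceeding its bound, and kG = m.+1 if there is none. *)
Definition SD_rule (m n : nat) (sigma alpha : R) : testing_rule m n :=
  fun x =>
    let pv := pvalue sigma x in
    let kG := (find (fun k : nat => k%:R * alpha / m%:R < ordered pv k)
                 (iota 1 m)).+1 in
    [set i | (m < kG)%N || (pv i < ordered pv kG)]%SET.

Definition assumption_A (n : nat -> nat) (delta f : nat -> R) (C : R) : Prop :=
  [/\ n @ \oo --> \oo,
      exists2 c : \bar R, (0 < c)%E &
        (delta m * f m)%:E @[m --> \oo] --> c,
      2 * ln (delta m * f m) / (n m)%:R @[m --> \oo] --> C
    & 0 <= C].

Definition assumption_C (nu : probability (measurableTypeR R) R)
    (sigma C : R) : Prop :=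
  let T := sigma * Num.sqrt C in
  exists eps : R, exists rho : R -> R, exists M : R,
    let S : set R := `[- T - eps, - T + eps] `|` `[T - eps, T + eps] in
    [/\ 0 < eps,
        measurable_fun S rho,
        (forall t, S t -> 0 < rho t <= M),
        (forall A : set R, measurable A -> A `<=` S ->
           nu A = (\int[lebesgue_measure]_(t in A) (rho t)%:E)%E)
      & C = 0 ->
        (exists2 l : R, 0 < l & rho t @[t --> 0^'-] --> l) /\
        (exists2 l : R, 0 < l & rho t @[t --> 0^'+] --> l)].

Definition propto (g h : nat -> R) : Prop :=
  exists2 K : R, 0 < K & g m / h m @[m --> \oo] --> K.

Definition ABOS (risk_rule risk_oracle : nat -> R) : Prop :=
  risk_rule m / risk_oracle m @[m --> \oo] --> (1 : R).

End model.

(* Main.v *)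
(* For alpha <= 1/4 the expected number of false rejections of BH is at most
   2 alpha (1 + m p): in the step-up index, null p-values are replaced by 0 one
   after the other, which decouples the index from them.  Relative to the number
   m p of signals this costs at most 4 alpha delta -> 0.  Since BH rejects whatever
   SD rejects, both procedures are asymptotically optimal as soon as the
   probability that SD misses a signal is asymptotically at most the probability
   that the oracle misses one, which bounds the Bayes risk from below.

   SD misses a signal only if its p-value exceeds (k0 + 1) alpha / m, or if for
   some k <= k0 fewer than k p-values are below k alpha / m; the latter is made
   negligible by a Chernoff bound.  If C = 0, one takes k0 = m p / 16, and both
   miss probabilities are equivalent to the nu-mass of intervals around 0 whose
   lengths have ratio tending to 1.  If C > 0, one takes k0 = m t / alpha with t the
   p-value of a z-score slightly beyond T / s, where s is the standard deviation of
   a sample mean; both miss probabilities are then close to nu [-T, T]. *)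
From HB Require Import structures.
Require Import Defs.
From mathcomp Require Import all_boot all_order all_algebra.
From mathcomp Require Import all_classical all_reals all_analysis.
From mathcomp Require Import measurable_realfun.
From mathcomp Require Import ring lra zify.
Import Order.TTheory GRing.Theory Num.Theory.
Import numFieldNormedType.Exports.
Local Open Scope classical_set_scope.
Local Open Scope ring_scope.

Set Implicit Arguments.
Unset Strict Implicit.
Unset Printing Implicit Defensive.

(** * Densities and image measures *)

Import HBNNSimple.

(** When C = 0 the probability that the oracle misses a signal tends to 0 itself, at the rate s z'
    with s = sigma / sqrt n and z' its cutoff on the z-scale. A cost of false rejections that merely
    tends to 0 would not do; the level n^(-1/2) makes it O(s), which is negligible because z' tends
    to infinity. The same level makes the cutoffs agree: that of SD satisfies z^2 / 2 = - ln (alpha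
    p) + O(1), that of the oracle z'^2 / 2 = ln odds + ln sqrt n + O(1), and - ln alpha = ln sqrt n
    + O(1), however ln n compares with ln m. The term ln sqrt n of the oracle comes from the bounded
    density of nu near 0, by which the likelihood ratio at x is exp (x^2 / 2) times a factor O(s).
    The model gives probabilities of rectangles in the raw observations only, whereas the rules see
    sample means. The independence of the pairs (truth of the hypothesis, z-score) therefore has to
    be derived first; z-scores are then coarsened to finitely many values, which turns every
    conditioning argument into an identity between finite sums. *)

Lemma ge0_integral_density (d : measure_display) (T : measurableType d)
    (R : realType) (m1 m2 : {measure set T -> \bar R}) (h : T -> R)
    (f : T -> \bar R) :
  measurable_fun setT h -> (forall x, 0 <= h x) ->
  (forall A, measurable A -> m2 A = (\int[m1]_(x in A) (h x)%:E)%E) ->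
  measurable_fun setT f -> (forall x, (0 <= f x)%E) ->
  (\int[m2]_x f x = \int[m1]_x (f x * (h x)%:E))%E.
Proof.
move=> mh h0 m2E mf f0; pose f_ := @nnsfun_approx _ T R setT measurableT f mf.
have cf x : EFin \o f_^~ x @ \oo --> f x by exact: cvg_nnsfun_approx.
transitivity (limn (fun n => \int[m2]_x (f_ n x)%:E)%E).
  rewrite -monotone_convergence//=.
  - by apply: eq_integral => x _; apply/esym/cvg_lim => //; exact: cf.
  - by move=> n; exact/measurable_EFinP/measurable_funTS.
  - by move=> n x _; rewrite lee_fin.
  - by move=> x _ a b ab; rewrite lee_fin; exact/lefP/nd_nnsfun_approx.
transitivity (limn (fun n => \int[m1]_x ((f_ n x)%:E * (h x)%:E))%E); last first.
  rewrite -monotone_convergence//=.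
  - apply: eq_integral => x _; apply/cvg_lim => //.
    by apply: cvgeZr => //; exact: cf.
  - move=> n; apply: emeasurable_funM; last exact/measurable_EFinP.
    exact/measurable_EFinP/measurable_funTS.
  - by move=> n x _; rewrite mule_ge0// lee_fin.
  - move=> x _ a b ab; rewrite lee_pmul ?lee_fin//.
    exact/lefP/nd_nnsfun_approx.
congr (limn _); apply/funext => n.
under eq_integral do rewrite fimfunE -fsumEFin//.
rewrite ge0_integral_fsum//; first last.
- by move=> r x _; rewrite lee_fin; exact: nnfun_muleindic_ge0.
- by move=> r; exact/measurable_EFinP/measurable_funM.
under [RHS]eq_integral.
  move=> x _; rewrite fimfunE -fsumEFin// ge0_mule_fsuml; last first.
    by move=> r; exact: nnfun_muleindic_ge0.
  over.
rewrite ge0_integral_fsum//; first last.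
- move=> r x _; rewrite mule_ge0 ?lee_fin//.
  exact: nnfun_muleindic_ge0.
- move=> r; apply: emeasurable_funM; last exact/measurable_EFinP.
  by apply/measurable_EFinP; exact: measurable_funM.
apply: eq_fsbigr => r rf.
rewrite integralZl_indic_nnsfun// integral_indic// setIT m2E//.
rewrite [in LHS]integral_mkcond.
under [RHS]eq_integral do rewrite EFinM -muleA.
have r0 : 0 <= r by move: rf; rewrite inE => -[x _ <-].
rewrite ge0_integralZl//; first last.
- by move=> x _; rewrite mule_ge0 ?lee_fin.
- apply: emeasurable_funM; exact/measurable_EFinP.
congr (_ * _)%E; apply: eq_integral => x _.
rewrite /patch indicE; case: ifPn => xA; first by rewrite mul1e.
by rewrite mul0e.
Qed.

(** The pushforward with its measure structure; the measurability proof is an explicit argument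
    because the bundled instance depends on it. *)
Definition image_measure (d1 d2 : measure_display) (T1 : measurableType d1)
    (T2 : measurableType d2) (R : realType) (m : {measure set T1 -> \bar R})
    (f : T1 -> T2) (mf : measurable_fun setT f) :
  {measure set T2 -> \bar R} :=
  measure_function_pushforward__canonical__measure_function_Measure m mf.

Lemma ge0_integral_image_measure (d1 d2 : measure_display)
    (T1 : measurableType d1) (T2 : measurableType d2) (R : realType)
    (m : {measure set T1 -> \bar R}) (f : T1 -> T2)
    (mf : measurable_fun setT f) (D : set T2) (g : T2 -> \bar R) :
  measurable D -> measurable_fun D g -> (forall y, D y -> (0 <= g y)%E) ->
  (\int[image_measure m mf]_(y in D) g y =
   \int[m]_(x in f @^-1` D) g (f x))%E.
Proof.
move=> mD mg g0; apply: ge0_integral_pushforward => // y.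
by rewrite inE; exact: g0.
Qed.

Lemma integral_indic_mul (d : measure_display) (T : measurableType d)
    (R : realType) (m : {measure set T -> \bar R}) (D : set T) (g : T -> R) :
  (\int[m]_(x in D) (g x)%:E = \int[m]_x (g x * \1_D x)%:E)%E.
Proof.
rewrite integral_mkcond; apply: eq_integral => x _.
by rewrite /patch indicE; case: ifPn => _; rewrite ?mulr1 ?mulr0.
Qed.

Section density_measure.
Context (d : measure_display) (T : measurableType d) (R : realType).
Variables (m : {measure set T -> \bar R}) (r : T -> R).
Hypotheses (mr : measurable_fun setT r) (r0 : forall x, 0 <= r x).

(** Carrying the two proofs as arguments lets the measure instance be attached to this
    expression. *)
Definition density_fun of measurable_fun setT r & (forall x, 0 <= r x) :=
  fun A : set T => (\int[m]_(x in A) (r x)%:E)%E.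

Let density0 : density_fun mr r0 set0 = 0%E.
Proof. exact: integral_set0. Qed.

Let density_ge0 A : (0 <= density_fun mr r0 A)%E.
Proof. by apply: integral_ge0 => x _; rewrite lee_fin. Qed.

Let density_sigma_additive : semi_sigma_additive (density_fun mr r0).
Proof.
move=> F mF tF mUF; rewrite /density_fun ge0_integral_bigcup//.
- apply: is_cvg_ereal_nneg_natsum_cond => n _ _.
  by apply: integral_ge0 => x _; rewrite lee_fin.
- by apply/measurable_EFinP; exact: measurable_funTS.
- by move=> x _; rewrite lee_fin.
Qed.

HB.instance Definition _ := isMeasure.Build _ _ _
  (density_fun mr r0) density0 density_ge0 density_sigma_additive.

Definition density_measure : {measure set T -> \bar R} := density_fun mr r0.

Lemma ge0_integral_density_measure (f : T -> \bar R) :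
  measurable_fun setT f -> (forall x, (0 <= f x)%E) ->
  (\int[density_measure]_x f x = \int[m]_x (f x * (r x)%:E))%E.
Proof. by move=> mf f0; apply: ge0_integral_density. Qed.

End density_measure.

Section normal.
Context {R : realType}.
Implicit Types (m s t c x y z : R) (A D : set R).

Lemma measurable_affine t c :
  measurable_fun [set: R] (fun x => t * x + c : measurableTypeR R).
Proof. by apply: measurable_funD => //; exact: measurable_funM. Qed.

(** Multiplied by [t], the pushforward of Lebesgue measure under the affine map has the right value
    on half-open intervals, hence is Lebesgue measure by uniqueness. *)
Lemma lebesgue_measure_affine t c A : 0 < t -> measurable A ->
  lebesgue_measure ((fun x => t * x + c) @^-1` A) =
  (t^-1%:E * lebesgue_measure A)%E.
Proof.
move=> t0 mA.
have t0' : 0 <= t by exact: ltW.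
pose phi : R -> measurableTypeR R := fun x => t * x + c.
have mphi : measurable_fun setT phi by exact: measurable_affine.
pose m' := mscale (NngNum t0') (image_measure lebesgue_measure mphi).
rewrite (@lebesgue_measure_unique R m' _ A mA); last first.
  move=> /= _ [[a b]] _ <-; rewrite /m' /mscale /pushforward/=.
  pose I : set R := `](a - c) / t, (b - c) / t]%classic.
  transitivity (t%:E * lebesgue_measure I)%E; last first.
    congr (_ * lebesgue_measure _)%E.
    apply/seteqP; split => x; rewrite /I /phi/= !in_itv/= => /andP[].
      by rewrite ltr_pdivrMr// ler_pdivlMr// mulrC => ? ?; apply/andP; split; lra.
    by move=> ? ?; rewrite ltr_pdivrMr// ler_pdivlMr// mulrC; apply/andP; split; lra.
  rewrite /I !lebesgue_measure_itv/= !lte_fin ltr_pM2r ?invr_gt0// ltrD2r.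
  case: ifPn => _; last by rewrite mule0.
  rewrite -!EFinD -EFinM; congr EFin; field; exact: lt0r_neq0.
by rewrite /m' /mscale /pushforward/= muleA -EFinM mulVf ?lt0r_neq0// mul1e.
Qed.

(** Change of variables: the Jacobian [t] cancels against the factor [t^-1] in the peak of the
    density. This standardizes sums into z-scores and, for [t = 1], shifts means. *)
Lemma normal_prob_affine m s t c A : 0 < t -> 0 < s -> measurable A ->
  normal_prob (t * m + c) (t * s) A = normal_prob m s ((fun x => t * x + c) @^-1` A).
Proof.
move=> t0 s0 mA; rewrite /normal_prob.
have t0' : 0 <= t by exact: ltW.
pose phi : R -> measurableTypeR R := fun x => t * x + c.
have mphi : measurable_fun setT phi by exact: measurable_affine.
pose m' := mscale (NngNum t0') (image_measure lebesgue_measure mphi).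
have mpdf B m1 s1 : measurable_fun B (fun x : R => (normal_pdf m1 s1 x)%:E).
  by apply/measurable_EFinP; apply: measurable_funTS; exact: measurable_normal_pdf.
rewrite (eq_measure_integral m'); last first.
  move=> B mB BA; transitivity (t%:E * lebesgue_measure (phi @^-1` B))%E => //.
  rewrite lebesgue_measure_affine//.
  by rewrite muleA -EFinM divff ?lt0r_neq0// mul1e.
rewrite ge0_integral_mscale//; first last.
- by move=> x _; rewrite lee_fin normal_pdf_ge0.
- exact: mpdf.
rewrite ge0_integral_image_measure//; first last.
- by move=> x _; rewrite lee_fin normal_pdf_ge0.
- exact: mpdf.
have mphiA : measurable (phi @^-1` A).
  by rewrite -[X in measurable X]setTI; exact: (mphi measurableT _ mA).
rewrite -ge0_integralZl//; last 2 first.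
- by apply: measurable_funTS; exact: (measurableT_comp (mpdf setT (t * m + c) (t * s)) mphi).
- by move=> x _; rewrite lee_fin normal_pdf_ge0.
apply: eq_integral => x _ /=; rewrite -EFinM; congr EFin.
rewrite !normal_pdfE ?gt_eqF ?mulr_gt0// /normal_peak /normal_fun /phi.
rewrite exprMn -mulrA -mulrnAr sqrtrM ?sqr_ge0// sqrtr_sqr gtr0_norm// invfM.
rewrite !mulrA mulfV ?lt0r_neq0// mul1r; congr (_ * expR _).
have ->: t * x + c - (t * m + c) = t * (x - m) by ring.
by rewrite !exprMn; field; rewrite !lt0r_neq0.
Qed.

Lemma normal_prob_shift m s A : 0 < s -> measurable A ->
  normal_prob m s A = normal_prob 0 s ((fun x => x + m) @^-1` A).
Proof.
move=> s0 mA; have := @normal_prob_affine 0 s 1 m A ltr01 s0 mA.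
rewrite mulr0 add0r mul1r => ->; congr (normal_prob _ _ _).
by apply/seteqP; split => x /=; rewrite mul1r.
Qed.

Lemma ge0_integral_normal_prob m s (f : R -> \bar R) :
  measurable_fun setT f -> (forall x, (0 <= f x)%E) ->
  (\int[normal_prob m s]_x f x =
   \int[lebesgue_measure]_x (f x * (normal_pdf m s x)%:E))%E.
Proof.
move=> mf f0; apply: ge0_integral_density => //.
- exact: measurable_normal_pdf.
- by move=> x; exact: normal_pdf_ge0.
Qed.

(** After a shift, the probability is that of a section of the planar set of all [(m, x)] with
    [x + m] in [D], under one fixed law; measurability in [m] is that of section measures. *)
Lemma measurable_normal_prob_mean s D : 0 < s -> measurable D ->
  measurable_fun [set: R] (fun m => normal_prob m s D).
Proof.
move=> s0 mD.
rewrite (_ : (fun _ => _) =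
  (fun m => (normal_prob 0 s \o xsection [set xy : R * R | D (xy.2 + xy.1)]) m)); last first.
  apply/funext => m /=; rewrite normal_prob_shift//; congr (normal_prob _ _ _).
  by apply/seteqP; split => x /=; rewrite /xsection/= in_setE.
apply: measurable_fun_xsection.
rewrite -[X in measurable X]setTI; apply: measurable_funD => //.
Qed.

(** Completing the square in [x]. On the right stand the density of the sum and the conditional
    density of [x] given the sum, so that integrating out [x] is immediate. *)
Lemma normal_pdf_conv s t c x y : 0 < s -> 0 < t ->
  let q := Num.sqrt (s ^+ 2 + t ^+ 2) in
  normal_pdf (x + c) t y * normal_pdf 0 s x =
  normal_pdf c q y * normal_pdf ((y - c) * s ^+ 2 / q ^+ 2) (s * t / q) x.
Proof.
move=> s0 t0 q.
have q2 : q ^+ 2 = s ^+ 2 + t ^+ 2 by rewrite sqr_sqrtr// addr_ge0// sqr_ge0.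
have q2_gt0 : 0 < s ^+ 2 + t ^+ 2 by rewrite addr_gt0// exprn_gt0.
have q0 : 0 < q by rewrite sqrtr_gt0.
rewrite !normal_pdfE ?gt_eqF ?divr_gt0 ?mulr_gt0// /normal_peak /normal_fun.
have peakE r : 0 < r -> Num.sqrt (r ^+ 2 * pi *+ 2) = r * Num.sqrt (pi *+ 2) :> R.
  by move=> r0; rewrite -mulrnAr sqrtrM ?sqr_ge0// sqrtr_sqr gtr0_norm.
rewrite !peakE ?divr_gt0 ?mulr_gt0//.
have pi0 : 0 < Num.sqrt (pi *+ 2 : R) by rewrite sqrtr_gt0 pmulrn_lgt0// pi_gt0.
set w := Num.sqrt _ in pi0 *.
rewrite [LHS]mulrACA [RHS]mulrACA -!expRD.
congr (_ * expR _); first by field; rewrite !lt0r_neq0.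
rewrite !exprMn !exprVn q2; field.
by rewrite !lt0r_neq0.
Qed.

Lemma normal_prob_conv s t c D : 0 < s -> 0 < t -> measurable D ->
  (normal_prob 0 s \x normal_prob 0 t)%E [set xy : R * R | D (xy.1 + xy.2 + c)] =
  normal_prob c (Num.sqrt (s ^+ 2 + t ^+ 2)) D.
Proof.
move=> s0 t0 mD; rewrite /product_measure1/=.
set q := Num.sqrt _.
have q2_gt0 : 0 < s ^+ 2 + t ^+ 2 by rewrite addr_gt0// exprn_gt0.
have q0 : 0 < q by rewrite sqrtr_gt0.
transitivity (\int[normal_prob 0 s]_x normal_prob (x + c) t D)%E.
  apply: eq_integral => x _ /=; rewrite (normal_prob_shift (x + c))//.
  congr (normal_prob _ _ _); apply/seteqP; split => y /=;
  by rewrite /xsection/= in_setE/= addrAC addrC.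
rewrite ge0_integral_normal_prob//; last first.
  apply: (measurableT_comp (measurable_normal_prob_mean t0 mD)).
  exact: measurable_funD.
pose h (xy : R * R) : \bar R :=
  (normal_pdf (xy.1 + c) t xy.2 * normal_pdf 0 s xy.1 * \1_D xy.2)%:E.
have h0 xy : (0 <= h xy)%E.
  by rewrite lee_fin mulr_ge0// mulr_ge0// normal_pdf_ge0.
have mh : measurable_fun setT h.
  apply/measurable_EFinP; apply: measurable_funM; last exact: measurableT_comp.
  apply: measurable_funM; last first.
    by apply: measurableT_comp => //; exact: measurable_normal_pdf.
  rewrite (_ : (fun _ => _) = normal_pdf 0 t \o (fun xy : R * R => xy.2 - (xy.1 + c))).
    apply: measurableT_comp; first exact: measurable_normal_pdf.
    by apply: measurable_funB => //; exact: measurable_funD.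
  by apply/funext => xy; rewrite /= !normal_pdfE ?gt_eqF// /normal_fun subr0.
transitivity (\int[lebesgue_measure]_x \int[lebesgue_measure]_y h (x, y))%E.
  apply: eq_integral => x _.
  rewrite /normal_prob integral_indic_mul// -ge0_integralZr//; last 3 first.
  - apply/measurable_EFinP; apply: measurable_funM => //.
    exact: measurable_normal_pdf.
  - by move=> y _; rewrite lee_fin mulr_ge0 ?normal_pdf_ge0.
  - by rewrite lee_fin normal_pdf_ge0.
  by apply: eq_integral => y _; rewrite /h -EFinM/= mulrAC.
rewrite fubini_tonelli// /normal_prob [RHS]integral_indic_mul//.
apply: eq_integral => y _.
under eq_integral do rewrite /h/= normal_pdf_conv// mulrAC EFinM.
rewrite ge0_integralZl//; first by rewrite integral_normal_pdf mule1.
- by apply/measurable_EFinP; exact: measurable_normal_pdf.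
- by move=> x _; rewrite lee_fin normal_pdf_ge0.
- by rewrite lee_fin mulr_ge0 ?normal_pdf_ge0.
Qed.

End normal.

(** * Sums of conditionally normal variables *)

Section normal_sums.
Context {R : realType} (d : measure_display) (Omega : measurableType d)
  (P : probability Omega R).

(* Both sides come from finite measures on the plane which agree on rectangles.
   The weight r carries the observations other than Y1 and Y2, so that the
   lemma can be iterated. *)
Lemma conditionally_normal_add (S : set Omega) (r M1 M2 Y1 Y2 : Omega -> R)
    (s t : R) :
  measurable S -> measurable_fun setT r -> (forall w, 0 <= r w) ->
  measurable_fun setT M1 -> measurable_fun setT M2 ->
  measurable_fun setT Y1 -> measurable_fun setT Y2 -> 0 < s -> 0 < t ->
  (forall B1 B2, measurable B1 -> measurable B2 ->
    P (S `&` Y1 @^-1` B1 `&` Y2 @^-1` B2) =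
    (\int[P]_w (normal_prob (M1 w) s B1 * normal_prob (M2 w) t B2 * (r w)%:E))%E) ->
  forall D, measurable D ->
    P (S `&` (Y1 \+ Y2) @^-1` D) =
    (\int[P]_w (normal_prob (M1 w + M2 w)%R (Num.sqrt (s ^+ 2 + t ^+ 2)) D *
      (r w)%:E))%E.
Proof.
move=> mS mr r0 mM1 mM2 mY1 mY2 s0 t0 hyp D mD.
pose Y w := (Y1 w, Y2 w).
have mY : measurable_fun setT Y by exact: measurable_fun_pair.
pose phi (v : Omega * (R * R)) := (v.2.1 + M1 v.1, v.2.2 + M2 v.1).
have mphi : measurable_fun setT phi.
  apply: measurable_fun_pair; apply: measurable_funD.
  - exact: (measurableT_comp measurable_fst measurable_snd).
  - exact: measurableT_comp.
  - exact: (measurableT_comp measurable_snd measurable_snd).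
  - exact: measurableT_comp.
pose NN : probability (measurableTypeR R * measurableTypeR R)%type R :=
  (normal_prob (0 : R) s \x normal_prob (0 : R) t)%E.
pose dP := density_measure P mr r0.
pose l1 := image_measure (mrestr P mS) mY.
pose PN : {measure set (Omega * (measurableTypeR R * measurableTypeR R))%type -> \bar R} := (dP \x NN)%E.
pose l2 := image_measure PN mphi.
have l2E A : measurable A ->
    l2 A = (\int[P]_w (NN (xsection (phi @^-1` A) w) * (r w)%:E))%E.
  move=> mA.
  have mphiA : measurable (phi @^-1` A).
    by rewrite -[X in measurable X]setTI; exact: (mphi measurableT _ mA).
  transitivity (\int[dP]_w NN (xsection (phi @^-1` A) w))%E => //.
  rewrite ge0_integral_density_measure//.
  exact: measurable_fun_xsection.
have l12 A : measurable A -> l1 A = l2 A.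
  pose C : set (set (R * R)) :=
    [set C | exists A, measurable A /\ exists B, measurable B /\ C = A `*` B].
  move=> mA; apply: (measure_unique C (fun=> setT)) => //.
  - rewrite measurable_prod_measurableType //; congr (<<s _ >>).
    rewrite predeqE; split => [[X mX [Z mZ <-]]|[X [mX [Z [mZ ->]]]]].
      by exists X; split => //; exists Z.
    by exists X => //; exists Z.
  - move=> /= _ _ [X1 [mX1 [X2 [mX2 ->]]]] [Z1 [mZ1 [Z2 [mZ2 ->]]]].
    rewrite -setXI; exists (X1 `&` Z1); split; first exact: measurableI.
    by exists (X2 `&` Z2); split => //; exact: measurableI.
  - by move=> n; exists setT; split => //; exists setT; split => //; rewrite setXTT.
  - by rewrite bigcup_const.
  - move=> _ [X [mX [Z [mZ ->]]]].
    rewrite l2E; last exact: measurableX.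
    transitivity (P (S `&` Y1 @^-1` X `&` Y2 @^-1` Z)).
      rewrite /l1 /image_measure /=/pushforward /mrestr/=; congr (P _).
      by apply/seteqP; split => w /=; rewrite /Y/=; tauto.
    rewrite hyp//; apply: eq_integral => w _; congr (_ * _)%E.
    rewrite [in LHS]normal_prob_shift// [X in (_ * X)%E = _]normal_prob_shift//.
    rewrite -product_measure1E; first congr (NN _).
    + by apply/seteqP; split => v /=; rewrite /xsection/= in_setE.
    + rewrite -[X in measurable X]setTI.
      have h : measurable_fun setT (fun x : R => x + M1 w) by exact: measurable_funD.
      exact: (h measurableT _ mX).
    + rewrite -[X in measurable X]setTI.
      have h : measurable_fun setT (fun x : R => x + M2 w) by exact: measurable_funD.
      exact: (h measurableT _ mZ).
  - move=> n; rewrite /l1 /image_measure/= /pushforward /mrestr/=.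
    by rewrite (le_lt_trans (probability_le1 _ _)) ?ltry// preimage_setT setTI.
pose A := [set xy : R * R | D (xy.1 + xy.2)].
have mA : measurable A.
  rewrite -[X in measurable X]setTI.
  have h : measurable_fun setT (fun xy : R * R => xy.1 + xy.2) by exact: measurable_funD.
  exact: (h measurableT _ mD).
transitivity (l1 A).
  rewrite /l1 /image_measure/= /pushforward /mrestr/=; congr (P _).
  by rewrite setIC.
rewrite l12// l2E; last exact: mA.
apply: eq_integral => w _; congr (_ * _)%E.
rewrite -(normal_prob_conv _ s0 t0 mD); congr (NN _).
apply/seteqP; split => v /=; rewrite /xsection/= in_setE/= /phi /A/=;
  by rewrite addrACA.
Qed.

End normal_sums.

Section conditionally_normal.
Context {R : realType}.

Definition normal_mass (m s : R) (B : set R) : R := fine (normal_prob m s B).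

Lemma normal_massE (m s : R) (B : set R) : measurable B ->
  (normal_mass m s B)%:E = normal_prob m s B.
Proof. by move=> mB; rewrite fineK// fin_num_measure. Qed.

Lemma normal_mass_ge0 (m s : R) (B : set R) : 0 <= normal_mass m s B.
Proof. exact: fine_ge0. Qed.

Lemma measurable_normal_mass (s : R) (B : set R) : 0 < s -> measurable B ->
  measurable_fun setT (fun m : R => normal_mass m s B).
Proof.
move=> s0 mB; apply/measurable_EFinP.
rewrite (_ : _ \o _ = fun m : R => normal_prob m s B).
  exact: measurable_normal_prob_mean.
by apply/funext => m /=; rewrite normal_massE.
Qed.

Lemma forall_ordS n (Q : 'I_n.+1 -> Prop) :
  (forall i, Q i) <-> Q ord0 /\ forall i : 'I_n, Q (lift ord0 i).
Proof.
split => [h|[h0 h] i]; first by split.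
by have [j ->|->] := unliftP ord0 i.
Qed.

Context (d : measure_display) (Omega : measurableType d)
  (P : probability Omega R).

Lemma measurable_forall_ord n (Y : 'I_n -> Omega -> R) (B : 'I_n -> set R) :
  (forall i, measurable_fun setT (Y i)) -> (forall i, measurable (B i)) ->
  measurable [set w | forall i, B i (Y i w)].
Proof.
move=> mY mB.
rewrite (_ : [set _ | _] = \bigcap_(i in [set: 'I_n]) (Y i @^-1` B i)).
  apply: fin_bigcap_measurable => // i _.
  by rewrite -[X in measurable X]setTI; exact: (mY i measurableT _ (mB i)).
by apply/seteqP; split => w /=; [move=> h i _; exact: h|move=> h i; exact: h].
Qed.

Lemma measurable_sum_ord n (Y : 'I_n -> Omega -> R) :
  (forall i, measurable_fun setT (Y i)) ->
  measurable_fun setT (fun w => \sum_(i < n) Y i w).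
Proof. by move=> mY; apply: measurable_sum. Qed.

(** Induction on the number of summands. The constraint that the first variable lies in [B1] is
    moved into [S] and its conditional probability into the weight [r], so that the induction
    hypothesis applies to the others; [conditionally_normal_add] then merges the first variable with
    their sum. *)
Lemma conditionally_normal_sum n (S : set Omega) (r M : Omega -> R)
    (Y : 'I_n.+1 -> Omega -> R) (s : R) :
  measurable S -> measurable_fun setT r -> (forall w, 0 <= r w) ->
  measurable_fun setT M -> (forall j, measurable_fun setT (Y j)) -> 0 < s ->
  (forall B : 'I_n.+1 -> set R, (forall j, measurable (B j)) ->
    P (S `&` [set w | forall j, B j (Y j w)]) =
    (\int[P]_w ((\prod_(j < n.+1) normal_mass (M w) s (B j)) * r w)%:E)%E) ->
  forall D, measurable D ->
    P (S `&` [set w | D (\sum_(j < n.+1) Y j w)]) =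
    (\int[P]_w (normal_mass (n.+1%:R * M w) (Num.sqrt n.+1%:R * s) D * r w)%:E)%E.
Proof.
elim: n S r Y => [|n IH] S r Y mS mr r0 mM mY s0 hyp D mD.
  rewrite (_ : [set w | _] = [set w | forall j : 'I_1, D (Y j w)]).
    rewrite (hyp (fun=> D))//; apply: eq_integral => w _.
    by rewrite big_ord1 mul1r sqrtr1 mul1r.
  apply/seteqP; split => w /=; rewrite big_ord1 => h; last exact: h.
  by move=> j; rewrite ord1.
have sqrtn0 : 0 < Num.sqrt n.+1%:R * s by rewrite mulr_gt0// sqrtr_gt0.
have -> : Num.sqrt n.+2%:R * s =
    Num.sqrt (s ^+ 2 + (Num.sqrt n.+1%:R * s) ^+ 2) :> R.
  rewrite exprMn sqr_sqrtr ?ler0n// -[X in X + _]mul1r -mulrDl nat1r.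
  by rewrite sqrtrM ?ler0n// sqrtr_sqr gtr0_norm.
pose Y' w := \sum_(j < n.+1) Y (lift ord0 j) w.
have mY' : measurable_fun setT Y' by apply: measurable_sum_ord => j; exact: mY.
rewrite (_ : [set w | _] = (Y ord0 \+ Y') @^-1` D); last first.
  by apply/seteqP; split => w /=; rewrite big_ord_recl.
rewrite (@conditionally_normal_add _ _ _ _ S r M (fun w => n.+1%:R * M w)
    (Y ord0) Y' s (Num.sqrt n.+1%:R * s))//.
- apply: eq_integral => w _; rewrite EFinM normal_massE; last exact: mD.
  by rewrite (_ : n.+2%:R * M w = M w + n.+1%:R * M w)// mulrSr mulrDl mul1r addrC.
- exact: measurable_funM.
- move=> B1 B2 mB1 mB2.
  have mS' : measurable (S `&` Y ord0 @^-1` B1).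
    apply: measurableI => //.
    by rewrite -[X in measurable X]setTI; exact: (mY ord0 measurableT _ mB1).
  pose r' w := normal_mass (M w) s B1 * r w.
  have mr' : measurable_fun setT r'.
    apply: measurable_funM => //.
    by apply: (measurableT_comp (measurable_normal_mass s0 mB1)).
  rewrite (IH (S `&` Y ord0 @^-1` B1) r' (fun j => Y (lift ord0 j)))//.
  + apply: eq_integral => w _.
    by rewrite -!normal_massE// -!EFinM /r' mulrCA mulrA.
  + by move=> w; rewrite mulr_ge0 ?normal_mass_ge0.
  + move=> B mB.
    pose B' j := if unlift ord0 j is Some i then B i else B1.
    have mB' j : measurable (B' j) by rewrite /B'; case: unlift.
    rewrite -setIA (_ : Y ord0 @^-1` B1 `&` _ = [set w | forall j, B' j (Y j w)]).
      rewrite hyp//; apply: eq_integral => w _; rewrite big_ord_recl /r' mulrA.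
      congr ((_ * _)%:E); rewrite mulrC; congr (_ * _).
        by apply: eq_bigr => j _; rewrite /B' liftK.
      by rewrite /B' unlift_none.
    apply/seteqP; split => w /=; rewrite (forall_ordS (fun j => B' j (Y j w)));
      rewrite /B' unlift_none => -[h1 h2]; split => // j; move: (h2 j);
      by rewrite liftK.
Qed.

(** One column at a time, the other columns being absorbed into [S] and [r]. Column 0 is summed with
    the others already summed, and the induction hypothesis for the others is used with the raw
    observations of column 0. *)
Lemma conditionally_normal_sums m n (S : set Omega) (r : Omega -> R)
    (M : 'I_m -> Omega -> R) (Y : 'I_m -> 'I_n.+1 -> Omega -> R) (s : R) :
  measurable S -> measurable_fun setT r -> (forall w, 0 <= r w) ->
  (forall i, measurable_fun setT (M i)) ->
  (forall i j, measurable_fun setT (Y i j)) -> 0 < s ->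
  (forall B : 'I_m -> 'I_n.+1 -> set R, (forall i j, measurable (B i j)) ->
    P (S `&` [set w | forall i j, B i j (Y i j w)]) =
    (\int[P]_w ((\prod_(i < m) \prod_(j < n.+1) normal_mass (M i w) s (B i j)) *
      r w)%:E)%E) ->
  forall D : 'I_m -> set R, (forall i, measurable (D i)) ->
    P (S `&` [set w | forall i, D i (\sum_(j < n.+1) Y i j w)]) =
    (\int[P]_w ((\prod_(i < m)
      normal_mass (n.+1%:R * M i w) (Num.sqrt n.+1%:R * s) (D i)) * r w)%:E)%E.
Proof.
elim: m S r M Y => [|m IH] S r M Y mS mr r0 mM mY s0 hyp D mD.
  rewrite (_ : [set w | _] = [set w | forall (i : 'I_0) (j : 'I_n.+1), setT (Y i j w)]).
    rewrite (hyp (fun _ _ => setT))//; apply: eq_integral => w _.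
    by rewrite !big_ord0.
  by apply/seteqP; split => w /= _ [].
have sq0 : 0 < Num.sqrt n.+1%:R * s by rewrite mulr_gt0// sqrtr_gt0.
pose D' i := D (lift ord0 i).
pose E' := [set w | forall i, D' i (\sum_(j < n.+1) Y (lift ord0 i) j w)].
have mE' : measurable E'.
  by apply: measurable_forall_ord => i; [exact: measurable_sum_ord|exact: mD].
pose r'' w := (\prod_(i < m)
  normal_mass (n.+1%:R * M (lift ord0 i) w) (Num.sqrt n.+1%:R * s) (D' i)) * r w.
have mr'' : measurable_fun setT r''.
  apply: measurable_funM => //; apply: measurable_prod => i _.
  apply: (measurableT_comp (measurable_normal_mass sq0 (mD _))).
  exact: measurable_funM.
rewrite (_ : S `&` _ = (S `&` E') `&` [set w | D ord0 (\sum_(j < n.+1) Y ord0 j w)]).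
  rewrite (@conditionally_normal_sum n (S `&` E') r'' (M ord0) (Y ord0) s)//.
  - apply: eq_integral => w _; rewrite big_ord_recl /r'' mulrA//.
  - exact: measurableI.
  - move=> w; rewrite mulr_ge0// prodr_ge0// => i _; exact: normal_mass_ge0.
  move=> B mB.
  have mSB : measurable (S `&` [set w | forall j, B j (Y ord0 j w)]).
    by apply: measurableI => //; exact: measurable_forall_ord.
  pose r' w := (\prod_(j < n.+1) normal_mass (M ord0 w) s (B j)) * r w.
  have mr' : measurable_fun setT r'.
    apply: measurable_funM => //; apply: measurable_prod => j _.
    exact: (measurableT_comp (measurable_normal_mass s0 (mB _))).
  rewrite setIAC (IH (S `&` [set w | forall j, B j (Y ord0 j w)]) r'
    (fun i => M (lift ord0 i)) (fun i => Y (lift ord0 i)))//.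
  - by apply: eq_integral => w _; rewrite /r' /r'' mulrCA.
  - by move=> w; rewrite mulr_ge0// prodr_ge0// => i _; exact: normal_mass_ge0.
  - move=> B0 mB0.
    pose B' i j := if unlift ord0 i is Some k then B0 k j else B j.
    have mB' i j : measurable (B' i j) by rewrite /B'; case: unlift.
    rewrite -setIA (_ : [set w | forall j, B j (Y ord0 j w)] `&` _ =
      [set w | forall i j, B' i j (Y i j w)]).
      rewrite hyp//; apply: eq_integral => w _; rewrite big_ord_recl /r' mulrA.
      congr ((_ * _)%:E); rewrite mulrC; congr (_ * _).
        by apply: eq_bigr => i _; apply: eq_bigr => j _; rewrite /B' liftK.
      by apply: eq_bigr => j _; rewrite /B' unlift_none.
    apply/seteqP; split => w /=;
      rewrite (forall_ordS (fun i => forall j, B' i j (Y i j w)));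
      rewrite /B' unlift_none => -[h1 h2]; split => // i; move: (h2 i);
      by rewrite liftK.
  - by move=> i; exact: mD.
apply/seteqP; split => w /=; rewrite (forall_ordS (fun i => D i (\sum_(j < n.+1) Y i j w))) /E'/=; tauto.
Qed.

End conditionally_normal.

(** * Joint law of the effects and the z-scores *)

Section independence.
Context {R : realType} (d : measure_display) (Omega : measurableType d)
  (P : probability Omega R) (eta : {measure set (measurableTypeR R) -> \bar R}).
Hypothesis eta1 : eta setT = 1%E.

Lemma ge0_integral_law (r U : Omega -> R) (c : R) (g : R -> R) :
  measurable_fun setT r -> (forall w, 0 <= r w) -> measurable_fun setT U ->
  0 <= c ->
  (forall A, measurable A ->
    (\int[P]_(w in U @^-1` A) (r w)%:E = c%:E * eta A)%E) ->
  measurable_fun setT g -> (forall x, 0 <= g x) ->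
  (\int[P]_w (g (U w) * r w)%:E = c%:E * \int[eta]_x (g x)%:E)%E.
Proof.
move=> mr r0 mU c0 hyp mg g0.
have mg' : measurable_fun setT (EFin \o g) by exact/measurable_EFinP.
have mU' : measurable_fun setT (U : Omega -> measurableTypeR R) by [].
transitivity (\int[image_measure (density_measure P mr r0) mU']_x (g x)%:E)%E.
  rewrite ge0_integral_image_measure//; last by move=> x _; rewrite lee_fin.
  rewrite preimage_setT ge0_integral_density_measure//.
  - exact: (measurableT_comp mg' mU).
  - by move=> w; rewrite lee_fin.
transitivity (\int[mscale (NngNum c0) eta]_x (g x)%:E)%E.
  by apply: eq_measure_integral => A mA _; exact: (hyp A mA).
by rewrite ge0_integral_mscale// => x _; rewrite lee_fin.
Qed.

Lemma measurable_preimage (U : Omega -> R) (A : set R) :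
  measurable_fun setT U -> measurable A -> measurable (U @^-1` A).
Proof. by move=> mU mA; rewrite -[X in measurable X]setTI; exact: mU. Qed.

Lemma law_fin_num A : measurable A -> eta A \is a fin_num.
Proof.
move=> mA; rewrite ge0_fin_numE//.
by rewrite (@le_lt_trans _ _ (eta setT)) ?le_measure ?inE ?eta1 ?ltry.
Qed.

Lemma integral_law_fin_num (g : R -> R) : measurable_fun setT g ->
  (forall x, 0 <= g x <= 1) -> (\int[eta]_x (g x)%:E)%E \is a fin_num.
Proof.
move=> mg g01; rewrite ge0_fin_numE; last first.
  by apply: integral_ge0 => x _; rewrite lee_fin; case/andP: (g01 x).
rewrite (@le_lt_trans _ _ (\int[eta]_x (cst 1%E x)))%E//; last first.
  by rewrite integral_cst//= mul1e eta1 ltry.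
apply: ge0_le_integral => //.
- by move=> x _; rewrite lee_fin; case/andP: (g01 x).
- exact/measurable_EFinP.
- by move=> x _; rewrite lee_fin; case/andP: (g01 x).
Qed.

(** From rectangles to products of functions, one coordinate at a time: the indicator of the first
    coordinate goes into the weight [r] and its probability into [c], and the induction hypothesis
    covers the remaining coordinates. *)
Lemma integral_prod_independent m (r : Omega -> R) (U : 'I_m -> Omega -> R)
    (c : R) (g : 'I_m -> R -> R) :
  measurable_fun setT r -> (forall w, 0 <= r w) ->
  (forall i, measurable_fun setT (U i)) -> 0 <= c ->
  (forall A : 'I_m -> set R, (forall i, measurable (A i)) ->
    (\int[P]_(w in [set w | forall i, A i (U i w)]) (r w)%:E =
     c%:E * \prod_(i < m) eta (A i))%E) ->
  (forall i, measurable_fun setT (g i)) -> (forall i x, 0 <= g i x <= 1) ->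
  (\int[P]_w ((\prod_(i < m) g i (U i w)) * r w)%:E =
   c%:E * \prod_(i < m) \int[eta]_x (g i x)%:E)%E.
Proof.
elim: m r U c g => [|m IH] r U c g mr r0 mU c0 hyp mg g01.
  have := hyp (fun=> setT) (fun=> measurableT); rewrite !big_ord0 => <-.
  rewrite (_ : [set w | _] = setT); last by apply/seteqP; split => // w _ [].
  by apply: eq_integral => w _; rewrite big_ord0 mul1r.
pose r' w := (\prod_(i < m) g (lift ord0 i) (U (lift ord0 i) w)) * r w.
have g0 i x : 0 <= g i x by case/andP: (g01 i x).
have r'0 w : 0 <= r' w by rewrite mulr_ge0// prodr_ge0.
have mr' : measurable_fun setT r'.
  apply: measurable_funM => //; apply: measurable_prod => i _.
  exact: (measurableT_comp (mg _) (mU _)).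
pose c' := c * \prod_(i < m) fine (\int[eta]_x (g (lift ord0 i) x)%:E)%E.
have c'E : (c'%:E = c%:E * \prod_(i < m) \int[eta]_x (g (lift ord0 i) x)%:E)%E.
  rewrite /c' EFinM -prodEFin; congr (_ * _)%E; apply: eq_bigr => i _.
  by rewrite fineK// integral_law_fin_num.
have c'0 : 0 <= c'.
  rewrite mulr_ge0// prodr_ge0// => i _; apply: fine_ge0.
  by apply: integral_ge0 => x _; rewrite lee_fin.
transitivity (c'%:E * \int[eta]_x (g ord0 x)%:E)%E; last first.
  by rewrite big_ord_recl c'E [RHS]muleCA muleC.
rewrite -(@ge0_integral_law r' (U ord0))//.
  by apply: eq_integral => w _; rewrite big_ord_recl /r' mulrA.
move=> A0 mA0.
have mU0 := measurable_preimage (mU ord0) mA0.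
pose r0' w := \1_(U ord0 @^-1` A0) w * r w.
have mr0' : measurable_fun setT r0' by apply: measurable_funM.
transitivity (\int[P]_w ((\prod_(i < m) g (lift ord0 i) (U (lift ord0 i) w)) *
    r0' w)%:E)%E.
  rewrite integral_indic_mul; apply: eq_integral => w _.
  by rewrite /r' /r0' mulrAC mulrA.
rewrite (IH r0' (fun i => U (lift ord0 i)) (c * fine (eta A0))
  (fun i => g (lift ord0 i)))//.
- by rewrite c'E EFinM fineK ?law_fin_num// muleAC.
- by move=> w; rewrite mulr_ge0.
- by rewrite mulr_ge0// fine_ge0.
move=> A mA.
pose A' i := if unlift ord0 i is Some k then A k else A0.
have mA' i : measurable (A' i) by rewrite /A'; case: unlift.
transitivity (\int[P]_(w in [set w | forall i, A' i (U i w)]) (r w)%:E)%E.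
  rewrite [LHS]integral_indic_mul [RHS]integral_indic_mul; apply: eq_integral => w _; congr EFin.
  rewrite /r0' mulrAC mulrC; congr (_ * _); rewrite !indicE.
  rewrite -natrM mulnb; congr (_%:R : R); congr nat_of_bool.
  apply/idP/idP; rewrite !inE/= (forall_ordS (fun i => A' i (U i w))).
    rewrite /A' unlift_none => /andP[]; rewrite !inE => h1 h2; split => // i.
    by rewrite liftK; apply: h2.
  rewrite /A' unlift_none => -[h1 h2]; apply/andP; split; rewrite inE//= => i.
  by have := h2 i; rewrite liftK.
rewrite hyp// big_ord_recl EFinM fineK ?law_fin_num// muleA.
congr (_ * _ * _)%E; first by rewrite /A' unlift_none.
by apply: eq_bigr => i _; rewrite /A' liftK.
Qed.

End independence.

Section joint_law.
Context {R : realType}.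

(** The bundled counterpart of [effect_law], needed to integrate against it. *)
Definition effect_measure (p : R) (p0 : 0 <= p) (p1 : 0 <= 1 - p)
    (nu : probability (measurableTypeR R) R) :
    {measure set (measurableTypeR R) -> \bar R} :=
  measure_add (mscale (NngNum p1) (dirac (0 : measurableTypeR R))) (mscale (NngNum p0) nu).

Lemma effect_measureE p (p0 : 0 <= p) (p1 : 0 <= 1 - p) nu A :
  effect_measure p0 p1 nu A = effect_law p nu A.
Proof.
exact: (measure_addE (mscale (NngNum p1) (dirac (0 : measurableTypeR R)))
  (mscale (NngNum p0) nu)).
Qed.

Lemma ge0_integral_effect_measure p (p0 : 0 <= p) (p1 : 0 <= 1 - p)
    (nu : probability (measurableTypeR R) R) (g : R -> R) :
  measurable_fun setT g -> (forall x, 0 <= g x) ->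
  (\int[effect_measure p0 p1 nu]_x (g x)%:E =
   (1 - p)%:E * (g 0)%:E + p%:E * \int[nu]_x (g x)%:E)%E.
Proof.
move=> mg g0.
have mg' : measurable_fun setT (EFin \o g) by exact/measurable_EFinP.
rewrite ge0_integral_measure_add//; last by move=> x _; rewrite lee_fin.
rewrite !ge0_integral_mscale//; try by move=> x _; rewrite lee_fin.
by rewrite integral_dirac// diracT mul1e.
Qed.

(** The law of the z-score of a false null hypothesis, for [s] the standard deviation
    [sigma / sqrt n] of a sample mean: given the effect [t], the z-score is N(t / s, 1). *)
Definition alt_law (s : R) (nu : probability (measurableTypeR R) R)
    (D : set R) : R :=
  fine (\int[nu]_t (normal_mass (t / s) 1 D)%:E)%E.

(** The law of one pair formed by the truth value of [mu_i != 0] and the z-score. *)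
Definition mark_mass (p s : R) (nu : probability (measurableTypeR R) R)
    (h : bool) (D : set R) : R :=
  if h then p * alt_law s nu D else (1 - p) * normal_mass 0 1 D.

Definition zscore (n m : nat) (sigma : R) (x : 'I_n -> 'I_m -> R) (i : 'I_m) : R :=
  Num.sqrt n%:R * sample_mean x i / sigma.

Lemma measurable_normal_mass_scaled (s : R) (D : set R) : measurable D ->
  measurable_fun setT (fun t : R => normal_mass (t / s) 1 D).
Proof.
move=> mD; apply: (measurableT_comp (measurable_normal_mass ltr01 mD)).
exact: measurable_funM.
Qed.

Lemma normal_mass_le1 (m s : R) (B : set R) : measurable B -> normal_mass m s B <= 1.
Proof. by move=> mB; rewrite -lee_fin normal_massE// probability_le1. Qed.

Lemma alt_lawE s nu (D : set R) : measurable D ->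
  ((alt_law s nu D)%:E = \int[nu]_t (normal_mass (t / s) 1 D)%:E)%E.
Proof.
move=> mD; rewrite /alt_law fineK//.
have := @integral_law_fin_num R nu (probability_setT nu)
  (fun t => normal_mass (t / s) 1 D) (measurable_normal_mass_scaled s mD).
by apply=> x; rewrite normal_mass_ge0 normal_mass_le1.
Qed.

(** The sums over replicates are conditionally normal by [conditionally_normal_sums]; what remains
    is an integral over the effects, which [integral_prod_independent] factorizes. The events on the
    effects enter as the sets [A i], those on the z-scores as the rescaled sets [D' i]. *)
Lemma joint_law (m n : nat) (p sigma : R)
    (nu : probability (measurableTypeR R) R)
    (d : measure_display) (Omega : measurableType d) (P : probability Omega R)
    (mu : 'I_m -> {RV P >-> R}) (X : 'I_n -> 'I_m -> {RV P >-> R})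
    (H : 'I_m -> bool) (D : 'I_m -> set R) :
  0 < sigma -> (0 < n)%N -> 0 < p < 1 -> nu [set 0] = 0%E ->
  two_groups_model p sigma nu mu X -> (forall i, measurable (D i)) ->
  P [set w | forall i, (mu i w != 0) = H i /\
                       D i (zscore sigma (fun j i => X j i w) i)] =
  (\prod_(i < m) mark_mass p (sigma / Num.sqrt n%:R) nu (H i) (D i))%:E.
Proof.
case: n X => // n X sg0 _ /andP[p0 p1] nu0 [Hmu HX] mD.
have sq0 : 0 < Num.sqrt n.+1%:R :> R by rewrite sqrtr_gt0.
have p0' := ltW p0; have p1' : 0 <= 1 - p by rewrite subr_ge0 ltW.
pose eta := effect_measure p0' p1' nu.
have eta1 : eta setT = 1%E.
  rewrite /eta effect_measureE /effect_law diracT probability_setT !mule1.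
  by rewrite -EFinD subrK.
pose A i : set R := if H i then ~` [set 0] else [set 0].
have mA i : measurable (A i).
  by rewrite /A; case: ifP => // _; apply: measurableC.
pose S := [set w | forall i, A i (mu i w)].
have mS : measurable S by apply: measurable_forall_ord.
pose D' i := (fun y : R => (Num.sqrt n.+1%:R * sigma)^-1 * y + 0) @^-1` D i.
have mD' i : measurable (D' i).
  rewrite /D' -[X in measurable X]setTI.
  exact: (measurable_affine _ _ measurableT (mD i)).
pose g i x := \1_(A i) x * normal_mass (n.+1%:R * x) (Num.sqrt n.+1%:R * sigma) (D' i).
have sns : 0 < Num.sqrt n.+1%:R * sigma by rewrite mulr_gt0.
have mg i : measurable_fun setT (g i).
  apply: measurable_funM => //.
  apply: (measurableT_comp (measurable_normal_mass sns (mD' i))).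
  exact: measurable_funM.
have gE x i : normal_mass (n.+1%:R * x) (Num.sqrt n.+1%:R * sigma) (D' i) =
    normal_mass (x / (sigma / Num.sqrt n.+1%:R)) 1 (D i).
  have tn : 0 < (Num.sqrt n.+1%:R * sigma)^-1 by rewrite invr_gt0.
  rewrite /normal_mass /D' -(normal_prob_affine _ _ tn sns (mD i)).
  rewrite mulVf; last by rewrite gt_eqF.
  rewrite addr0 (_ : _^-1 * _ = x / (sigma / Num.sqrt n.+1%:R)); first by [].
  rewrite -[X in X * x](@sqr_sqrtr _ n.+1%:R) ?ler0n// expr2.
  by field; rewrite !gt_eqF.
rewrite (_ : [set w | _] = S `&` [set w | forall i, D' i (\sum_(j < n.+1) X j i w)]).
  rewrite (@conditionally_normal_sums _ _ _ P m n S \1_S mu (fun i j => X j i) sigma)//.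
  - rewrite -prodEFin.
    have := @integral_prod_independent _ _ _ P eta eta1 m (cst 1) mu 1 g.
    move=> Hprod.
    transitivity (\int[P]_w (\prod_(i < m) g i (mu i w) * 1)%:E)%E.
      apply: eq_integral => w _; rewrite mulr1 /g big_split/= mulrC.
      congr ((_ * _)%:E); rewrite indicE; case: (pselect (S w)) => [Sw|nSw].
        by rewrite mem_set// big1// => i _; rewrite indicE mem_set.
      rewrite memNset//; apply/esym/eqP; rewrite prodf_seq_eq0.
      apply/hasP; move/existsNP : nSw => [i Ai]; exists i; first by rewrite mem_index_enum.
      by rewrite /= indicE memNset// eqxx.
    have law_mu B : (forall i, measurable (B i)) ->
        (\int[P]_(w in [set w | forall i, B i (mu i w)]) (cst 1 w)%:E =
         \prod_(i < m) eta (B i))%E.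
      move=> mB; rewrite (eq_integral (cst 1%E))// integral_cst//; last exact: measurable_forall_ord.
      rewrite mul1e; apply: (etrans (Hmu B mB)); apply: eq_bigr => i _.
      by rewrite effect_measureE.
    have g01 i x : 0 <= g i x <= 1.
      rewrite /g indicE; case: (_ \in _); rewrite ?mul0r ?mul1r ?lexx ?ler01//.
      by rewrite normal_mass_ge0 normal_mass_le1.
    rewrite Hprod//; last by move=> B mB; rewrite mul1e; exact: law_mu.
    rewrite mul1e; apply: eq_bigr => i _; rewrite ge0_integral_effect_measure//; last first.
      by move=> x; rewrite /g mulr_ge0// normal_mass_ge0.
    have mf : measurable_fun setT
        (fun x : R => (normal_mass (x / (sigma / Num.sqrt n.+1%:R)) 1 (D i))%:E).
      by apply/measurable_EFinP; exact: measurable_normal_mass_scaled.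
    have intE : (\int[nu]_x (g i x)%:E =
        \int[nu]_(x in A i) (normal_mass (x / (sigma / Num.sqrt n.+1%:R)) 1 (D i))%:E)%E.
      rewrite [RHS]integral_indic_mul; apply: eq_integral => x _.
      by rewrite /g gE mulrC.
    (* As [nu] has no atom at 0, the event of a nonzero effect carries all of [nu], and the event of
       a zero effect only the Dirac part. *)
    rewrite intE /mark_mass /g /A; case: ifPn => Hi.
      rewrite indicE memNset//= mul0r mule0 add0e EFinM alt_lawE//.
      congr (_ * _)%E.
      rewrite [RHS](@ge0_negligible_integral _ _ _ nu setT ([set 0] : set R))//.
        by rewrite setTD.
      by move=> x _; rewrite lee_fin normal_mass_ge0.
    rewrite (@null_set_integral _ _ _ nu ([set 0] : set R))//; last exact: measurable_funTS.
    rewrite mule0 adde0 indicE mem_set// mul1r mulr0.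
    by rewrite -[0 in RHS](mul0r (sigma / Num.sqrt n.+1%:R)^-1) -gE mulr0 EFinM.
  - move=> B mB; have := HX A (fun j i => B i j) mA (fun j i => mB i j).
    rewrite (_ : [set w | _ /\ _] = S `&` [set w | forall i j, B i j (X j i w)]).
      move=> ->; rewrite -integral_indic_mul; apply: eq_integral => w _.
      rewrite -prodEFin; apply: eq_bigr => i _; rewrite -prodEFin.
      by apply: eq_bigr => j _; rewrite normal_massE.
    by apply/seteqP; split => w /= [h1 h2]; split.
have AE w i : A i (mu i w) <-> (mu i w != 0) = H i.
  rewrite /A; case: (H i); split => /=.
  - by move=> h; apply/eqP.
  - by move=> /eqP.
  - by move=> ->; rewrite eqxx.
  - by move=> /negbFE/eqP.
have DE w i : D' i (\sum_(j < n.+1) X j i w) <->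
    D i (zscore sigma (fun j i => X j i w) i).
  rewrite /D' /= /zscore /sample_mean addr0.
  rewrite (_ : _^-1 * _ = Num.sqrt n.+1%:R *
    (n.+1%:R^-1 * \sum_(j < n.+1) (X j i) w) / sigma)//.
  have nE : n.+1%:R^-1 = (Num.sqrt n.+1%:R)^-1 ^+ 2 :> R.
    by rewrite exprVn sqr_sqrtr ?ler0n.
  by rewrite nE; field; rewrite !gt_eqF.
apply/seteqP; split => w /=.
  by move=> h; split => i; have [h1 h2] := h i; [exact/AE|exact/DE].
by move=> [h1 h2] i; split; [exact/AE|exact/DE].
Qed.

End joint_law.

(** * Step-up and step-down indices under a finite product law *)

Local Close Scope classical_set_scope.
Section step_up_down.
Variable m : nat.
Implicit Types c : 'I_m -> nat.

(** In the application [c i] is the number of thresholds [k * alpha / m] smaller than the p-value of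
    test [i], so [c i < k] means that this p-value is at most the k-th threshold. Both procedures
    then reject the [i] with [c i] below their index. *)
Definition count_below c k := #|[set i | (c i < k)%N]|.

Definition step_up_index c :=
  (\max_(1 <= k < m.+1 | (k <= count_below c k)%N) k)%N.

Definition step_down_index c :=
  (find (fun k => (count_below c k < k)%N) (iota 1 m)).+1.

Lemma step_up_index_ge c k : (0 < k <= m)%N -> (k <= count_below c k)%N ->
  (k <= step_up_index c)%N.
Proof.
move=> /andP[k0 km] h; rewrite /step_up_index.
by apply: (@leq_bigmax_seq _ _ _ id) => //; rewrite mem_index_iota k0.
Qed.

Lemma step_up_indexP c :
  step_up_index c = 0%N \/
  [/\ (0 < step_up_index c)%N, (step_up_index c <= m)%N &
      (step_up_index c <= count_below c (step_up_index c))%N].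
Proof.
rewrite /step_up_index big_seq_cond; elim/big_ind : _ => [|a b Ha Hb|k].
- by left.
- by rewrite /maxn; case: ifP.
by rewrite mem_index_iota => /andP[/andP[k0 km] kN]; right.
Qed.

Lemma step_up_index_le_count c :
  (step_up_index c <= count_below c (step_up_index c))%N.
Proof. by case: (step_up_indexP c) => [->|[]]. Qed.

Lemma step_up_index_le c : (step_up_index c <= m)%N.
Proof. by case: (step_up_indexP c) => [->|[]]. Qed.

Lemma count_below_anti c c' k : (forall i, c' i <= c i)%N ->
  (count_below c k <= count_below c' k)%N.
Proof.
move=> h; apply: subset_leq_card; apply/fintype.subsetP => i; rewrite !inE.
exact: leq_ltn_trans.
Qed.

Lemma step_up_index_anti c c' : (forall i, c' i <= c i)%N ->
  (step_up_index c <= step_up_index c')%N.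
Proof.
move=> h; case: (step_up_indexP c) => [->//|[h1 h2 h3]].
apply: step_up_index_ge; first by rewrite h1.
exact: (leq_trans h3 (count_below_anti _ h)).
Qed.

Lemma count_below_mono c k k' : (k <= k')%N ->
  (count_below c k <= count_below c k')%N.
Proof.
move=> kk'; apply: subset_leq_card; apply/fintype.subsetP => i; rewrite !inE => h.
exact: leq_trans h kk'.
Qed.

Lemma lt_step_down_index c k : (0 < k < step_down_index c)%N ->
  (k <= count_below c k)%N.
Proof.
case: k => // k /andP[_]; rewrite ltnS /step_down_index => kf.
have km : (k < m)%N.
  by rewrite (leq_trans kf)// -[leqRHS](size_iota 1 m) find_size.
by have := before_find 0 kf; rewrite nth_iota// add1n => /negbT; rewrite -leqNgt.
Qed.

Lemma step_down_indexP c : (step_down_index c <= m)%N ->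
  (count_below c (step_down_index c) < step_down_index c)%N.
Proof.
rewrite /step_down_index => fm.
have hf : has (fun k => (count_below c k < k)%N) (iota 1 m).
  by rewrite has_find size_iota.
by have := nth_find 0 hf; rewrite nth_iota.
Qed.

Lemma step_down_index_le c : (step_down_index c <= m.+1)%N.
Proof. by rewrite /step_down_index ltnS -[leqRHS](size_iota 1 m) find_size. Qed.

(** Let [k] be the step-down index. If [k <= m], fewer than [k] cells are below [k], but at least
    [k - 1] are below [k - 1]; the two sets coincide, and the step-up index is at least [k - 1]. If
    [k = m + 1], all cells are below [m] and the step-up index is [m]. *)
Lemma step_down_subset_step_up c i : (forall j, c j <= m)%N ->
  (c i < step_down_index c)%N -> (c i < step_up_index c)%N.
Proof.
move=> cm ci.
have [kGm|] := leqP (step_down_index c) m; last first.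
  move=> mk; have kE : step_down_index c = m.+1.
    by apply/eqP; rewrite eqn_leq step_down_index_le.
  have m0 : (0 < m)%N by case: m i {ci cm kE mk} => // -[].
  have cmk : (m <= count_below c m)%N by apply: lt_step_down_index; rewrite m0 kE ltnSn.
  have allm : [set j | (c j < m)%N] = [set: 'I_m].
    by apply/eqP; rewrite eqEcard finset.subsetT cardsT card_ord.
  have : i \in [set j | (c j < m)%N] by rewrite allm inE.
  rewrite inE => cim; apply: (leq_trans cim).
  by apply: step_up_index_ge; rewrite ?m0 ?leqnn.
have := step_down_indexP kGm; set k := step_down_index c in ci kGm * => Nk.
have [k1|k1] := leqP k 1.
  have k0 : (0 < k)%N by [].
  have kE : k = 1%N by apply/eqP; rewrite eqn_leq k1.
  move: Nk; rewrite kE ltnS leqn0 cards_eq0 => /eqP/setP/(_ i).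
  by rewrite !inE -kE ci.
have k1E : k.-1.+1 = k by rewrite prednK// ltnW.
have k1m : (0 < k.-1 <= m)%N.
  by apply/andP; split; [rewrite -ltnS k1E|rewrite (leq_trans (leq_pred _))].
have Nk1 : (k.-1 <= count_below c k.-1)%N.
  apply: lt_step_down_index; rewrite -/k; case/andP: k1m => -> _ /=.
  by rewrite k1E.
have sub : [set j | (c j < k.-1)%N] = [set j | (c j < k)%N].
  apply/eqP; rewrite eqEcard; apply/andP; split.
    apply/fintype.subsetP => j; rewrite !inE => /leq_trans; apply; exact: leq_pred.
  by rewrite (leq_trans _ Nk1)// -ltnS k1E.
have : i \in [set j | (c j < k)%N] by rewrite inE.
rewrite -sub inE => h; apply: (leq_trans h).
exact: step_up_index_ge.
Qed.

End step_up_down.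

(** * Finite product laws: the optimal rule, false rejections, missed signals *)

Section product_law.
Variables (R : realFieldType) (m : nat) (C : finType) (w : bool * C -> R).
Hypotheses (w0 : forall t, 0 <= w t) (w1 : \sum_t w t = 1).
Local Notation state := {ffun 'I_m -> bool * C}.
Implicit Types (F : state -> R) (x : state).

(** Expectation under independent coordinates of law [w]. The boolean of a coordinate records that
    its null hypothesis is false, the component in [C] what is observed. *)
Definition pmean F : R := \sum_x F x * \prod_i w (x i).

Lemma pmeanD F G : pmean (fun x => F x + G x) = pmean F + pmean G.
Proof. by rewrite -big_split; apply: eq_bigr => x _; rewrite mulrDl. Qed.

Lemma pmeanZ a F : pmean (fun x => a * F x) = a * pmean F.
Proof. by rewrite mulr_sumr; apply: eq_bigr => x _; rewrite mulrA. Qed.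

Lemma pmean_sum (I : Type) (s : seq I) (Q : pred I) (F : I -> state -> R) :
  pmean (fun x => \sum_(i <- s | Q i) F i x) = \sum_(i <- s | Q i) pmean (F i).
Proof.
rewrite exchange_big/=; apply: eq_bigr => x _; exact: mulr_suml.
Qed.

Lemma le_pmean F G : (forall x, F x <= G x) -> pmean F <= pmean G.
Proof. by move=> h; apply: ler_sum => x _; rewrite ler_wpM2r ?prodr_ge0. Qed.

Lemma eq_pmean F G : F =1 G -> pmean F = pmean G.
Proof. by move=> h; apply: eq_bigr => x _; rewrite h. Qed.

Lemma pmean_prod (u : 'I_m -> bool * C -> R) :
  pmean (fun x => \prod_i u i (x i)) = \prod_i \sum_t u i t * w t.
Proof.
rewrite bigA_distr_bigA/=; apply: eq_bigr => x _; rewrite big_split//.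
Qed.

Lemma pmean_cst a : pmean (fun=> a) = a.
Proof.
transitivity (a * pmean (fun x => \prod_(i < m) (fun=> 1) (x i))).
  by rewrite -pmeanZ; apply: eq_pmean => x; rewrite big1// mulr1.
rewrite (pmean_prod (fun _ _ => 1)) big1 ?mulr1// => i _; rewrite -[RHS]w1.
by apply: eq_bigr => t _; rewrite mul1r.
Qed.

Definition upd x i t : state := [ffun j => if j == i then t else x j].

(* (x, t) |-> (upd x i t, x i) is an involution preserving the weight. *)
Lemma pmean_resample i F :
  pmean F = pmean (fun x => \sum_t w t * F (upd x i t)).
Proof.
pose W (xt : state * (bool * C)) := w xt.2 * \prod_j w (xt.1 j).
pose inv (xt : state * (bool * C)) := (upd xt.1 i xt.2, xt.1 i).
have invK : cancel inv inv.
  move=> [x t]; rewrite /inv/=; congr (_, _); last by rewrite ffunE eqxx.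
  by apply/ffunP => j; rewrite !ffunE; case: eqVneq => // ->.
have WK xt : W (inv xt) = W xt.
  rewrite /W /inv/=; case: xt => x t /=.
  rewrite (bigD1 i)//= [in RHS](bigD1 i)//= ffunE eqxx mulrCA; congr (_ * (_ * _)).
  by apply: eq_bigr => j ji; rewrite ffunE (negbTE ji).
transitivity (\sum_xt F xt.1 * W xt).
  rewrite -(pair_big xpredT xpredT (fun x t => F x * (w t * \prod_j w (x j))))/=.
  apply: eq_bigr => x _; rewrite -mulr_sumr; congr (_ * _).
  by rewrite -mulr_suml w1 mul1r.
rewrite (reindex_inj (can_inj invK))/=.
under eq_bigr do rewrite WK.
rewrite -(pair_big xpredT xpredT (fun x t => F (upd x i t) * (w t * \prod_j w (x j))))/=.
apply: eq_bigr => x _; rewrite mulr_suml; apply: eq_bigr => t _.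
by rewrite mulrA (mulrC (F _)).
Qed.

Lemma pmean_marginal i (u : bool * C -> R) :
  pmean (fun x => u (x i)) = \sum_t w t * u t.
Proof.
rewrite (pmean_resample i) -[RHS]pmean_cst; apply: eq_pmean => x.
by apply: eq_bigr => t _; rewrite ffunE eqxx.
Qed.

Variables (d0 dA : R).
Hypotheses (d00 : 0 <= d0) (dA0 : 0 <= dA).

Definition prisk (phi : state -> {set 'I_m}) : R :=
  d0 * pmean (fun x => #|[set i | ~~ (x i).1 && (i \in phi x)]|%:R) +
  dA * pmean (fun x => #|[set i | (x i).1 && (i \notin phi x)]|%:R).

Lemma cardsE_sum (Q : pred 'I_m) : #|[set i | Q i]|%:R = \sum_i (Q i)%:R :> R.
Proof.
rewrite -sum1_card natr_sum big_mkcond; apply: eq_bigr => i _.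
by rewrite inE; case: (Q i).
Qed.

Lemma priskE phi : prisk phi =
  \sum_i pmean (fun x => d0 * (~~ (x i).1 && (i \in phi x))%:R +
                         dA * ((x i).1 && (i \notin phi x))%:R).
Proof.
rewrite /prisk -!pmeanZ -pmeanD -pmean_sum; apply: eq_pmean => x.
by rewrite !cardsE_sum !mulr_sumr -big_split.
Qed.

Lemma sum_bool_prod (G : bool * C -> R) :
  \sum_t G t = \sum_c G (true, c) + \sum_c G (false, c).
Proof.
rewrite (eq_bigr (fun t => G (t.1, t.2))); last by case.
by rewrite -(pair_big xpredT xpredT (fun h c => G (h, c))) big_bool.
Qed.

(** With the other coordinates frozen, a rule that sees only the observed components takes one
    decision at [i] for each value [c]; the oracle takes the cheaper one for every [c]. *)
Lemma oracle_optimal (o : C -> bool) (phi : state -> {set 'I_m}) :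
  (forall c, if o c then d0 * w (false, c) <= dA * w (true, c)
             else dA * w (true, c) <= d0 * w (false, c)) ->
  (forall x y : state, (forall i, (x i).2 = (y i).2) -> phi x = phi y) ->
  prisk (fun x => [set i | o (x i).2]) <= prisk phi.
Proof.
move=> ho hphi; rewrite !priskE; apply: ler_sum => i _.
rewrite (pmean_resample i) [leRHS](pmean_resample i); apply: le_pmean => x.
rewrite !sum_bool_prod -!big_split/=; apply: ler_sum => c _.
rewrite !inE !ffunE !eqxx/=.
(* The rule does not see the boolean of coordinate [i]: both truth values lead to the same
   decision. *)
have -> : (i \in phi (upd x i (true, c))) = (i \in phi (upd x i (false, c))).
  by rewrite (hphi _ (upd x i (false, c)))// => j; rewrite !ffunE; case: ifP.
move: (ho c); case: (o c); case: (i \in _) => /=; rewrite !(mulr1, mulr0, addr0, add0r) => h; lra.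
Qed.

Variable kappa : C -> nat.
Hypothesis kappa_le : forall c, (kappa c <= m)%N.

Definition cells x (i : 'I_m) : nat := kappa (x i).2.

Let prior : R := \sum_c w (true, c).

Let pmean_alt i : pmean (fun x => (x i).1%:R) = prior.
Proof.
rewrite (pmean_marginal i (fun t => t.1%:R)).
rewrite sum_bool_prod/=.
rewrite [X in _ + X]big1 ?addr0; last by move=> c _; rewrite mulr0.
by apply: eq_bigr => c _; rewrite mulr1.
Qed.

Section step_up_false_rejections.
Variable alpha : R.
Hypotheses (alpha0 : 0 <= alpha) (alpha4 : alpha <= 4^-1).
Hypothesis null_cells : forall k, (0 < k <= m)%N ->
  \sum_(c | (kappa c < k)%N) w (false, c) <= alpha * k%:R / m%:R.

(* The cells after the nonnull p-values and those indexed by S are set to 0. *)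
Definition zeroed (S : {set 'I_m}) x (i : 'I_m) : nat :=
  if (i \in S) || (x i).1 then 0%N else cells x i.

Definition nulls_below (S : {set 'I_m}) x : {set 'I_m} :=
  [set i | [&& i \notin S, ~~ (x i).1 & (cells x i < step_up_index (zeroed S x))%N]].

(** The index is at most the number of cells below it, and each of these is in [S], nonnull, or
    counted by [nulls_below]. *)
Lemma step_up_index_zeroed S x :
  (step_up_index (zeroed S x) <=
   #|S| + #|[set i | (x i).1]| + #|nulls_below S x|)%N.
Proof.
apply: (leq_trans (step_up_index_le_count _)).
apply: (@leq_trans #|S :|: [set i | (x i).1] :|: nulls_below S x|); last first.
  apply: (leq_trans (leq_card_setU _ _).1); rewrite leq_add2r.
  exact: (leq_card_setU _ _).1.
apply: subset_leq_card; apply/fintype.subsetP => i; rewrite !inE /zeroed.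
by case: (i \in S); case: (x i).1.
Qed.

(* Replacing a null cell by 0 can only raise the step-up index, and makes it
   independent of that cell. *)
Lemma pmean_nulls_below_step S :
  pmean (fun x => #|nulls_below S x|%:R) <=
  \sum_(i | i \notin S) alpha / m%:R *
    (#|S|.+1%:R + m%:R * prior + pmean (fun x => #|nulls_below (i |: S) x|%:R)).
Proof.
have -> : pmean (fun x => #|nulls_below S x|%:R) =
    \sum_(i | i \notin S) pmean (fun x =>
      (~~ (x i).1 && (cells x i < step_up_index (zeroed S x))%N)%:R).
  rewrite -pmean_sum; apply: eq_pmean => x; rewrite cardsE_sum [RHS]big_mkcond.
  by apply: eq_bigr => i _; case: (i \in S).
apply: ler_sum => i iS.
pose K x := step_up_index (zeroed (i |: S) x).
have KK x t : K (upd x i t) = K x.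
  congr step_up_index; apply/funext => j; rewrite /zeroed /cells !inE !ffunE.
  by case: eqVneq.
apply: (@le_trans _ _ (pmean (fun x => (~~ (x i).1 && (cells x i < K x)%N)%:R))).
  apply: le_pmean => x; rewrite ler_nat; case: (~~ _) => //=.
  case: ltnP => // ci; rewrite (leq_trans ci)//; apply: step_up_index_anti => j.
  by rewrite /zeroed !inE; case: (j == i); case: (j \in S).
rewrite (pmean_resample i).
apply: (@le_trans _ _ (pmean (fun x => alpha / m%:R * (K x)%:R))).
  apply: le_pmean => x.
  under eq_bigr do rewrite KK /cells !ffunE eqxx.
  rewrite sum_bool_prod/=.
  rewrite big1 ?add0r; last by move=> c _; rewrite mulr0.
  have [->|K0] := posnP (K x).
    by rewrite big1 ?mulr0// => c _; rewrite mulr0.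
  rewrite mulrAC; apply: le_trans (null_cells _); last first.
    by rewrite K0 step_up_index_le.
  rewrite [leRHS]big_mkcond/=; apply: ler_sum => c _.
  by case: ifP; rewrite ?mulr1 ?mulr0.
rewrite pmeanZ ler_wpM2l ?divr_ge0//.
apply: (@le_trans _ _ (pmean (fun x =>
  #|i |: S|%:R + \sum_j (x j).1%:R + #|nulls_below (i |: S) x|%:R))).
  apply: le_pmean => x; rewrite -cardsE_sum -!natrD ler_nat.
  exact: step_up_index_zeroed.
rewrite !pmeanD pmean_cst pmean_sum cardsU1 iS add1n.
under eq_bigr do rewrite pmean_alt.
by rewrite sumr_const card_ord mulr_natl.
Qed.

(** Descending induction on [S], starting from the set of all tests. Let [a >= 1] be the parenthesis
    of the statement. The induction hypothesis turns the contribution of one test into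
    [alpha * (a + 2 * alpha * (a + 1)) / m], which is at most [2 * alpha * a / m] because
    [alpha <= 1 / 4]: the constant 2 reproduces itself. *)
Lemma pmean_nulls_below S :
  pmean (fun x => #|nulls_below S x|%:R) <=
  2 * alpha * (#|S|.+1%:R + m%:R * prior).
Proof.
have prior0 : 0 <= prior by apply: sumr_ge0.
have [n] := ubnP (m - #|S|); elim: n S => // n IH S Sn.
apply: (le_trans (pmean_nulls_below_step S)).
apply: (@le_trans _ _ (\sum_(i | i \notin S) m%:R^-1 *
    (2 * alpha * (#|S|.+1%:R + m%:R * prior)))).
  apply: ler_sum => i iS.
  have cS : #|i |: S| = #|S|.+1 by rewrite cardsU1 iS.
  have Sm : (#|S| < m)%N by rewrite -cS -[leqRHS](card_ord m) max_card.
  have Sn' : (m - #|i |: S| < n)%N by rewrite cS; move: Sn Sm; clear; lia.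
  have h := IH (i |: S) Sn'; rewrite cS in h.
  rewrite [leLHS]mulrAC [leRHS]mulrC ler_wpM2r ?invr_ge0//.
  set a : R := #|S|.+1%:R + m%:R * prior.
  have a1 : 1 <= a by rewrite /a -[leLHS]addr0 lerD ?mulr_ge0// ler1n.
  move: h; rewrite -[#|S|.+2]addn1 natrD addrAC -/a => h.
  have : alpha * (a + pmean (fun x => #|nulls_below (i |: S) x|%:R)) <=
    alpha * (a + 2 * alpha * (a + 1)) by rewrite ler_wpM2l// lerD2l.
  move=> /le_trans; apply; rewrite [leRHS]mulrAC [leRHS]mulrC ler_wpM2l//.
  have : 0 <= (4^-1 - alpha) * (a + 1) by rewrite mulr_ge0 ?subr_ge0// addr_ge0// (le_trans _ a1).
  lra.
rewrite sumr_const -[leLHS]mulr_natl.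
have [m0|m0] := posnP m.
  have -> : m%:R^-1 = 0 :> R by rewrite m0 invr0.
  by rewrite mul0r mulr0 mulr_ge0 ?addr_ge0 ?mulr_ge0.
rewrite mulrA ler_piMl//.
  by rewrite mulr_ge0 ?addr_ge0 ?mulr_ge0//.
rewrite ler_pdivrMr ?ltr0n// mul1r ler_nat -[leqRHS](card_ord m).
exact: max_card.
Qed.

(** The case of empty [S]: setting the nonnull cells to 0 only raises the index. *)
Lemma step_up_false_rejections :
  pmean (fun x => #|[set i | ~~ (x i).1 &&
    (cells x i < step_up_index (cells x))%N]|%:R) <=
  2 * alpha * (1 + m%:R * prior).
Proof.
have := pmean_nulls_below finset.set0; rewrite cards0; apply: le_trans.
apply: le_pmean => x; rewrite ler_nat; apply: subset_leq_card.
apply/fintype.subsetP => i; rewrite !inE => /andP[-> /leq_trans]; apply.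
by apply: step_up_index_anti => j; rewrite /zeroed; case: ifP.
Qed.

End step_up_false_rejections.

(** A joint probability, of being nonnull with a cell below [k]; in the model it contains the factor
    [p]. *)
Definition alt_below k : R := \sum_(c | (kappa c < k)%N) w (true, c).

(* 2 ^ k * (1 - alt_below k / 2) ^ (m - 1) is the Chernoff bound with parameter
   1 / 2 on the event that fewer than k of the other cells are below k. *)
Lemma step_down_missed k0 : (k0 < m)%N ->
  pmean (fun x => #|[set i | (x i).1 &&
    ~~ (cells x i < step_down_index (cells x))%N]|%:R) <=
  m%:R * (\sum_(c | ~~ (kappa c < k0.+1)%N) w (true, c) +
    prior * \sum_(1 <= k < k0.+1) 2 ^+ k * (1 - alt_below k / 2) ^+ m.-1).
Proof.
move=> k0m.
have -> : pmean (fun x => #|[set i | (x i).1 &&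
    ~~ (cells x i < step_down_index (cells x))%N]|%:R) =
    \sum_i pmean (fun x => ((x i).1 && ~~ (cells x i < step_down_index (cells x))%N)%:R).
  by rewrite -pmean_sum; apply: eq_pmean => x; rewrite cardsE_sum.
rewrite -[m in X in _ <= X * _]card_ord -sumr_const mulr_suml.
apply: ler_sum => i _; rewrite mul1r.
(* [half k] contributes 1 / 2 for each nonnull cell below [k], so [2 ^+ k] times the product is at
   least 1 when fewer than [k] cells are below [k]. Coordinate [i] contributes its nonnull indicator
   instead, whence the factor [prior] and the exponent [m - 1]. *)
pose half k (t : bool * C) : R := if t.1 && (kappa t.2 < k)%N then 2^-1 else 1.
pose u k (l : 'I_m) (t : bool * C) : R := if l == i then t.1%:R else half k t.
apply: (@le_trans _ _ (pmean (fun x => ((x i).1 && ~~ (cells x i < k0.+1)%N)%:R +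
    \sum_(1 <= k < k0.+1) 2 ^+ k * \prod_l u k l (x l)))).
  apply: le_pmean => x.
  have u0 k : 0 <= 2 ^+ k * \prod_l u k l (x l).
    rewrite mulr_ge0 ?exprn_ge0// prodr_ge0// => l _; rewrite /u /half.
    by case: ifP => // _; case: ifP => // _; rewrite invr_ge0.
  case hi : (x i).1 => /=; last by rewrite add0r sumr_ge0.
  (* If the step-down index exceeds [k0], a missed cell is at least [k0 + 1], which is the first
     term. *)
  have [kk|kk] := leqP (step_down_index (cells x)) k0; last first.
    rewrite ler_wpDr ?sumr_ge0// ler_nat.
    case: (ltnP (cells x i) k0.+1) => /= h; last exact: leq_b1.
    by rewrite (leq_trans h kk).
  apply: (@le_trans _ _ 1); first by rewrite lern1 leq_b1.
  set k := step_down_index (cells x) in kk *.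
  have Nk := step_down_indexP (leq_trans kk (ltnW k0m)).
  rewrite ler_wpDl//.
  rewrite (bigD1_seq k)/= ?iota_uniq//; last first.
    by rewrite mem_index_iota ltnS kk.
  rewrite ler_wpDr ?sumr_ge0//.
  rewrite (bigD1 i)//= {1}/u eqxx hi mul1r.
  rewrite (eq_bigr (fun l => half k (x l))); last by move=> l li; rewrite /u (negbTE li).
  have -> : \prod_(l | l != i) half k (x l) =
      2^-1 ^+ #|[set l | [&& l != i, (x l).1 & (cells x l < k)%N]]|.
    rewrite -prodr_const [LHS]big_mkcond [RHS]big_mkcond; apply: eq_bigr => l _.
    by rewrite inE /half /cells; case: (l != i).
  rewrite exprVn ler_pdivlMr ?exprn_gt0// mul1r.
  rewrite ler_eXn2l ?ltr1n//.
  apply: (leq_trans _ (ltnW Nk)); apply: subset_leq_card.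
  by apply/fintype.subsetP => l; rewrite !inE => /and3P[].
rewrite pmeanD lerD//.
  rewrite (pmean_marginal i (fun t => (t.1 && ~~ (kappa t.2 < k0.+1)%N)%:R)).
  rewrite sum_bool_prod/=.
  rewrite [X in _ + X]big1 ?addr0; last by move=> c _; rewrite mulr0.
  rewrite [leRHS]big_mkcond; apply: ler_sum => c _.
  by case: ifP => _; rewrite ?mulr1 ?mulr0.
rewrite pmean_sum mulr_sumr; apply: ler_sum => k _.
rewrite pmeanZ mulrCA ler_wpM2l ?exprn_ge0//.
rewrite pmean_prod (bigD1 i)//=.
rewrite le_eqVlt; apply/orP; left; apply/eqP; congr (_ * _).
  rewrite /u eqxx sum_bool_prod/= [X in _ + X]big1 ?addr0; last by move=> c _; rewrite mul0r.
  by apply: eq_bigr => c _; rewrite mul1r.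
rewrite (eq_bigr (fun=> 1 - alt_below k / 2)); last first.
  move=> l li; rewrite /u (negbTE li) -[X in _ = X - _]w1 /alt_below mulr_suml.
  rewrite !sum_bool_prod/=.
  rewrite [X in _ - X]big_mkcond/= addrAC -sumrB; congr (_ + _).
    by apply: eq_bigr => c _; rewrite /half/=; case: ifP => _; lra.
  by apply: eq_bigr => c _; rewrite /half/= mul1r.
rewrite prodr_const; congr (_ ^+ _).
by rewrite cardC1 card_ord.
Qed.

End product_law.
Local Open Scope classical_set_scope.

(** * Normal tails and p-values *)

Section integral_bounds.
Context (d : measure_display) (T : measurableType d) (R : realType)
  (m : {measure set T -> \bar R}) (D : set T) (f : T -> R) (c : R).
Hypotheses (mD : measurable D) (mf : measurable_fun D f).

Lemma ge0_integral_le_cst : (forall x, D x -> 0 <= f x <= c) ->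
  (\int[m]_(x in D) (f x)%:E <= c%:E * m D)%E.
Proof.
move=> fc; rewrite -integral_cst//; apply: ge0_le_integral => //.
all: try by move=> x /fc /andP[]; rewrite ?lee_fin.
all: try exact/measurable_EFinP.
Qed.

Lemma ge0_integral_ge_cst : 0 <= c -> (forall x, D x -> c <= f x) ->
  (c%:E * m D <= \int[m]_(x in D) (f x)%:E)%E.
Proof.
move=> c0 fc; rewrite -integral_cst//; apply: ge0_le_integral => //.
all: try by move=> x /fc; rewrite ?lee_fin// => /(le_trans c0).
all: try exact/measurable_EFinP.
all: by move=> x Dx; rewrite lee_fin ?(le_trans c0)// fc.
Qed.

End integral_bounds.

Section normal_tails.
Context {R : realType}.
Implicit Types (x y z t : R) (A : set R).
Local Notation gauss := (normal_mass (0 : R) 1).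

Lemma le_normal_mass m s A B : measurable A -> measurable B -> A `<=` B ->
  normal_mass m s A <= normal_mass m s B :> R.
Proof.
by move=> mA mB AB; rewrite -lee_fin !normal_massE// le_measure// inE.
Qed.

Lemma normal_massU m s A B : measurable A -> measurable B -> [disjoint A & B] ->
  normal_mass m s (A `|` B) = normal_mass m s A + normal_mass m s B :> R.
Proof.
move=> mA mB AB; apply: EFin_inj; rewrite EFinD !normal_massE//.
  by rewrite measureU//; exact/disj_set2P.
exact: measurableU.
Qed.

Lemma normal_massC m s A : measurable A ->
  normal_mass m s (~` A) = 1 - normal_mass m s A :> R.
Proof.
move=> mA; apply: EFin_inj; rewrite EFinB !normal_massE ?probability_setC//.
exact: measurableC.
Qed.

Lemma normal_mass_shift m A : measurable A ->
  normal_mass m 1 A = gauss ((fun x => x + m) @^-1` A).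
Proof. by move=> mA; rewrite /normal_mass normal_prob_shift. Qed.

Lemma measurable_shift m A : measurable A -> measurable ((fun x => x + m) @^-1` A).
Proof.
move=> mA; rewrite -[X in measurable X]setTI.
have h : measurable_fun setT (fun x : R => x + m) by exact: measurable_funD.
exact: (h measurableT _ mA).
Qed.

Lemma measurable_opp_preimage A : measurable A -> measurable (-%R @^-1` A).
Proof.
move=> mA; rewrite -[X in measurable X]setTI.
have h : measurable_fun setT (-%R : R -> R) by [].
exact: (h measurableT _ mA).
Qed.

Lemma gauss_opp A : measurable A -> gauss (-%R @^-1` A) = gauss A.
Proof.
move=> mA; rewrite /normal_mass; congr fine; rewrite /normal_prob.
have mN : measurable_fun setT (-%R : R -> measurableTypeR R) by [].
have mpdf B : measurable_fun B (fun x : R => (normal_pdf 0 1 x)%:E).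
  by apply/measurable_EFinP; apply: measurable_funTS; exact: measurable_normal_pdf.
rewrite [RHS](eq_measure_integral (image_measure lebesgue_measure mN)).
  rewrite ge0_integral_image_measure//; first last.
  - by move=> x _; rewrite lee_fin normal_pdf_ge0.
  - exact: mpdf.
  apply: eq_integral => x _; rewrite !normal_pdfE ?oner_eq0// /normal_fun.
  by rewrite !subr0 sqrrN.
by move=> B mB _; rewrite -[LHS]lebesgue_measureN.
Qed.

Lemma measurable_expR_affine m z :
  measurable_fun setT (fun x => expR (m * x - z)).
Proof.
exact: (measurableT_comp (@measurable_expR R) (measurable_affine m (- z))).
Qed.

(** Ratio of the two normal densities. Averaged over the effects it becomes the likelihood ratio
    [lik]; with [m = - z] it yields the tail bounds. *)
Lemma normal_mass_tilt m A : measurable A ->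
  ((normal_mass m 1 A)%:E =
   \int[normal_prob (0 : R) 1]_(x in A) (expR (m * x - m ^+ 2 / 2))%:E)%E.
Proof.
move=> mA; rewrite normal_massE//.
have mexp := measurable_expR_affine m (m ^+ 2 / 2).
rewrite [RHS]integral_indic_mul ge0_integral_normal_prob//; last first.
  by apply/measurable_EFinP; exact: measurable_funM.
rewrite /normal_prob [LHS]integral_indic_mul; apply: eq_integral => x _.
rewrite -EFinM [in RHS]mulrAC; congr ((_ * _)%:E).
rewrite !normal_pdfE ?oner_eq0// /normal_fun [RHS]mulrCA -expRD.
by congr (_ * expR _); field.
Qed.

(** The mass is that of N(- z, 1) on the positive half-line, where the tilting factor
    [expR (- z * x - z ^+ 2 / 2)] is at most [expR (- (z ^+ 2 / 2))]. *)
Lemma gauss_ray_ge z : 0 <= z -> gauss `[z, +oo[ <= expR (- (z ^+ 2 / 2)).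
Proof.
move=> z0.
have -> : gauss `[z, +oo[ = normal_mass (- z) 1 `[0, +oo[.
  rewrite [RHS]normal_mass_shift//; congr gauss.
  by apply/seteqP; split => x /=; rewrite !in_itv/= !andbT subr_ge0.
rewrite -lee_fin normal_mass_tilt//.
apply: (le_trans (@ge0_integral_le_cst _ _ _ _ _ _ (expR (- (z ^+ 2 / 2))) _ _ _)) => //.
- by apply: measurable_funTS; exact: measurable_expR_affine.
- move=> x /=; rewrite in_itv/= andbT => x0; rewrite expR_ge0 ler_expR sqrrN.
  by rewrite gerDr mulNr oppr_le0 mulr_ge0.
- rewrite -[leRHS]mule1 lee_pmul2l ?lte_fin ?expR_gt0//.
  exact: probability_le1.
Qed.

Lemma gauss_ray_le z : 0 <= z -> gauss `]-oo, - z] <= expR (- (z ^+ 2 / 2)).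
Proof.
move=> z0; rewrite -gauss_opp// (_ : _ @^-1` _ = `[z, +oo[%classic) ?gauss_ray_ge//.
by apply/seteqP; split => x /=; rewrite !in_itv/= ?andbT lerN2.
Qed.

Lemma gauss_outside z : 0 <= z ->
  gauss [set x | z <= `|x|] <= 2 * expR (- (z ^+ 2 / 2)).
Proof.
move=> z0; rewrite (_ : [set x | _] = `[z, +oo[ `|` `]-oo, - z]); last first.
  apply/seteqP; split => x /=; rewrite !in_itv/= andbT ler_normr lerNr.
    by move=> /orP[]; [left|right].
  by move=> [->//|->]; rewrite orbT.
apply: (@le_trans _ _ (gauss `[z, +oo[ + gauss `]-oo, - z])).
  rewrite -lee_fin EFinD !normal_massE//; last exact: measurableU.
  exact: measureU2.
rewrite mulr_natl mulr2n; apply: lerD; [exact: gauss_ray_ge|exact: gauss_ray_le].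
Qed.

(** The p-value as a function of the z-score; [pvalue] is convertible with [ptail] at [zscore]. *)
Definition ptail z : R := 2 * (1 - std_normal_cdf `|z|).

Lemma std_normal_cdfE z : std_normal_cdf z = gauss `]-oo, z].
Proof. by []. Qed.

Lemma ptailE z : ptail z = 2 * gauss `]`|z|, +oo[.
Proof.
rewrite /ptail std_normal_cdfE -normal_massC//; congr (2 * gauss _).
by rewrite setCitvl.
Qed.

Lemma ptail_le_expR z : ptail z <= 2 * expR (- (z ^+ 2 / 2)).
Proof.
rewrite ptailE ler_wpM2l//; apply: (@le_trans _ _ (gauss `[`|z|, +oo[)).
  by apply: le_normal_mass => //; apply: subset_itvr; rewrite bnd_simp.
by rewrite -(normr_id z) -[z ^+ 2]real_normK ?num_real// normr_id gauss_ray_ge.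
Qed.

Lemma gauss_itv_le y z : y <= z -> gauss `]y, z] <= (z - y) * normal_peak 1.
Proof.
move=> yz; rewrite -lee_fin normal_massE// /normal_prob.
apply: (le_trans (@ge0_integral_le_cst _ _ _ _ _ _ (normal_peak 1) _ _ _)) => //.
- by apply: measurable_funTS; exact: measurable_normal_pdf.
- by move=> x _; rewrite normal_pdf_ge0 normal_pdf_ub ?oner_eq0.
rewrite [X in (_ * X)%E](_ : _ = lebesgue_measure (`]y, z]%classic : set R))// lebesgue_measure_itv/= lte_fin.
move: yz; rewrite le_eqVlt => /orP[/eqP->|yz].
  by rewrite ltxx mule0 subrr mul0r.
by rewrite yz -EFinD -EFinM lee_fin mulrC.
Qed.

Lemma gauss_itv_gt0 y z : 0 <= y -> y < z -> 0 < gauss `]y, z].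
Proof.
move=> y0 yz; pose c := normal_pdf 0 1 z.
have c0 : 0 < c.
  by rewrite /c normal_pdfE ?oner_eq0// mulr_gt0 ?expR_gt0// normal_peak_gt0 ?oner_eq0.
apply: (@lt_le_trans _ _ (c * (z - y))); first by rewrite mulr_gt0// subr_gt0.
rewrite -lee_fin normal_massE// /normal_prob.
have pdf_ge x : `]y, z]%classic x -> c <= normal_pdf 0 1 x.
  rewrite /= in_itv/= => /andP[yx xz].
  rewrite /c !normal_pdfE ?oner_eq0// ler_wpM2l ?normal_peak_ge0//.
  rewrite /normal_fun !subr0 ler_expR !mulNr lerN2 ler_wpM2r ?invr_ge0//.
  by rewrite ler_sqr ?nnegrE// (le_trans y0)// ?(ltW yx)// (ltW yz).
have := @ge0_integral_ge_cst _ _ _ lebesgue_measure `]y, z]%classic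
  (normal_pdf 0 1) c (measurable_itv _)
  (measurable_funTS (measurable_normal_pdf 0 1)) (ltW c0) pdf_ge.
apply: le_trans; rewrite [X in (_ * X)%E](_ : _ = lebesgue_measure (`]y, z]%classic : set R))//.
by rewrite lebesgue_measure_itv/= lte_fin yz -EFinD -EFinM mulrC.
Qed.

Lemma ptail_diff y z : 0 <= y -> y <= z -> ptail y - ptail z = 2 * gauss `]y, z].
Proof.
move=> y0 yz; rewrite /ptail !std_normal_cdfE !ger0_norm ?(le_trans y0)//.
have -> : `]-oo, z]%classic = `]-oo, y] `|` `]y, z] :> set R.
  by rewrite -itv_bndbnd_setU// bnd_simp.
rewrite normal_massU//; first by ring.
apply/disj_set2P; apply/seteqP; split => // x /=; rewrite !in_itv/=.
by move=> [xy /andP[]]; rewrite ltNge xy.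
Qed.

Lemma ptail_norm z : ptail `|z| = ptail z.
Proof. by rewrite /ptail normr_id. Qed.

Lemma ptail_anti y z : 0 <= y -> y <= z -> ptail z <= ptail y.
Proof.
by move=> y0 yz; rewrite -subr_ge0 ptail_diff// mulr_ge0 ?normal_mass_ge0.
Qed.

Lemma ptail_lt y z : 0 <= y -> y < z -> ptail z < ptail y.
Proof.
move=> y0 yz; rewrite -subr_gt0 ptail_diff ?(ltW yz)//.
by rewrite mulr_gt0 ?gauss_itv_gt0.
Qed.

Lemma gauss_set1 x : gauss [set x] = 0.
Proof.
apply/eqP; rewrite -[_ == _]/((gauss [set x]) == 0).
rewrite /normal_mass (_ : normal_prob 0 1 [set x] = 0%E)//.
exact: integral_set1.
Qed.

Lemma gauss_norm_gt z : 0 <= z -> gauss [set x | z < `|x|] = ptail z.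
Proof.
move=> z0; rewrite ptailE ger0_norm//.
rewrite (_ : [set x | _] = `]z, +oo[ `|` -%R @^-1` `]z, +oo[); last first.
  apply/seteqP; split => x /=; rewrite !in_itv/= !andbT ltr_normr.
    by move=> /orP[]; [left|right].
  by move=> [->//|->]; rewrite orbT.
rewrite normal_massU//; last 2 first.
- exact: measurable_opp_preimage.
- apply/disj_set2P; apply/seteqP; split => // x /=; rewrite !in_itv/= !andbT.
  by move=> [zx]; apply/negP; rewrite -leNgt; lra.
by rewrite gauss_opp// mulr_natl mulr2n.
Qed.

Lemma measurable_norm_ge z : measurable [set x : R | z <= `|x|].
Proof.
rewrite (_ : [set x | _] = (fun x : R => `|x|) @^-1` `[z, +oo[); last first.
  by apply/seteqP; split => x /=; rewrite in_itv/= andbT.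
rewrite -[X in measurable X]setTI.
by apply: (@normr_measurable R setT measurableT).
Qed.

Lemma measurable_norm_gt z : measurable [set x : R | z < `|x|].
Proof.
rewrite (_ : [set x | _] = (fun x : R => `|x|) @^-1` `]z, +oo[); last first.
  by apply/seteqP; split => x /=; rewrite in_itv/= andbT.
rewrite -[X in measurable X]setTI.
by apply: (@normr_measurable R setT measurableT).
Qed.

(** The strict and the large event differ by the two points [z] and [- z], which are null. *)
Lemma gauss_norm_ge z : 0 <= z -> gauss [set x | z <= `|x|] = ptail z.
Proof.
move=> z0; apply/eqP; rewrite eq_le; apply/andP; split; last first.
  rewrite -gauss_norm_gt//; apply: le_normal_mass.
  - exact: measurable_norm_gt.
  - exact: measurable_norm_ge.
  - by move=> x /= /ltW.
rewrite -gauss_norm_gt// -[leRHS]addr0 -[X in _ <= _ + X](addr0 0).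
rewrite -[X in _ <= _ + (X + _)](gauss_set1 z) -[X in _ <= _ + (_ + X)](gauss_set1 (- z)).
rewrite -lee_fin !EFinD !normal_massE; try exact: measurable_norm_ge;
  try exact: measurable_norm_gt; try exact: measurable_set1.
apply: (@le_trans _ _ (normal_prob 0 1 ([set x | z < `|x|] `|` ([set z] `|` [set - z])))).
  apply: le_measure; rewrite ?inE; first exact: measurable_norm_ge.
    by apply: measurableU; [exact: measurable_norm_gt|exact: measurableU].
  move=> x /=; rewrite le_eqVlt => /orP[/eqP zx|]; last by left.
  right; case: (lerP 0 x) => x0; [left|right]; rewrite zx.
    by rewrite ger0_norm.
  by rewrite ltr0_norm// opprK.
apply: (le_trans (measureU2 _ _ _)); [exact: measurable_norm_gt|exact: measurableU|].
by rewrite leeD2l// measureU2.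
Qed.

Lemma ptail0 : ptail 0 = 1.
Proof.
rewrite -gauss_norm_gt//.
rewrite (_ : [set x | _] = ~` [set 0]); last first.
  by apply/seteqP; split => x /=; rewrite normr_gt0 => /eqP.
by rewrite normal_massC// gauss_set1 subr0.
Qed.

Lemma ptail_lipschitz y z : 0 <= y -> 0 <= z ->
  `|ptail y - ptail z| <= 2 * normal_peak 1 * `|y - z|.
Proof.
wlog yz : y z / y <= z => [h y0 z0|y0 z0].
  have [yz|/ltW zy] := leP y z; first exact: h.
  by rewrite distrC (distrC y); exact: h.
rewrite ptail_diff// ger0_norm ?mulr_ge0 ?normal_mass_ge0//.
rewrite distrC ger0_norm ?subr_ge0// -mulrA ler_wpM2l// mulrC.
exact: gauss_itv_le.
Qed.

Lemma continuous_ptail : continuous ptail.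
Proof.
move=> y; apply/cvgrPdist_le => e e0.
have k0 : 0 < 2 * normal_peak (1 : R) by rewrite mulr_gt0// normal_peak_gt0 ?oner_eq0.
have ek0 : 0 < e / (2 * normal_peak (1 : R)) by exact: divr_gt0.
near=> z.
rewrite -ptail_norm -(ptail_norm z).
apply: (le_trans (ptail_lipschitz _ _)) => //.
rewrite mulrC -ler_pdivlMr//; apply: (le_trans (ler_dist_dist _ _)).
by near: z; exact: (@cvgr_dist_le _ _ _ (nbhs y) _ id y cvg_id _ ek0).
Unshelve. all: by end_near. Qed.

Lemma ptail_onto t : 0 < t < 1 -> exists2 y, 0 <= y & ptail y = t.
Proof.
move=> /andP[t0 t1].
(* Chosen so that [2 * expR (- (Y ^+ 2 / 2)) = t], hence [ptail Y <= t]; at the other end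
   [ptail 0 = 1]. *)
pose Y := Num.sqrt (2 * ln (2 / t)).
have ln0 : 0 <= ln (2 / t) by rewrite ln_ge0// ler_pdivlMr// mul1r; lra.
have Yt : ptail Y <= t.
  apply: (le_trans (ptail_le_expR _)); rewrite /Y sqr_sqrtr ?mulr_ge0//.
  rewrite mulrAC divff// mul1r expRN lnK ?posrE ?divr_gt0//.
  by rewrite invf_div mulrCA divff// mulr1.
have Y0 : 0 <= Y by exact: sqrtr_ge0.
have cont : {within `[0, Y], continuous ptail}.
  exact/continuous_subspaceT/continuous_ptail.
have [] := @IVT R ptail 0 Y t Y0 cont.
  rewrite ptail0 ge_min le_max (ltW t1) Yt orbT//.
by move=> y; rewrite in_itv/= => /andP[y0 _] yt; exists y.
Qed.

(** Null p-values are uniform: if [ptail y = t], strict monotonicity identifies the event with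
    [y <= |x|], whose mass is [ptail y]. *)
Lemma gauss_ptail_le t : 0 < t < 1 -> gauss [set x | ptail x <= t] = t.
Proof.
move=> /ptail_onto[y y0 yt]; rewrite -[RHS]yt -gauss_norm_ge//; congr gauss.
apply/seteqP; split => x /=; rewrite -yt -ptail_norm.
  move=> xt; rewrite leNgt; apply/negP => lt.
  by have := ptail_lt (normr_ge0 x) lt; rewrite ltNge xt.
by move=> yx; rewrite ptail_anti.
Qed.

End normal_tails.

(** * Likelihood ratio and law of the non-null z-scores *)

Section likelihood.
Context {R : realType} (nu : probability (measurableTypeR R) R) (s : R).
Hypothesis s0 : 0 < s.
Implicit Types (x y z w t u theta W : R) (D : set R).
Local Notation gauss := (normal_mass (0 : R) 1).

(* The likelihood ratio of a z-score under the alternative and the null. *)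
Definition lik x : R :=
  fine (\int[nu]_t (expR (t / s * x - (t / s) ^+ 2 / 2))%:E)%E.

(** The likelihood ratio without its factor [expR (z ^+ 2 / 2)]. It is at most 1, and of order [s]
    at moderate [z] when [nu] has a bounded density around 0; this gain is what shifts the cutoff of
    the oracle when C = 0. *)
Definition kern z : R := fine (\int[nu]_t (expR (- ((t / s - z) ^+ 2 / 2)))%:E)%E.

Lemma measurable_likelihood :
  measurable_fun setT (fun tx : R * R => expR (tx.1 / s * tx.2 - (tx.1 / s) ^+ 2 / 2)).
Proof.
apply: measurableT_comp => //.
have m1 : measurable_fun setT (fun tx : R * R => tx.1 / s).
  by apply: measurable_funM => //; exact: measurable_fst.
apply: measurable_funB; first by apply: measurable_funM => //; exact: measurable_snd.
by apply: measurable_funM => //; exact: measurable_funX.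
Qed.

Lemma measurable_lik_integrand x :
  measurable_fun setT (fun t => expR (t / s * x - (t / s) ^+ 2 / 2)).
Proof.
apply: measurableT_comp => //.
have m1 : measurable_fun setT (fun t : R => t / s) by exact: measurable_funM.
apply: measurable_funB; first by apply: measurable_funM.
by apply: measurable_funM => //; exact: measurable_funX.
Qed.

Lemma measurable_kern_integrand z :
  measurable_fun setT (fun t => expR (- ((t / s - z) ^+ 2 / 2))).
Proof.
apply: measurableT_comp => //; apply: measurableT_comp => //.
have m1 : measurable_fun setT (fun t : R => t / s - z).
  by apply: measurable_funD => //; exact: measurable_funM.
by apply: measurable_funM => //; exact: measurable_funX.
Qed.

Lemma integral_le_cstT (f : R -> R) (c : R) : measurable_fun setT f ->
  (forall t, 0 <= f t <= c) -> (\int[nu]_t (f t)%:E <= c%:E)%E.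
Proof.
move=> mf fc; have := @ge0_integral_le_cst _ _ _ nu setT f c measurableT mf (fun t _ => fc t).
by rewrite (_ : Measure.sort nu setT = 1%E) ?mule1//; exact: probability_setT.
Qed.

Lemma integral_bounded_fin (f : R -> R) (c : R) : measurable_fun setT f ->
  (forall t, 0 <= f t <= c) -> (\int[nu]_t (f t)%:E)%E \is a fin_num.
Proof.
move=> mf fc; rewrite ge0_fin_numE.
  exact: le_lt_trans (integral_le_cstT mf fc) (ltry _).
by apply: integral_ge0 => t _; rewrite lee_fin; case/andP: (fc t).
Qed.

Lemma kern_integrand_bounded z t : 0 <= expR (- ((t / s - z) ^+ 2 / 2)) <= 1.
Proof.
rewrite expR_ge0 -[leRHS]expR0 ler_expR oppr_le0.
by rewrite mulr_ge0 ?sqr_ge0.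
Qed.

Lemma kernE z : ((kern z)%:E = \int[nu]_t (expR (- ((t / s - z) ^+ 2 / 2)))%:E)%E.
Proof.
rewrite fineK//.
exact: integral_bounded_fin (measurable_kern_integrand z) (kern_integrand_bounded z).
Qed.

Lemma kern_ge0 z : 0 <= kern z.
Proof. by rewrite fine_ge0// integral_ge0// => t _; rewrite lee_fin expR_ge0. Qed.

Lemma kern_le1 z : kern z <= 1.
Proof.
rewrite -lee_fin kernE.
exact: integral_le_cstT (measurable_kern_integrand z) (kern_integrand_bounded z).
Qed.

Lemma lik_integrand t x : expR (t / s * x - (t / s) ^+ 2 / 2) =
  expR (x ^+ 2 / 2) * expR (- ((t / s - x) ^+ 2 / 2)).
Proof. by rewrite -expRD; congr expR; field; rewrite gt_eqF. Qed.

Lemma likE x :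
  ((lik x)%:E = \int[nu]_t (expR (t / s * x - (t / s) ^+ 2 / 2))%:E)%E.
Proof.
rewrite fineK//; apply: (@integral_bounded_fin _ (expR (x ^+ 2 / 2))).
  exact: measurable_lik_integrand.
move=> t; rewrite expR_ge0 lik_integrand ler_piMr ?expR_ge0//.
by case/andP: (kern_integrand_bounded x t).
Qed.

Lemma lik_kern x : lik x = expR (x ^+ 2 / 2) * kern x.
Proof.
apply: EFin_inj; rewrite likE EFinM kernE -ge0_integralZl//.
- by apply: eq_integral => t _; rewrite lik_integrand EFinM.
- by apply/measurable_EFinP; exact: measurable_kern_integrand.
Qed.

Lemma lik_le_expR x : lik x <= expR (x ^+ 2 / 2).
Proof. by rewrite lik_kern ler_piMr ?expR_ge0 ?kern_le1. Qed.

Lemma lik_ge0 x : 0 <= lik x.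
Proof. by rewrite lik_kern mulr_ge0 ?expR_ge0 ?kern_ge0. Qed.

Lemma lik0_le1 : lik 0 <= 1.
Proof. by rewrite (le_trans (lik_le_expR 0))// expr0n/= mul0r expR0. Qed.

Lemma expR_convex theta x y : 0 <= theta <= 1 ->
  expR ((1 - theta) * x + theta * y) <= (1 - theta) * expR x + theta * expR y :> R.
Proof.
move=> /andP[t0 t1]; set z := (1 - theta) * x + theta * y.
have tangent u : expR z * (1 + (u - z)) <= expR u.
  have -> : expR u = expR z * expR (u - z) by rewrite -expRD addrC subrK.
  by rewrite ler_wpM2l ?expR_ge0// expR_ge1Dx.
have h1 : (1 - theta) * (expR z * (1 + (x - z))) <= (1 - theta) * expR x.
  by rewrite ler_wpM2l ?subr_ge0.
have h2 : theta * (expR z * (1 + (y - z))) <= theta * expR y by rewrite ler_wpM2l.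
apply: (le_trans _ (lerD h1 h2)); rewrite le_eqVlt; apply/orP; left; apply/eqP.
by rewrite /z; ring.
Qed.

Lemma lik_convex theta x y : 0 <= theta <= 1 ->
  lik ((1 - theta) * x + theta * y) <= (1 - theta) * lik x + theta * lik y.
Proof.
move=> t01; have /andP[t0 t1] := t01.
have t1' : 0 <= 1 - theta by rewrite subr_ge0.
have mexp z : measurable_fun setT
    (fun t : measurableTypeR R => (expR (t / s * z - (t / s) ^+ 2 / 2))%:E).
  by apply/measurable_EFinP; exact: measurable_lik_integrand.
have exp0 z t : (0 <= (expR (t / s * z - (t / s) ^+ 2 / 2))%:E)%E.
  by rewrite lee_fin expR_ge0.
rewrite -lee_fin EFinD !EFinM !likE -!ge0_integralZl//.
have mexpZ k z : measurable_fun setT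
    (fun t : measurableTypeR R => (k%:E * (expR (t / s * z - (t / s) ^+ 2 / 2))%:E)%E).
  exact: measurable_funeM.
rewrite -ge0_integralD//; try (by move=> t _; rewrite mule_ge0).
apply: ge0_le_integral => //;
  try (by move=> t _; rewrite ?adde_ge0// mule_ge0);
  try (by apply: emeasurable_funD; exact: mexpZ).
move=> t _; rewrite -!EFinM -EFinD lee_fin.
apply: le_trans (expR_convex _ _ t01).
rewrite ler_expR le_eqVlt; apply/orP; left; apply/eqP; ring.
Qed.

Lemma lik_between x y z W : x < y -> y < z -> lik x <= W -> lik z <= W ->
  lik y <= W.
Proof.
move=> xy yz lx lz.
have xz : 0 < z - x by rewrite subr_gt0 (lt_trans xy).
pose theta := (y - x) / (z - x).
have t01 : 0 <= theta <= 1.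
  by rewrite divr_ge0 ?(ltW xz) ?subr_ge0 ?(ltW xy)//= ler_pdivrMr// mul1r lerB// ltW.
have -> : y = (1 - theta) * x + theta * z by rewrite /theta; field; rewrite gt_eqF.
apply: (le_trans (lik_convex _ _ t01)).
have /andP[t0 t1] := t01.
have h1 : (1 - theta) * lik x <= (1 - theta) * W by rewrite ler_wpM2l ?subr_ge0.
have h2 : theta * lik z <= theta * W by rewrite ler_wpM2l.
by apply: (le_trans (lerD h1 h2)); rewrite -mulrDl subrK mul1r.
Qed.

(** A convex function that is at most [W] at [x] and has reached [W] at [y] stays at least [W]
    further away from [x]. Used with [x] the opposite cutoff of the oracle, and with [x = 0], where
    [lik] is at most 1. *)
Lemma lik_beyond x y z W : x < y <= z \/ z <= y < x -> lik x <= W -> W <= lik y ->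
  W <= lik z.
Proof.
move=> xyz lx ly.
have zx : z - x != 0.
  rewrite subr_eq0; case: xyz => /andP[h1 h2].
    by rewrite gt_eqF// (lt_le_trans h1 h2).
  by rewrite lt_eqF// (le_lt_trans h1 h2).
pose theta := (y - x) / (z - x).
have t01 : 0 < theta <= 1.
  case: xyz => /andP[h1 h2].
    have h : 0 < z - x by rewrite subr_gt0 (lt_le_trans h1).
    by rewrite /theta divr_gt0// ?subr_gt0//= ler_pdivrMr// mul1r lerB.
  have h : 0 < x - z by rewrite subr_gt0 (le_lt_trans h1).
  have -> : theta = (x - y) / (x - z) by rewrite /theta -!(opprB x) invrN mulrNN.
  by rewrite divr_gt0// ?subr_gt0//= ler_pdivrMr// mul1r lerB.
have yE : y = (1 - theta) * x + theta * z by rewrite /theta; field.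
have /andP[t0 t1] := t01.
have := @lik_convex theta x z; rewrite -yE (ltW t0) t1 => /(_ isT) h.
have h1 : (1 - theta) * lik x <= (1 - theta) * W by rewrite ler_wpM2l ?subr_ge0.
rewrite -(ler_pM2l t0); lra.
Qed.

Lemma measurable_lik : measurable_fun setT lik.
Proof.
apply/measurable_EFinP.
rewrite (_ : _ \o _ = fun x => \int[nu]_t (expR (t / s * x - (t / s) ^+ 2 / 2))%:E)%E.
  apply: (@measurable_fun_fubini_tonelli_G _ _ (measurableTypeR R) R _ nu
    (fun tx => (expR (tx.1 / s * tx.2 - (tx.1 / s) ^+ 2 / 2))%:E)).
    by apply/measurable_EFinP; exact: measurable_likelihood.
  by move=> tx; rewrite lee_fin expR_ge0.
by apply/funext => x; rewrite -likE.
Qed.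

(** Tilting and Tonelli: [lik] is the density of the alternative law with respect to N(0, 1), so
    pointwise bounds on [lik] become comparisons of the two laws. *)
Lemma alt_law_lik D : measurable D ->
  ((alt_law s nu D)%:E = \int[normal_prob (0 : R) 1]_(x in D) (lik x)%:E)%E.
Proof.
move=> mD; rewrite alt_lawE//.
under eq_integral do rewrite normal_mass_tilt// integral_indic_mul.
pose f (tx : R * R) :=
  (expR (tx.1 / s * tx.2 - (tx.1 / s) ^+ 2 / 2) * \1_D tx.2)%:E.
rewrite (@fubini_tonelli _ _ _ _ _ nu (normal_prob (0 : R) 1) f); last 2 first.
- apply/measurable_EFinP; apply: measurable_funM; first exact: measurable_likelihood.
  exact: measurableT_comp.
- by move=> tx; rewrite lee_fin mulr_ge0 ?expR_ge0.
rewrite [RHS]integral_indic_mul; apply: eq_integral => x _.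
rewrite EFinM likE -ge0_integralZr//.
by apply/measurable_EFinP; exact: measurable_lik_integrand.
Qed.

Lemma alt_law_le D W : measurable D -> (forall x, D x -> lik x <= W) ->
  alt_law s nu D <= W * gauss D.
Proof.
move=> mD h; rewrite -lee_fin alt_law_lik// EFinM normal_massE//.
apply: ge0_integral_le_cst => //; first exact: measurable_funTS measurable_lik.
by move=> x Dx; rewrite lik_ge0 h.
Qed.

Lemma alt_law_ge D W : measurable D -> 0 <= W -> (forall x, D x -> W <= lik x) ->
  W * gauss D <= alt_law s nu D.
Proof.
move=> mD W0 h; rewrite -lee_fin alt_law_lik// EFinM normal_massE//.
by apply: ge0_integral_ge_cst => //; exact: measurable_funTS measurable_lik.
Qed.

End likelihood.

Section alternative_bounds.
Context {R : realType} (nu : probability (measurableTypeR R) R) (s : R).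
Hypothesis s0 : 0 < s.
Implicit Types (m x y z w t : R).
Local Notation gauss := (normal_mass (0 : R) 1).
Local Notation ball z := [set x : R | `|x| < z].

Lemma measurable_norm_lt z : measurable (ball z).
Proof.
rewrite (_ : ball z = (fun x : R => `|x|) @^-1` `]-oo, z[); last first.
  by apply/seteqP; split => x /=; rewrite in_itv.
rewrite -[X in measurable X]setTI.
by apply: (@normr_measurable R setT measurableT).
Qed.

Lemma measurable_norm_le z : measurable [set x : R | `|x| <= z].
Proof.
rewrite (_ : [set x | _] = (fun x : R => `|x|) @^-1` `]-oo, z]); last first.
  by apply/seteqP; split => x /=; rewrite in_itv.
rewrite -[X in measurable X]setTI.
by apply: (@normr_measurable R setT measurableT).
Qed.

Lemma normal_mass_ball_ge m z w : 0 <= w -> `|m| <= z - w ->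
  1 - 2 * expR (- (w ^+ 2 / 2)) <= normal_mass m 1 (ball z).
Proof.
move=> w0 mzw; rewrite normal_mass_shift; last exact: measurable_norm_lt.
apply: (@le_trans _ _ (gauss (~` [set x | w <= `|x|]))).
  by rewrite normal_massC ?lerD2l ?lerN2 ?gauss_outside//; exact: measurable_norm_ge.
apply: le_normal_mass.
- by apply: measurableC; exact: measurable_norm_ge.
- by apply: measurable_shift; exact: measurable_norm_lt.
move=> x /= /negP; rewrite -ltNge => xw.
by rewrite (le_lt_trans (ler_normD _ _))//; lra.
Qed.

Lemma normal_mass_ball_right m z : z <= m ->
  normal_mass m 1 (ball z) <= expR (- ((m - z) ^+ 2 / 2)).
Proof.
move=> zm; rewrite normal_mass_shift; last exact: measurable_norm_lt.
have mz0 : 0 <= m - z by rewrite subr_ge0.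
apply: le_trans (gauss_ray_le mz0); apply: le_normal_mass => //.
  by apply: measurable_shift; exact: measurable_norm_lt.
move=> x /=; rewrite ltr_norml in_itv/= => /andP[_ h]; lra.
Qed.

Lemma normal_mass_ball_left m z : m <= - z ->
  normal_mass m 1 (ball z) <= expR (- ((- m - z) ^+ 2 / 2)).
Proof.
move=> zm; rewrite normal_mass_shift; last exact: measurable_norm_lt.
have mz0 : 0 <= - m - z by lra.
apply: le_trans (gauss_ray_ge mz0); apply: le_normal_mass => //.
  by apply: measurable_shift; exact: measurable_norm_lt.
move=> x /=; rewrite ltr_norml in_itv/= andbT => /andP[h _]; lra.
Qed.

Lemma normal_mass_ball_far m z w : 0 <= w -> z + w <= `|m| ->
  normal_mass m 1 (ball z) <= expR (- (w ^+ 2 / 2)).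
Proof.
move=> w0; rewrite ler_normr => /orP[h|h].
  apply: (le_trans (normal_mass_ball_right _)); first lra.
  by rewrite ler_expR lerN2 ler_wpM2r ?invr_ge0// ler_sqr ?nnegrE//; lra.
apply: (le_trans (normal_mass_ball_left _)); first lra.
by rewrite ler_expR lerN2 ler_wpM2r ?invr_ge0// ler_sqr ?nnegrE//; lra.
Qed.

Local Notation numass A := (fine (nu A)).

Lemma numassE (A : set R) : measurable A -> ((numass A)%:E = nu A)%E.
Proof. by move=> mA; rewrite fineK// fin_num_measure. Qed.

(** An effect [t] with [|t| / s <= z - w] puts the mean of the z-score inside the ball with a margin
    [w]. *)
Lemma alt_law_ball_ge z w : 0 <= w -> 0 <= 1 - 2 * expR (- (w ^+ 2 / 2)) ->
  (1 - 2 * expR (- (w ^+ 2 / 2))) * numass [set t | `|t| <= s * (z - w)] <=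
  alt_law s nu (ball z).
Proof.
move=> w0 e0; have mI := measurable_norm_le (s * (z - w)).
have mf := measurable_normal_mass_scaled s (measurable_norm_lt z).
rewrite -lee_fin alt_lawE; last exact: measurable_norm_lt.
rewrite EFinM numassE//.
pose I : set R := [set t | `|t| <= s * (z - w)].
apply: (@le_trans _ _ (\int[nu]_(t in I)
  (normal_mass (t / s) 1 (ball z))%:E)%E).
  apply: ge0_integral_ge_cst => //; first exact: measurable_funTS.
  move=> t /= ts; apply: normal_mass_ball_ge => //.
  by rewrite normrM normfV (gtr0_norm s0) ler_pdivrMr// mulrC.
apply: ge0_subset_integral => //; first exact/measurable_EFinP.
by move=> t _; rewrite lee_fin normal_mass_ge0.
Qed.

(** Common pattern of the upper bounds: the normal mass is at most 1 on [A] and at most [f]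
    elsewhere. *)
Lemma alt_law_ball_le_of (z : R) (A : set R) (f : R -> R) :
  measurable A -> measurable_fun setT f -> (forall t, 0 <= f t) ->
  (forall t, ~ A t -> normal_mass (t / s) 1 (ball z) <= f t) ->
  ((alt_law s nu (ball z))%:E <= nu A + \int[nu]_t (f t)%:E)%E.
Proof.
move=> mA mf f0 h; rewrite alt_lawE; last exact: measurable_norm_lt.
have mI : measurable_fun setT (fun t : measurableTypeR R => (\1_A t : R)%:E).
  by apply/measurable_EFinP; exact: measurable_indic.
have mf' : measurable_fun setT (fun t : measurableTypeR R => (f t)%:E).
  exact/measurable_EFinP.
have -> : (nu A + \int[nu]_t (f t)%:E = \int[nu]_t ((\1_A t)%:E + (f t)%:E))%E.
  rewrite ge0_integralD//; first by rewrite integral_indic// setIT.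
  by move=> t _; rewrite lee_fin.
apply: ge0_le_integral => //;
  try (by move=> t _; rewrite ?adde_ge0// lee_fin ?normal_mass_ge0);
  try (by apply/measurable_EFinP; exact: (measurable_normal_mass_scaled s (measurable_norm_lt z)));
  try (by apply: emeasurable_funD).
move=> t _; rewrite -EFinD lee_fin indicE; case: (pselect (A t)) => At.
  rewrite mem_set//= ler_wpDr// normal_mass_le1//; exact: measurable_norm_lt.
by rewrite memNset//= add0r h.
Qed.

Lemma alt_law_ball_le_far z w : 0 <= w ->
  alt_law s nu (ball z) <=
  numass [set t | `|t| <= s * (z + w)] + expR (- (w ^+ 2 / 2)).
Proof.
move=> w0; rewrite -lee_fin EFinD numassE; last exact: measurable_norm_le.
have h t : ~ `|t| <= s * (z + w) ->
    normal_mass (t / s) 1 (ball z) <= (cst (expR (- (w ^+ 2 / 2))) t : R).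
  move=> /negP; rewrite -ltNge => ts; apply: normal_mass_ball_far => //.
  by rewrite normrM normfV (gtr0_norm s0) ler_pdivlMr// mulrC ltW.
apply: (le_trans (alt_law_ball_le_of (measurable_norm_le _) _ _ h)) => //.
  by move=> t; exact: expR_ge0.
rewrite leeD2l//; have := @integral_le_cstT R nu (cst (expR (- (w ^+ 2 / 2)))) (expR (- (w ^+ 2 / 2))).
by apply => // t; rewrite expR_ge0 lexx.
Qed.

(** For C = 0, where a margin [w] as in [alt_law_ball_le_far] would be too coarse: the effects
    beyond [s * z] are charged to Gaussian tails in [t / s], whose integrals [kern] at [z] and [- z]
    will be of order [s]. *)
Lemma alt_law_ball_le_kern z : 0 <= z ->
  alt_law s nu (ball z) <=
  numass [set t | `|t| <= s * z] + (kern nu s z + kern nu s (- z)).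
Proof.
move=> z0; rewrite -lee_fin !EFinD numassE; last exact: measurable_norm_le.
pose f t := expR (- ((t / s - z) ^+ 2 / 2)) + expR (- ((t / s - - z) ^+ 2 / 2)).
have mk y : measurable_fun setT
    (fun t : measurableTypeR R => (expR (- ((t / s - y) ^+ 2 / 2)))%:E).
  by apply/measurable_EFinP; exact: measurable_kern_integrand.
have mf : measurable_fun setT f.
  by apply: measurable_funD; exact: measurable_kern_integrand.
have f0 t : 0 <= f t by rewrite addr_ge0 ?expR_ge0.
have h t : ~ `|t| <= s * z -> normal_mass (t / s) 1 (ball z) <= f t.
  move=> /negP; rewrite -ltNge => ts.
  have : z < `|t / s|.
    by rewrite normrM normfV (gtr0_norm s0) ltr_pdivlMr// mulrC.
  rewrite ltr_normr => /orP[zt|zt].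
    apply: (le_trans (normal_mass_ball_right (ltW zt))).
    by rewrite lerDl expR_ge0.
  apply: (le_trans (normal_mass_ball_left _)); first by rewrite lerNr ltW.
  rewrite /f opprK -opprD sqrrN lerDr expR_ge0//.
apply: (le_trans (alt_law_ball_le_of (measurable_norm_le _) mf f0 h)).
rewrite leeD2l// !kernE// -ge0_integralD//; try (by move=> t _; rewrite lee_fin expR_ge0).
Qed.

Section bounded_density.
Variables (I : set R) (rho : R -> R) (M : R).
Hypotheses (mI : measurable I) (mrho : measurable_fun I rho) (M0 : 0 <= M)
  (rho_bound : forall t, I t -> 0 < rho t <= M)
  (nuE : forall A, measurable A -> A `<=` I ->
    nu A = (\int[lebesgue_measure]_(t in A) (rho t)%:E)%E).

Let rho' := rho \_ I.

Let mrho' : measurable_fun setT rho'.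
Proof. by have [h _] := @measurable_restrictT _ _ _ _ I rho mI; exact: h. Qed.

Let rho'0 t : 0 <= rho' t.
Proof.
rewrite /rho' patchE; case: ifPn => //; rewrite inE => /rho_bound /andP[].
by move=> /ltW.
Qed.

Lemma integral_density_le (f : R -> R) : measurable_fun setT f ->
  (forall t, 0 <= f t) ->
  (\int[nu]_(t in I) (f t)%:E <= M%:E * \int[lebesgue_measure]_t (f t)%:E)%E.
Proof.
move=> mf f0.
have mf' : measurable_fun setT (fun t : measurableTypeR R => (f t * \1_I t)%:E).
  by apply/measurable_EFinP; apply: measurable_funM => //; exact: measurable_indic.
rewrite [leLHS](eq_measure_integral (density_measure lebesgue_measure mrho' rho'0)); last first.
  move=> A mA AI; apply: (etrans (nuE mA AI)); apply: eq_integral => t; rewrite inE => At.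
  by rewrite /rho' patchE mem_set//; exact: AI.
rewrite integral_indic_mul ge0_integral_density_measure//; last first.
  by move=> t; rewrite lee_fin mulr_ge0.
rewrite -ge0_integralZl//; last 2 first.
- exact/measurable_EFinP.
- by move=> t _; rewrite lee_fin.
apply: ge0_le_integral => //;
  try (by move=> t _; rewrite -?EFinM lee_fin ?mulr_ge0);
  try (by apply/measurable_EFinP; apply: measurable_funM);
  try (by apply: emeasurable_funM => //; exact/measurable_EFinP).
move=> t _; rewrite -!EFinM lee_fin indicE /rho' patchE.
case: ifPn => It; last by rewrite !mulr0 mulr_ge0.
by rewrite mulr1 mulrC ler_wpM2r//; move: It; rewrite inE => /rho_bound /andP[].
Qed.

End bounded_density.

Lemma integral_kern_lebesgue z :
  (\int[lebesgue_measure]_t (expR (- ((t / s - z) ^+ 2 / 2)))%:E =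
   (s * Num.sqrt (pi *+ 2))%:E :> \bar R)%E.
Proof.
have peak0 := @normal_peak_gt0 R s (lt0r_neq0 s0).
have peakE : s * Num.sqrt (pi *+ 2) = (normal_peak s)^-1 :> R.
  rewrite /normal_peak invrK -mulrnAr sqrtrM ?sqr_ge0// sqrtr_sqr gtr0_norm//.
rewrite peakE -[RHS]mule1 -(integral_normal_pdf (s * z) s) -ge0_integralZl//.
- apply: eq_integral => t _; rewrite normal_pdfE ?gt_eqF// -EFinM mulrA mulVf ?gt_eqF//.
  rewrite mul1r /normal_fun; congr (expR _)%:E; field; rewrite gt_eqF//.
- by apply/measurable_EFinP; exact: measurable_normal_pdf.
- by move=> t _; rewrite lee_fin normal_pdf_ge0.
- by rewrite lee_fin invr_ge0 ltW.
Qed.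

End alternative_bounds.

(** * Discretization and risk bounds *)

Section ordered_pvalues.
Context {R : realType} (m : nat) (pv : 'I_m -> R).
Local Notation count_le t := #|[set i | pv i <= t]%SET|.

(** In the sorted list the values at most [t] form an initial segment, whose length is the count. *)
Lemma ordered_le k t : (0 < k <= m)%N -> (ordered pv k <= t) = (k <= count_le t)%N.
Proof.
move=> /andP[k0 km]; rewrite /ordered; set s := sort _ _.
have sz : size s = m by rewrite size_sort size_image card_ord.
have ss : sorted <=%R s by exact: sort_le_sorted.
have -> : count_le t = count (fun x => x <= t) s.
  rewrite (permP (permEl (perm_sort _ _))) /image_mem count_map -sum1_count.
  by rewrite big_enum_cond -sum1_card; apply: eq_bigl => i; rewrite !inE.
have k1 : (k.-1 < size s)%N by rewrite sz prednK.
apply/idP/idP => [h|].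
  have : all (fun x => x <= t) (take k s).
    apply/(all_nthP 0) => j; rewrite size_take sz.
    have -> : (if (k < m)%N then k else m) = k.
      by case: ltnP => // mk; apply/eqP; rewrite eqn_leq km mk.
    move=> jk; rewrite nth_take//; apply: le_trans h.
    apply: (sorted_leq_nth (@le_trans _ _) (@lexx _ _) 0 ss); rewrite ?inE ?sz//.
    - exact: leq_trans jk km.
    - by rewrite prednK.
    - by rewrite -ltnS prednK.
  rewrite all_count => /eqP; rewrite size_takel ?sz// => h'.
  by rewrite -[X in count _ X](cat_take_drop k s) count_cat h' leq_addr.
apply: contraTT; rewrite -ltNge -ltnNge => h.
have : ~~ has (fun x => x <= t) (drop k.-1 s).
  rewrite -all_predC; apply/(all_nthP 0) => j; rewrite size_drop sz => jk /=.
  rewrite nth_drop -ltNge; apply: (lt_le_trans h).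
  by apply: (sorted_leq_nth (@le_trans _ _) (@lexx _ _) 0 ss); rewrite ?inE ?sz ?leq_addr//; move: jk k0 km; clear; lia.
rewrite has_count -leqNgt leqn0 => /eqP h'.
rewrite -[X in count _ X](cat_take_drop k.-1 s) count_cat h' addn0.
apply: (leq_ltn_trans (count_size _ _)); rewrite size_takel ?ltn_predL//.
by rewrite ltnW.
Qed.

Lemma count_le_mono t u : t <= u -> (count_le t <= count_le u)%N.
Proof.
move=> tu; apply: subset_leq_card; apply/fintype.subsetP => i; rewrite !inE.
by move=> /le_trans; apply.
Qed.

Lemma count_le_lt t i : t < pv i -> (count_le t < count_le (pv i))%N.
Proof.
move=> ti; apply: proper_card; apply/properP; split.
  by apply/fintype.subsetP => j; rewrite !inE => /le_trans; apply; exact: ltW.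
by exists i; rewrite !inE ?lexx// -ltNge.
Qed.

Variables (alpha : R) (c : 'I_m -> nat).
Hypotheses (alpha0 : 0 < alpha) (c_le : forall i, (c i <= m)%N)
  (c_cell : forall i k, (0 < k <= m)%N ->
    (pv i <= k%:R * alpha / m%:R) = (c i < k)%N).

Let thr k : R := k%:R * alpha / m%:R.

Let ordered_thr k : (0 < k <= m)%N ->
  (ordered pv k <= thr k) = (k <= count_below c k)%N.
Proof.
move=> km; rewrite ordered_le//; congr (_ <= _)%N; apply: eq_card => i.
by rewrite !inE c_cell.
Qed.

Let thr_mono k l : (k <= l)%N -> thr k <= thr l.
Proof.
by move=> kl; rewrite /thr ler_wpM2r ?invr_ge0// ler_wpM2r ?ler_nat// ltW.
Qed.

(** A p-value above the [kF]-th smallest but at most the [kF]-th threshold would leave [kF + 1]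
    p-values at most that threshold, against the maximality of [kF]. Comparing with the order
    statistic or with the threshold is thus the same. *)
Lemma BH_cells :
  let kF := (\max_(1 <= k < m.+1 |
    (ordered pv k <= k%:R * alpha / m%:R)%R) k)%N in
  [set i | (0 < kF)%N && (pv i <= ordered pv kF)]%SET =
  [set i | (c i < step_up_index c)%N]%SET.
Proof.
move=> kF; have -> : kF = step_up_index c.
  rewrite /kF /step_up_index big_nat_cond [RHS]big_nat_cond.
  apply: eq_bigl => k; case: (boolP (1 <= k < m.+1)%N) => //= km.
  by rewrite -ordered_thr.
apply/setP => i; rewrite !inE.
case: (step_up_indexP c) => [->//|]; move: {kF} (step_up_index c) (@step_up_index_ge _ c).
move=> k kmax [k0 km kN]; rewrite k0/=.
have k0m : (0 < k <= m)%N by rewrite k0.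
have kthr : ordered pv k <= thr k by rewrite ordered_thr.
rewrite -c_cell//; apply/idP/idP => [h|h]; first exact: le_trans h kthr.
rewrite leNgt; apply/negP => lt.
have h1 : (k < count_le (pv i))%N.
  apply: leq_ltn_trans (count_le_lt lt); by rewrite -ordered_le.
have kSm : (0 < k.+1 <= m)%N.
  by rewrite /= -[leqRHS](card_ord m); apply: (leq_trans h1); exact: max_card.
suff : (k.+1 <= k)%N by rewrite ltnn.
apply: kmax => //; rewrite -ordered_thr// ordered_le//; apply: (leq_trans h1).
by apply: count_le_mono; apply: (le_trans h); exact: thr_mono.
Qed.

(** Suppose a p-value exceeds the [kG]-th threshold. At least [kG - 1] p-values are at most the
    previous threshold; together with this one, [kG] of them are at most its value, so it is not
    below the [kG]-th smallest. *)
Lemma SD_cells :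
  let kG := (find (fun k : nat => k%:R * alpha / m%:R < ordered pv k)
               (iota 1 m)).+1 in
  [set i | (m < kG)%N || (pv i < ordered pv kG)]%SET =
  [set i | (c i < step_down_index c)%N]%SET.
Proof.
move=> kG; have -> : kG = step_down_index c.
  rewrite /kG /step_down_index; congr S; apply: eq_in_find => k.
  by rewrite mem_iota add1n ltnS => km; rewrite ltNge ordered_thr// -ltnNge.
apply/setP => i; rewrite !inE; have := step_down_index_le c.
have [kGm _|mk kle] := leqP (step_down_index c) m; last first.
  have -> : step_down_index c = m.+1 by apply/eqP; rewrite eqn_leq kle.
  by rewrite ltnS c_le.
have Nk := step_down_indexP kGm; rewrite /=.
have lt_k := @lt_step_down_index _ c.
move: (step_down_index c) (ltn0Sn _ : (0 < step_down_index c)%N) kGm Nk lt_k.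
move=> k k0 km Nk lt_k; have k0m : (0 < k <= m)%N by rewrite k0.
rewrite -c_cell//.
have kthr : thr k < ordered pv k by rewrite ltNge ordered_thr// -ltnNge.
apply/idP/idP => [h|h]; last exact: le_lt_trans h kthr.
rewrite leNgt; apply/negP => lt.
move: h; rewrite ltNge ordered_le//; case/negP.
have := count_le_lt lt; apply: leq_trans; rewrite -(prednK k0) ltnS.
have [->//|k1] := posnP k.-1.
have kpm : (0 < k.-1 <= m)%N by rewrite k1 (leq_trans (leq_pred _)).
apply: (@leq_trans (count_below c k.-1)).
  by apply: lt_k; rewrite k1 ltn_predL.
apply: (@leq_trans (count_below c k)); first exact: count_below_mono (leq_pred _).
apply: subset_leq_card; apply/fintype.subsetP => j; rewrite !inE.
by rewrite prednK// c_cell.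
Qed.

End ordered_pvalues.

Section pvalue_cells.
Context {R : realType} (m : nat) (alpha : R).
Hypothesis alpha0 : 0 <= alpha.

(** Ranges from 0 to [m], the value [m] meaning above all thresholds; ordinals start at 0, whence
    [k.+1]. *)
Definition pcell (z : R) : nat :=
  #|[set k : 'I_m | k.+1%:R * alpha / m%:R < ptail z]%SET|.

Lemma pcell_le z : (pcell z <= m)%N.
Proof. by rewrite -[leqRHS](card_ord m); exact: max_card. Qed.

(** The thresholds are nondecreasing in [k], so those below the p-value are the first ones. *)
Lemma pcellP z k : (0 < k <= m)%N ->
  (ptail z <= k%:R * alpha / m%:R) = (pcell z < k)%N.
Proof.
move=> /andP[k0 km].
have thr_mono j l : (j <= l)%N -> j%:R * alpha / m%:R <= l%:R * alpha / m%:R.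
  by move=> jl; rewrite ler_wpM2r ?invr_ge0// ler_wpM2r ?ler_nat.
have card_lt j : (j <= m)%N -> #|[set i : 'I_m | (i < j)%N]%SET| = j.
  move=> jm; have inj : injective (widen_ord jm).
    by move=> x y /(congr1 val)/= xy; apply: val_inj.
  rewrite -[RHS](card_ord j) -(card_imset _ inj).
  apply: eq_card => i; rewrite inE; apply/idP/imsetP => [ij|[x _ ->]]; last exact: (ltn_ord x).
  by exists (Ordinal ij) => //; apply: val_inj.
apply/idP/idP => [h|].
  rewrite -[X in (_ < X)%N](prednK k0) ltnS -[leqRHS](card_lt k.-1).
    apply: subset_leq_card; apply/fintype.subsetP => i; rewrite !inE => hi.
    rewrite ltnNge; apply/negP => ki; have := lt_le_trans hi h.
    by rewrite ltNge thr_mono// -(prednK k0) ltnS.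
  exact: leq_trans (leq_pred _) km.
apply: contraTT; rewrite -ltNge -leqNgt => h.
rewrite -[X in (X <= _)%N](card_lt k)//.
apply: subset_leq_card; apply/fintype.subsetP => i; rewrite !inE => ik.
by apply: le_lt_trans h; exact: thr_mono.
Qed.

End pvalue_cells.

Section finite_fibers.
Context (d : measure_display) (T : measurableType d) (R : realType) (C : finType)
  (tau : T -> C).
Hypothesis mtau : forall c, measurable [set z | tau z = c].

Lemma measurable_fibers (Q : pred C) : measurable [set z | Q (tau z)].
Proof.
rewrite (_ : [set z | _] = \bigcup_(c in [set c | Q c]) [set z | tau z = c]).
  apply: fin_bigcup_measurable => //; exact: finite_finset.
by apply/seteqP; split => z /=; [move=> Qz; exists (tau z)|move=> [c Qc ->]].
Qed.

Lemma integral_fibers (m : {measure set T -> \bar R}) (F : C -> R) :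
  (forall c, 0 <= F c) ->
  (\int[m]_z (F (tau z))%:E = \sum_c (F c)%:E * m [set z | tau z = c])%E.
Proof.
move=> F0.
transitivity (\int[m]_z \sum_c ((F c)%:E * (\1_[set z | tau z = c] z)%:E))%E.
  apply: eq_integral => z _; rewrite (bigD1 (tau z))//= indicE mem_set// mule1.
  rewrite big1 ?adde0// => c cz; rewrite indicE memNset ?mule0//.
  by move=> /esym/eqP; rewrite (negbTE cz).
have mI c : measurable_fun setT (fun z => (\1_[set z | tau z = c] z : R)%:E).
  by apply/measurable_EFinP; exact: measurable_indic.
rewrite ge0_integral_sum//.
- apply: eq_bigr => c _; rewrite ge0_integralZl// ?lee_fin// integral_indic//.
  by rewrite setIT.
- by move=> c; exact: measurable_funeM.
- by move=> c z _; rewrite mule_ge0// lee_fin.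
Qed.

Lemma measure_fibers (m : {measure set T -> \bar R}) (Q : pred C) :
  (m [set z | Q (tau z)] = \sum_(c | Q c) m [set z | tau z = c])%E.
Proof.
have := @integral_fibers m (fun c => (Q c)%:R) (fun c => ler0n _ _).
move=> h; transitivity (\int[m]_z ((Q (tau z))%:R%:E : \bar R))%E.
  transitivity (\int[m]_z (\1_[set z | Q (tau z)] z)%:E)%E.
    by rewrite integral_indic ?setIT//; exact: measurable_fibers.
  apply: eq_integral => z _; rewrite indicE; congr (_%:R)%:E; congr nat_of_bool.
  by apply/idP/idP; rewrite inE.
by rewrite h [RHS]big_mkcond; apply: eq_bigr => c _; case: (Q c); rewrite ?mul1e ?mul0e.
Qed.

End finite_fibers.

Section real_fibers.
Context {R : realType} (C : finType) (tau : R -> C).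
Hypothesis mtau : forall c, measurable [set z | tau z = c].

Lemma normal_mass_fibers (m s : R) (Q : pred C) :
  normal_mass m s [set z | Q (tau z)] =
  \sum_(c | Q c) normal_mass m s [set z | tau z = c].
Proof.
apply: EFin_inj; rewrite normal_massE; last exact: measurable_fibers.
rewrite -sumEFin; apply: (etrans (@measure_fibers _ (measurableTypeR R) R C tau mtau (normal_prob m s) Q)).
by apply: eq_bigr => c _; rewrite normal_massE.
Qed.

Lemma alt_law_fibers (s : R) nu (Q : pred C) :
  alt_law s nu [set z | Q (tau z)] =
  \sum_(c | Q c) alt_law s nu [set z | tau z = c].
Proof.
apply: EFin_inj; rewrite alt_lawE; last exact: measurable_fibers.
rewrite -sumEFin -big_filter.
under [RHS]eq_bigr do rewrite alt_lawE//.
rewrite -ge0_integral_sum//.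
- apply: eq_integral => t _; rewrite sumEFin big_filter.
  by rewrite normal_mass_fibers.
- by move=> c; apply/measurable_EFinP; exact: measurable_normal_mass_scaled.
- by move=> c t _; rewrite lee_fin normal_mass_ge0.
Qed.

End real_fibers.

(** * Bounds on the three risks for fixed m *)

Section risk_bounds.
Context {R : realType} (m n : nat) (p sigma delta0 deltaA alpha : R)
    (nu : probability (measurableTypeR R) R)
    (d : measure_display) (Omega : measurableType d) (P : probability Omega R)
    (mu : 'I_m -> {RV P >-> R}) (X : 'I_n -> 'I_m -> {RV P >-> R}) (a b : R).
Hypotheses (sigma0 : 0 < sigma) (n0 : (0 < n)%N) (p01 : 0 < p < 1)
  (delta00 : 0 < delta0) (deltaA0 : 0 < deltaA)
  (alpha0 : 0 < alpha) (alpha4 : alpha <= 4^-1)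
  (nu0 : nu [set 0] = 0%E) (model : two_groups_model p sigma nu mu X)
  (cutoffs : oracle_cutoffs n p delta0 deltaA sigma nu a b).

Let s := sigma / Num.sqrt n%:R.
(** Carries a bound on a sample mean to the scale of z-scores. *)
Let scale x := Num.sqrt n%:R * x / sigma.
Let Z i w := zscore sigma (fun j i => X j i w) i.

(* The model becomes finite once each z-score is reduced to the number of
   thresholds k * alpha / m below its p-value and the decision of the oracle. *)
Let tau (z : R) : 'I_m.+1 * bool :=
  (inord (pcell m alpha z), ~~ (scale a < z < scale b)).

Let kappa (c : 'I_m.+1 * bool) : nat := val c.1.

Let kappa_tau z : kappa (tau z) = pcell m alpha z.
Proof. by rewrite /kappa /tau/= inordK// ltnS pcell_le. Qed.

Lemma measurable_ptail_le t : measurable [set z : R | ptail z <= t].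
Proof.
rewrite (_ : [set z | _] = ptail @^-1` `]-oo, t]).
  rewrite -[X in measurable X]setTI.
  have h : measurable_fun setT (@ptail R).
    by apply: continuous_measurable_fun; exact: continuous_ptail.
  by apply: (h measurableT).
by apply/seteqP; split => z /=; rewrite in_itv.
Qed.

Let measurable_pcell_lt k : measurable [set z : R | (pcell m alpha z < k)%N].
Proof.
have [->|k0] := posnP k.
  by rewrite (_ : [set z | _] = set0)//; apply/seteqP; split.
have [km|mk] := leqP k m.
  rewrite (_ : [set z | _] = [set z | ptail z <= k%:R * alpha / m%:R]).
    exact: measurable_ptail_le.
  by apply/seteqP; split => z /=; rewrite pcellP ?k0 ?ltW.
rewrite (_ : [set z | _] = setT)//; apply/seteqP; split => // z _ /=.
exact: leq_ltn_trans (pcell_le _ _ _) mk.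
Qed.

Let measurable_tau c : measurable [set z | tau z = c].
Proof.
rewrite (_ : [set z | _] = ([set z : R | (pcell m alpha z < (kappa c).+1)%N] `\`
  [set z : R | (pcell m alpha z < kappa c)%N]) `&`
  (if c.2 then ~` `]scale a, scale b[%classic else `]scale a, scale b[%classic)).
  apply: measurableI; first by apply: measurableD; exact: measurable_pcell_lt.
  by case: ifP => // _; apply: measurableC.
apply/seteqP; split => z /=.
  move=> <-; rewrite kappa_tau ltnSn ltnn; split; first by split.
  by rewrite /tau/=; case: ifPn => /=; rewrite in_itv/= ?negbK// => /negP.
rewrite ltnS => -[[h1 /negP]]; rewrite -leqNgt => h2 h3.
apply/eqP; rewrite -pair_eqE/=; apply/andP; split.
  by apply/eqP/val_inj; rewrite -[LHS]/(kappa (tau z)) kappa_tau; apply/eqP; rewrite eqn_leq h1.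
move: h3; rewrite /tau/=; case: c.2; rewrite /= in_itv/=.
  by move=> /negP ->.
by move=> ->.
Qed.

Let state w : {ffun 'I_m -> bool * ('I_m.+1 * bool)} :=
  [ffun i => (mu i w != 0, tau (Z i w))].

Let W (hc : bool * ('I_m.+1 * bool)) : R :=
  mark_mass p s nu hc.1 [set z | tau z = hc.2].

Let s_gt0 : 0 < s. Proof. by rewrite divr_gt0// sqrtr_gt0 ltr0n. Qed.

Let alt_law_ge0 (D : set R) : 0 <= alt_law s nu D.
Proof.
by apply: fine_ge0; apply: integral_ge0 => t _; rewrite lee_fin normal_mass_ge0.
Qed.

Let W0 t : 0 <= W t.
Proof.
have /andP[p0 p1] := p01; rewrite /W /mark_mass; case: ifP => _.
  by rewrite mulr_ge0// ltW.
by rewrite mulr_ge0 ?normal_mass_ge0// subr_ge0 ltW.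
Qed.

Let sum_W_true (Q : pred ('I_m.+1 * bool)) :
  \sum_(c | Q c) W (true, c) = p * alt_law s nu [set z | Q (tau z)].
Proof. by rewrite (alt_law_fibers measurable_tau) mulr_sumr. Qed.

Let sum_W_false (Q : pred ('I_m.+1 * bool)) :
  \sum_(c | Q c) W (false, c) = (1 - p) * normal_mass 0 1 [set z | Q (tau z)].
Proof. by rewrite (normal_mass_fibers measurable_tau) mulr_sumr. Qed.

Lemma normal_massT (y t : R) : normal_mass y t setT = 1.
Proof. exact: (congr1 fine (@probability_setT _ _ _ (normal_prob y t))). Qed.

Let alt_lawT : alt_law s nu setT = 1.
Proof.
transitivity (fine (\int[nu]_t (cst 1%E t)))%E.
  by congr fine; apply: eq_integral => t _; rewrite normal_massT.
rewrite integral_cst// mul1e.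
exact: (congr1 fine (@probability_setT _ _ _ nu)).
Qed.

Let prior : \sum_c W (true, c) = p.
Proof.
rewrite (sum_W_true xpredT) (_ : [set z | _] = setT); last exact/seteqP.
by rewrite alt_lawT mulr1.
Qed.

Let W1 : \sum_t W t = 1.
Proof.
rewrite sum_bool_prod prior (sum_W_false xpredT) (_ : [set z | _] = setT); last exact/seteqP.
by rewrite normal_massT mulr1 addrC subrK.
Qed.

(** By [joint_law] the states have the product law of [W], so expectations in the model become
    finite sums. *)
Let mean_state (F : {ffun 'I_m -> bool * ('I_m.+1 * bool)} -> R) :
  (forall x, 0 <= F x) ->
  fine 'E_P[fun w => F (state w)] = pmean W F.
Proof.
move=> F0.
have stateP x : [set w | state w = x] = [set w | forall i, (mu i w != 0) = (x i).1 /\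
    [set z | tau z = (x i).2] (zscore sigma (fun j i => X j i w) i)].
  apply/seteqP; split => w /=.
    by move=> <- i; rewrite ffunE.
  move=> h; apply/ffunP => i; rewrite ffunE; have [-> zi] := h i.
  by rewrite /Z zi -surjective_pairing.
have PE x : P [set w | state w = x] = (\prod_i W (x i))%:E.
  rewrite stateP (@joint_law _ m n p sigma nu _ _ P mu X (fun i => (x i).1)
    (fun i => [set z | tau z = (x i).2]))//.
have mstate x : measurable [set w | state w = x].
  rewrite (_ : [set w | _] = \bigcap_(i in [set: 'I_m])
    ((mu i @^-1` (if (x i).1 then ~` [set 0] else [set 0])) `&`
     (fun w => Z i w) @^-1` [set z | tau z = (x i).2])).
    apply: fin_bigcap_measurable => // i _; apply: measurableI.
      rewrite -[X in measurable X]setTI; apply: measurable_funP => //.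
      by case: ifP => // _; apply: measurableC.
    have mZ : measurable_fun setT (Z i).
      rewrite /Z /zscore /sample_mean; apply: measurable_funM => //.
      apply: measurable_funM => //; apply: measurable_funM => //.
      by apply: measurable_sum => j; exact: measurable_funP.
    by rewrite -[X in measurable X]setTI; apply: mZ.
  rewrite stateP; apply/seteqP; split => w /=.
    move=> h i _; have [h1 h2] := h i; split => //; rewrite -h1.
    by case: (eqVneq (mu i w) 0) => /= [->|/eqP].
  move=> h i; have [h1 h2] := h i I; split => //.
  by move: h1; case: ifP => _ /=; [move=> /eqP|move=> ->; rewrite eqxx].
rewrite unlock (integral_fibers mstate)//.
rewrite (eq_bigr (fun x => (F x * \prod_i W (x i))%:E)); last first.
  by move=> x _; rewrite EFinM; congr (_ * _)%E; exact: PE.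
by rewrite sumEFin.
Qed.

Let risk_state (rule : testing_rule m n) phi :
  (forall w, rule (fun j i => X j i w) = phi (state w)) ->
  risk delta0 deltaA mu X rule = prisk W delta0 deltaA phi.
Proof.
move=> h; rewrite /risk /prisk; congr (_ * _ + _ * _).
  rewrite -mean_state//; congr (fine 'E_P[_]); apply/funext => w; congr _%:R.
  by apply: eq_card => i; rewrite !inE !ffunE/= h negbK.
rewrite -mean_state//; congr (fine 'E_P[_]); apply/funext => w; congr _%:R.
by apply: eq_card => i; rewrite !inE !ffunE/= h.
Qed.

Let phi_BH (x : {ffun 'I_m -> bool * ('I_m.+1 * bool)}) : {set 'I_m} :=
  [set i | (cells kappa x i < step_up_index (cells kappa x))%N]%SET.
Let phi_SD (x : {ffun 'I_m -> bool * ('I_m.+1 * bool)}) : {set 'I_m} :=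
  [set i | (cells kappa x i < step_down_index (cells kappa x))%N]%SET.
Let phi_oracle (x : {ffun 'I_m -> bool * ('I_m.+1 * bool)}) : {set 'I_m} :=
  [set i | (x i).2.2]%SET.

Let cells_state w i : cells kappa (state w) i = pcell m alpha (Z i w).
Proof. by rewrite /cells ffunE/= kappa_tau. Qed.

Let BH_state w : BH_rule sigma alpha (fun j i => X j i w) = phi_BH (state w).
Proof.
rewrite /BH_rule /phi_BH.
apply: (@BH_cells R m (pvalue sigma (fun j i => X j i w)) alpha (cells kappa (state w)) alpha0).
- by move=> i k km; rewrite cells_state -(pcellP (ltW alpha0)).
Qed.

Let SD_state w : SD_rule sigma alpha (fun j i => X j i w) = phi_SD (state w).
Proof.
have cm i : (cells kappa (state w) i <= m)%N by rewrite cells_state pcell_le.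
have cc i k : (0 < k <= m)%N ->
    (pvalue sigma (fun j i => X j i w) i <= k%:R * alpha / m%:R) =
    (cells kappa (state w) i < k)%N.
  by move=> km; rewrite cells_state -(pcellP (ltW alpha0)).
exact: (SD_cells cm cc).
Qed.

Let oracle_state w : bayes_oracle a b (fun j i => X j i w) = phi_oracle (state w).
Proof.
apply/setP => i; rewrite !inE ffunE /tau/= /Z /zscore /scale.
have sq0 : 0 < Num.sqrt n%:R :> R by rewrite sqrtr_gt0 ltr0n.
by rewrite !ltr_pM2r ?invr_gt0// !ltr_pM2l.
Qed.

Let odds := (1 - p) * delta0 / (p * deltaA).

(** On the scale of z-scores the exponent of the oracle equation is that of [lik]: a cutoff is a
    point where the likelihood ratio equals the critical odds. *)
Lemma lik_cutoff x : oracle_equation n p delta0 deltaA sigma nu x ->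
  lik nu s (scale x) = odds.
Proof.
have /andP[p0 p1] := p01.
have n0' : 0 < Num.sqrt n%:R :> R by rewrite sqrtr_gt0 ltr0n.
have nE : n%:R = Num.sqrt n%:R ^+ 2 :> R by rewrite sqr_sqrtr ?ler0n.
rewrite /oracle_equation => h.
have e : ((1 - p) * delta0)%:E = ((p * deltaA) * lik nu s (scale x))%:E.
  rewrite h [RHS]EFinM (likE nu s_gt0); congr (_ * _)%E; apply: eq_integral => t _.
  congr (expR _)%:E; rewrite /scale /s; move: nE n0'; set q := Num.sqrt n%:R.
  by move=> -> q0; field; rewrite !gt_eqF.
have [h'] := e; rewrite /odds h'; field.
by rewrite !gt_eqF.
Qed.

(** By convexity [lik] is at most [odds] between the cutoffs and at least [odds] outside. Each fibre
    of [tau] lies on one side, since the decision of the oracle is part of [tau], and integration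
    over the fibre preserves the comparison. *)
Let oracle_weights c :
  if c.2 then delta0 * W (false, c) <= deltaA * W (true, c)
         else deltaA * W (true, c) <= delta0 * W (false, c).
Proof.
have /andP[p0 p1] := p01.
have [a0 b0 /lik_cutoff la /lik_cutoff lb] := cutoffs.
have sq0 : 0 < Num.sqrt n%:R :> R by rewrite sqrtr_gt0 ltr0n.
have ab : scale a < scale b.
  by rewrite /scale ltr_pM2r ?invr_gt0// ltr_pM2l// (lt_trans a0).
have odds0 : 0 <= odds by rewrite divr_ge0 ?mulr_ge0 ?subr_ge0 ?ltW.
have oddsE y : deltaA * (p * (odds * y)) = delta0 * ((1 - p) * y).
  by rewrite /odds; field; rewrite !gt_eqF.
have fibre z : tau z = c -> c.2 = ~~ (scale a < z < scale b) by move=> <-.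
rewrite /W /mark_mass/=; case: ifPn => c2; rewrite -oddsE !ler_pM2l//.
  apply: (alt_law_ge s_gt0) => // z /fibre; rewrite c2 => /esym.
  rewrite negb_and -!leNgt => /orP[za|bz].
    apply: (@lik_beyond _ _ _ s_gt0 (scale b) (scale a)); rewrite ?la ?lb//.
    by right; rewrite za ab.
  apply: (@lik_beyond _ _ _ s_gt0 (scale a) (scale b)); rewrite ?la ?lb//.
  by left; rewrite bz ab.
apply: (alt_law_le s_gt0) => // z /fibre; rewrite (negbTE c2) => /esym/negbFE/andP[az zb].
by apply: (lik_between s_gt0 az zb); rewrite ?la ?lb.
Qed.

Let oracle_le phi :
  (forall x y : {ffun 'I_m -> bool * ('I_m.+1 * bool)},
    (forall i, (x i).2 = (y i).2) -> phi x = phi y) ->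
  risk delta0 deltaA mu X (bayes_oracle a b) <= prisk W delta0 deltaA phi.
Proof.
move=> h; rewrite (risk_state oracle_state).
exact: (@oracle_optimal R m _ W W0 W1 delta0 deltaA (fun c => c.2)).
Qed.

Let cells_eq (x y : {ffun 'I_m -> bool * ('I_m.+1 * bool)}) :
  (forall i, (x i).2 = (y i).2) -> cells kappa x = cells kappa y.
Proof. by move=> xy; apply/funext => i; rewrite /cells xy. Qed.

Lemma risk_oracle_le_BH :
  risk delta0 deltaA mu X (bayes_oracle a b) <=
  risk delta0 deltaA mu X (BH_rule sigma alpha).
Proof.
rewrite (risk_state BH_state); apply: oracle_le => x y /cells_eq xy.
by rewrite /phi_BH xy.
Qed.

Lemma risk_oracle_le_SD :
  risk delta0 deltaA mu X (bayes_oracle a b) <=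
  risk delta0 deltaA mu X (SD_rule sigma alpha).
Proof.
rewrite (risk_state SD_state); apply: oracle_le => x y /cells_eq xy.
by rewrite /phi_SD xy.
Qed.

(** The false rejections are dropped; what remains is a sum of [m] equal miss probabilities. *)
Lemma risk_oracle_ge :
  deltaA * (m%:R * p * alt_law s nu `]scale a, scale b[) <=
  risk delta0 deltaA mu X (bayes_oracle a b).
Proof.
rewrite (risk_state oracle_state) /prisk.
rewrite ler_wpDl ?mulr_ge0 ?(ltW delta00)//.
  by rewrite /pmean sumr_ge0// => x _; rewrite mulr_ge0// prodr_ge0.
rewrite ler_pM2l//.
have -> : pmean W (fun x => #|[set i | (x i).1 && (i \notin phi_oracle x)]%SET|%:R) =
    \sum_(i < m) \sum_c W (true, c) * (~~ c.2)%:R.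
  rewrite (@eq_pmean _ _ _ W _ (fun x => \sum_i ((x i).1 && ~~ (x i).2.2)%:R)).
    rewrite pmean_sum; apply: eq_bigr => i _.
    rewrite (pmean_marginal W1 i (fun t => (t.1 && ~~ t.2.2)%:R)).
    rewrite sum_bool_prod/= [X in _ + X]big1 ?addr0// => c _.
    by rewrite mulr0.
  by move=> x; rewrite cardsE_sum; apply: eq_bigr => i _; rewrite inE.
rewrite sumr_const card_ord -[leRHS]mulr_natl -[leLHS]mulrA ler_wpM2l//.
have -> : \sum_c W (true, c) * (~~ c.2)%:R = \sum_(c | ~~ c.2) W (true, c).
  by rewrite [RHS]big_mkcond; apply: eq_bigr => c _; case: ifP; rewrite ?mulr1 ?mulr0.
rewrite (sum_W_true (fun c => ~~ c.2)).
rewrite (_ : [set z | _] = `]scale a, scale b[%classic)//.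
by apply/seteqP; split => z /=; rewrite negbK in_itv.
Qed.

(** Null p-values are uniform; [alpha <= 1 / 4] keeps the thresholds in the open unit interval where
    [gauss_ptail_le] applies. *)
Let null_cells k : (0 < k <= m)%N ->
  \sum_(c | (kappa c < k)%N) W (false, c) <= alpha * k%:R / m%:R.
Proof.
move=> km; have /andP[k0 kml] := km; have /andP[p0 p1] := p01.
have m0 : (0 < m)%N by exact: leq_trans kml.
rewrite (sum_W_false (fun c => (kappa c < k)%N)).
rewrite (_ : [set z | _] = [set z | ptail z <= k%:R * alpha / m%:R]); last first.
  by apply/seteqP; split => z /=; rewrite kappa_tau (pcellP (ltW alpha0)).
rewrite gauss_ptail_le; last first.
  rewrite divr_gt0 ?mulr_gt0 ?ltr0n//= ltr_pdivrMr ?ltr0n// mul1r.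
  have : k%:R * alpha <= m%:R * alpha by rewrite ler_wpM2r ?ler_nat// ltW.
  have : m%:R * alpha <= m%:R * 4^-1 by rewrite ler_wpM2l.
  have : 0 < m%:R :> R by rewrite ltr0n.
  lra.
rewrite (mulrC k%:R) ler_piMl ?divr_ge0 ?mulr_ge0 ?(ltW alpha0)//.
by rewrite gerBl ltW.
Qed.

(** An upper bound on the probability that SD misses a given false null hypothesis: the bound of
    [step_down_missed] with the factor [m * p] taken out. *)
Definition step_down_bound (k0 : nat) : R :=
  alt_law s nu [set z | k0.+1%:R * alpha / m%:R < ptail z] +
  \sum_(1 <= k < k0.+1) 2 ^+ k *
    (1 - p * alt_law s nu [set z | ptail z <= k%:R * alpha / m%:R] / 2) ^+ m.-1.

(** Covers BH and SD at once: a rule lying between them has at most the false rejections of BH and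
    at most the misses of SD. *)
Let prisk_bound k0 (phi : {ffun 'I_m -> bool * ('I_m.+1 * bool)} -> {set 'I_m}) : (k0 < m)%N ->
  (forall x, phi x \subset phi_BH x) -> (forall x, phi_SD x \subset phi x) ->
  prisk W delta0 deltaA phi <=
  delta0 * (2 * alpha * (1 + m%:R * p)) + deltaA * (m%:R * p * step_down_bound k0).
Proof.
move=> k0m sub_BH sub_SD; have /andP[p0 p1] := p01.
rewrite /prisk lerD// ler_pM2l//.
  apply: (@le_trans _ _ (pmean W (fun x => #|[set i |
    ~~ (x i).1 && (cells kappa x i < step_up_index (cells kappa x))%N]%SET|%:R))).
    apply: le_pmean => // x; rewrite ler_nat; apply: subset_leq_card.
    apply/fintype.subsetP => i; rewrite !inE => /andP[->] /=.
    by move=> /(fintype.subsetP (sub_BH x)); rewrite inE.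
  have := step_up_false_rejections W0 W1 (ltW alpha0) alpha4 null_cells.
  by rewrite prior.
apply: (@le_trans _ _ (pmean W (fun x => #|[set i |
    (x i).1 && ~~ (cells kappa x i < step_down_index (cells kappa x))%N]%SET|%:R))).
  apply: le_pmean => // x; rewrite ler_nat; apply: subset_leq_card.
  apply/fintype.subsetP => i; rewrite !inE => /andP[->] /=; apply: contra => ci.
  by apply: (fintype.subsetP (sub_SD x)); rewrite inE.
have kappa_le c : (kappa c <= m)%N by rewrite -ltnS ltn_ord.
apply: (le_trans (step_down_missed W0 W1 kappa k0m)).
rewrite prior -mulrA ler_wpM2l// /step_down_bound mulrDr.
have altE (Q : pred nat) :
    \sum_(c | Q (kappa c)) W (true, c) = p * alt_law s nu [set z | Q (pcell m alpha z)].
  rewrite (sum_W_true (fun c => Q (kappa c))); congr (_ * alt_law _ _ _).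
  by apply/seteqP; split => z /=; rewrite kappa_tau.
rewrite (altE (fun k => ~~ (k < k0.+1)%N)) lerD//.
  rewrite (_ : [set z | ~~ (pcell m alpha z < k0.+1)%N] =
    [set z | k0.+1%:R * alpha / m%:R < ptail z])//.
  by apply/seteqP; split => z /=; rewrite -pcellP ?ltNge ?(ltW alpha0)//.
rewrite ler_wpM2l ?(ltW p0)// big_nat_cond [leRHS]big_nat_cond.
apply: ler_sum => k; rewrite andbT => /andP[k1 kk0].
rewrite /alt_below (altE (fun j => (j < k)%N)).
rewrite (_ : [set z | (pcell m alpha z < k)%N] = [set z | ptail z <= k%:R * alpha / m%:R])//.
apply/seteqP; split => z /=; rewrite pcellP ?(ltW alpha0)//.
  by rewrite k1/= (leq_trans (_ : k <= k0)%N)// ltnW.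
by rewrite k1/= (leq_trans (_ : k <= k0)%N)// ltnW.
Qed.

Lemma risk_BH_le k0 : (k0 < m)%N ->
  risk delta0 deltaA mu X (BH_rule sigma alpha) <=
  delta0 * (2 * alpha * (1 + m%:R * p)) + deltaA * (m%:R * p * step_down_bound k0).
Proof.
move=> k0m; rewrite (risk_state BH_state); apply: prisk_bound => // x.
apply/fintype.subsetP => i; rewrite !inE; apply: step_down_subset_step_up => j.
by rewrite -ltnS ltn_ord.
Qed.

Lemma risk_SD_le k0 : (k0 < m)%N ->
  risk delta0 deltaA mu X (SD_rule sigma alpha) <=
  delta0 * (2 * alpha * (1 + m%:R * p)) + deltaA * (m%:R * p * step_down_bound k0).
Proof.
move=> k0m; rewrite (risk_state SD_state); apply: prisk_bound => // x.
apply/fintype.subsetP => i; rewrite !inE; apply: step_down_subset_step_up => j.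
by rewrite -ltnS ltn_ord.
Qed.

End risk_bounds.

(** * Comparison with the oracle *)

Section density.
Context {R : realType} (nu : probability (measurableTypeR R) R).
Variables (S : set R) (rho : R -> R) (M : R).
Hypotheses (mS : measurable S) (mrho : measurable_fun S rho) (M0 : 0 <= M)
  (rho_bound : forall t, S t -> 0 < rho t <= M)
  (nuE : forall A, measurable A -> A `<=` S ->
    nu A = (\int[lebesgue_measure]_(t in A) (rho t)%:E)%E).
Implicit Types (x y z w s : R).

Lemma numass_ge0 (A : set R) : 0 <= fine (nu A).
Proof. exact: fine_ge0. Qed.

Lemma le_numass (A B : set R) : measurable A -> measurable B -> A `<=` B ->
  fine (nu A) <= fine (nu B).
Proof. by move=> mA mB AB; rewrite -lee_fin !numassE// le_measure// inE. Qed.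

Lemma numass_itv_le (i : interval R) x y : x <= y ->
  [set` i] `<=` `[x, y]%classic -> [set` i] `<=` S ->
  fine (nu [set` i]) <= M * (y - x).
Proof.
move=> xy ixy iS; rewrite -lee_fin numassE// nuE//.
apply: (le_trans (@ge0_integral_le_cst _ _ _ lebesgue_measure [set` i] rho M
  (measurable_itv _) (measurable_funS mS iS mrho) _)).
  by move=> t /iS /rho_bound /andP[/ltW -> ->].
rewrite EFinM lee_wpmul2l ?lee_fin//.
apply: (@le_trans _ _ (lebesgue_measure `[x, y]%classic)).
  by apply: le_measure; rewrite ?inE.
rewrite lebesgue_measure_itv/= lte_fin.
by case: ifPn => _; rewrite ?lee_fin ?subr_ge0// -EFinD.
Qed.

Lemma numass_itv_ge c x y : 0 <= c -> x <= y -> `]x, y]%classic `<=` S ->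
  (forall t, `]x, y]%classic t -> c <= rho t) ->
  c * (y - x) <= fine (nu `]x, y]%classic).
Proof.
move=> c0 xy iS h; rewrite -lee_fin numassE// nuE//.
have := @ge0_integral_ge_cst _ _ _ lebesgue_measure `]x, y]%classic rho c
  (measurable_itv _) (measurable_funS mS iS mrho) c0 h.
apply: le_trans; rewrite [X in (_ * X)%E](_ : _ = lebesgue_measure (`]x, y]%classic : set R))//.
rewrite lebesgue_measure_itv/= lte_fin; move: xy; rewrite le_eqVlt => /orP[/eqP->|xy].
  by rewrite ltxx subrr mulr0 mule0.
by rewrite xy -EFinD -EFinM.
Qed.

(** The density is positive but need not be bounded away from 0, so the argument is indirect: a zero
    mass would force [rho = 0] almost everywhere on the interval. *)
Lemma numass_itv_gt0 x y : x < y -> `]x, y]%classic `<=` S ->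
  0 < fine (nu `]x, y]%classic).
Proof.
move=> xy iS; rewrite lt_neqAle numass_ge0 andbT; apply/negP => /eqP/esym h.
have nu_eq0 : nu `]x, y]%classic = 0%E by rewrite -numassE// h.
rewrite nuE// in nu_eq0.
have mrho' : measurable_fun `]x, y] (EFin \o rho).
  by apply/measurable_EFinP; exact: (measurable_funS mS iS mrho).
have : (\int[lebesgue_measure]_(t in `]x, y]) `|(EFin \o rho) t| = 0)%E.
  rewrite -[RHS]nu_eq0; apply: eq_integral => t; rewrite inE => /iS /rho_bound /andP[t0 _].
  by rewrite /= gtr0_norm.
move/(ae_eq_integral_abs lebesgue_measure (measurable_itv _) mrho') => [N [mN N0 sub]].
have : (lebesgue_measure (`]x, y]%classic : set R) <= lebesgue_measure N)%E.
  apply: le_measure; rewrite ?inE// => t ti; apply: sub => /= /(_ ti)[rt].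
  by have := rho_bound (iS _ ti); rewrite rt ltxx.
by rewrite N0 lebesgue_measure_itv/= lte_fin xy -EFinD lee_fin leNgt subr_gt0 xy.
Qed.

Lemma numass_norm_le x y : 0 <= x -> x <= y ->
  `[x, y]%classic `<=` S -> `[- y, - x]%classic `<=` S ->
  fine (nu [set t | `|t| <= y]) <=
  fine (nu [set t | `|t| <= x]) + 2 * M * (y - x).
Proof.
move=> x0 xy xyS yxS; have mI := @measurable_norm_le R.
apply: (@le_trans _ _ (fine (nu [set t | `|t| <= x]) +
  (fine (nu `[x, y]%classic) + fine (nu `[- y, - x]%classic)))).
  rewrite -lee_fin !EFinD !numassE//.
  apply: (@le_trans _ _ (nu ([set t | `|t| <= x] `|` (`[x, y] `|` `[- y, - x])))).
    apply: le_measure; rewrite ?inE; first exact: mI.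
      by apply: measurableU; [exact: mI|exact: measurableU].
    move=> t /=; rewrite !in_itv/= => ty.
    have [tx|/ltW tx] := lerP `|t| x; first by left.
    right; case: (lerP 0 t) => t0; [left|right]; apply/andP.
      by rewrite ger0_norm// in tx ty.
    by rewrite ltr0_norm// in tx ty; split; lra.
  apply: (le_trans (measureU2 _ _ _)); [exact: mI|exact: measurableU|].
  by rewrite leeD2l// measureU2.
rewrite lerD2l (_ : 2 * M * (y - x) = M * (y - x) + M * (- x - - y)); last by ring.
by apply: lerD; apply: numass_itv_le => //; rewrite lerN2.
Qed.

(** On [[- eps, eps]] the bound [M] on the density leaves a Gaussian integral over the line;
    outside, [t / s] is at distance at least [w] from [z]. *)
Lemma kern_le_density s z w eps : 0 < s -> 0 <= w ->
  `[- eps, eps]%classic `<=` S -> s * (`|z| + w) <= eps ->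
  kern nu s z <= M * (s * Num.sqrt (pi *+ 2)) + expR (- (w ^+ 2 / 2)).
Proof.
move=> s0 w0 IS zw; set I := `[- eps, eps]%classic in IS.
have mI : measurable I by exact: measurable_itv.
have mk := @measurable_kern_integrand R s z.
have mk' : measurable_fun setT
    (fun t : measurableTypeR R => (expR (- ((t / s - z) ^+ 2 / 2)))%:E).
  exact/measurable_EFinP.
have k0 t : (0 <= (expR (- ((t / s - z) ^+ 2 / 2)))%:E)%E by rewrite lee_fin expR_ge0.
rewrite -lee_fin kernE// -(setUv I) ge0_integral_setU//; last 3 first.
- exact: measurableC.
- by rewrite setUv.
- by apply/disj_set2P; exact: setICr.
rewrite EFinD; apply: leeD.
  rewrite EFinM -(integral_kern_lebesgue s0 z).
  apply: (@integral_density_le R nu I rho M) => //.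
  - exact: (measurable_funS mS IS mrho).
  - by move=> t /IS; exact: rho_bound.
  - by move=> A mA AI; apply: nuE => // t /AI; exact: IS.
apply: (le_trans (@ge0_integral_le_cst _ _ _ nu (~` I) _ (expR (- (w ^+ 2 / 2))) _ _ _)).
- exact: measurableC.
- exact: measurable_funTS.
- move=> t /= /negP; rewrite in_itv/= -ler_norml -ltNge => et.
  rewrite expR_ge0 ler_expR lerN2 ler_wpM2r ?invr_ge0//.
  rewrite -(real_normK (num_real (t / s - z))) ler_sqr ?nnegrE//.
  have h : `|z| + w <= `|t / s|.
    rewrite normrM normfV (gtr0_norm s0) ler_pdivlMr// mulrC.
    exact: le_trans zw (ltW et).
  have := ler_normB (t / s - z) (- z); rewrite opprK subrK normrN; lra.
rewrite -[leRHS]mule1 lee_wpmul2l ?lee_fin ?expR_ge0//.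
by apply: probability_le1; exact: measurableC.
Qed.

End density.

(** * Sums of Chernoff bounds *)

Section finite_sums.
Context {R : realType}.
Implicit Types (p q alpha : R) (g : nat -> R).

Lemma expR_ge_onem_exp p m : 0 <= p -> p <= 1 -> (1 - p) ^+ m <= expR (- (m%:R * p)).
Proof.
move=> p0 p1; rewrite -mulrN expRM_natl.
by rewrite lerXn2r ?nnegrE ?subr_ge0 ?expR_ge0// expR_ge1Dx.
Qed.

Lemma geometric_sum_le q k0 : 0 <= q -> q <= 2^-1 ->
  \sum_(1 <= k < k0.+1) q ^+ k <= 2 * q.
Proof.
move=> q0 q1.
(* The factor [1 - 2^-1 ^+ k0] strengthens the claim so that the induction goes through. *)
suff : \sum_(1 <= k < k0.+1) q ^+ k <= 2 * q * (1 - 2^-1 ^+ k0).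
  have : 0 <= q * 2^-1 ^+ k0 by rewrite mulr_ge0// exprn_ge0// invr_ge0.
  lra.
elim: k0 => [|k IH]; first by rewrite big_geq// expr0 subrr mulr0.
rewrite big_nat_recr//=.
have : q ^+ k.+1 <= q * 2^-1 ^+ k.
  by rewrite exprS ler_wpM2l// lerXn2r ?nnegrE// invr_ge0.
move: IH; rewrite [2^-1 ^+ k.+1]exprS; set u := 2^-1 ^+ k => h1 h2.
apply: (le_trans (lerD h1 h2)); lra.
Qed.

Lemma onem_exp_bound m p (g c : R) : (1 < m)%N -> 0 <= p -> p <= 1 -> c <= g -> g <= 1 ->
  0 <= c -> (1 - p * g / 2) ^+ m.-1 <= expR (- (m%:R * p * c / 4)).
Proof.
move=> m1 p0 p1 cg g1 c0.
have g0 : 0 <= g by exact: le_trans cg.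
have pg1 : p * g <= 1 by rewrite mulr_ile1.
have pg0 : 0 <= p * g by rewrite mulr_ge0.
apply: (le_trans (expR_ge_onem_exp m.-1 _ _)); [lra|lra|].
rewrite ler_expR lerN2.
(* Replacing the exponent [m - 1] by [m] costs a factor 2; with the Chernoff parameter 1 / 2 this
   gives the 4 of the statement. *)
have hm : m%:R <= 2 * m.-1%:R :> R by rewrite -natrM ler_nat; lia.
have pc : p * c <= p * g by rewrite ler_wpM2l.
have pc0 : 0 <= p * c by rewrite mulr_ge0.
have : m%:R * (p * c) <= 2 * m.-1%:R * (p * g).
  by apply: ler_pM => //; rewrite mulr_ge0.
lra.
Qed.

(** As [g k >= 1 / 2], each power is at most [expR (- (m * p / 8))], while
    [2 ^+ k <= expR (m * p / 16)] by the choice of [k0]: half of the exponent survives. *)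
Lemma failure_sum_half m p g k0 : (1 < m)%N -> 0 <= p -> p <= 1 ->
  k0%:R <= m%:R * p / 16 ->
  (forall k, (0 < k <= k0)%N -> 2^-1 <= g k <= 1) ->
  \sum_(1 <= k < k0.+1) 2 ^+ k * (1 - p * g k / 2) ^+ m.-1 <=
  k0%:R * expR (- (m%:R * p / 16)).
Proof.
move=> m1 p0 p1 k0mp hg.
have -> : k0%:R * expR (- (m%:R * p / 16)) =
    \sum_(1 <= k < k0.+1) expR (- (m%:R * p / 16)) :> R.
  by rewrite sumr_const_nat subn1 mulr_natl.
rewrite big_nat_cond [leRHS]big_nat_cond; apply: ler_sum => k.
rewrite andbT => /andP[k1 kk0].
have /andP[hg1 hg2] := hg k (introT andP (conj k1 kk0)).
have h1 : (1 - p * g k / 2) ^+ m.-1 <= expR (- (m%:R * p * 2^-1 / 4)).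
  by apply: onem_exp_bound => //; rewrite invr_ge0.
have h2 : 2 ^+ k <= expR (m%:R * p / 16) :> R.
  apply: (@le_trans _ _ (expR 1 ^+ k)).
    by rewrite lerXn2r ?nnegrE ?expR_ge0//; have := @expR_ge1Dx R 1; lra.
  by rewrite -expRM_natl ler_expR mulr1 (le_trans _ k0mp)// ler_nat.
have g0 : 0 <= g k by apply: le_trans hg1; rewrite invr_ge0.
have pg : p * g k <= 1 by rewrite mulr_ile1.
apply: (le_trans (ler_pM _ _ h2 h1)) => //.
- by rewrite exprn_ge0// subr_ge0; lra.
by rewrite -expRD ler_expR; lra.
Qed.

(** The lower bound on [g k] is linear in [k], so the k-th term is at most [q ^+ k] with
    [q = 2 * expR (- (p * W * alpha / 4))]; the factor [m] cancels, and the bound is uniform in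
    [k0]. *)
Lemma failure_sum_geometric m p g k0 W alpha : (1 < m)%N -> 0 <= p -> p <= 1 ->
  0 <= W -> 0 <= alpha ->
  (forall k, (0 < k <= k0)%N -> W * (k%:R * alpha / m%:R) <= g k <= 1) ->
  2 * expR (- (p * W * alpha / 4)) <= 2^-1 ->
  \sum_(1 <= k < k0.+1) 2 ^+ k * (1 - p * g k / 2) ^+ m.-1 <=
  4 * expR (- (p * W * alpha / 4)).
Proof.
move=> m1 p0 p1 W0 a0 hg hq.
have q0 : 0 <= 2 * expR (- (p * W * alpha / 4)) by rewrite mulr_ge0 ?expR_ge0.
have := geometric_sum_le k0 q0 hq; rewrite mulrA -natrM => h.
apply: (le_trans _ h).
rewrite big_nat_cond [leRHS]big_nat_cond; apply: ler_sum => k.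
rewrite andbT => /andP[k1 kk0].
have /andP[hg1 hg2] := hg k (introT andP (conj k1 kk0)).
have m0 : 0 < m%:R :> R by rewrite ltr0n ltnW.
rewrite exprMn ler_wpM2l ?exprn_ge0// -expRM_natl.
apply: (le_trans (onem_exp_bound m1 p0 p1 hg1 hg2 _)).
  by rewrite mulr_ge0// divr_ge0 ?mulr_ge0// ltW.
rewrite ler_expR le_eqVlt; apply/orP; left; apply/eqP.
by field; rewrite gt_eqF.
Qed.

End finite_sums.

Section sparse_comparison.
Context {R : realType} (nu : probability (measurableTypeR R) R).
Implicit Types (x y z w s : R).
Local Notation ball z := [set x : R | `|x| < z].

Lemma le_alt_law s (A B : set R) : measurable A -> measurable B -> A `<=` B ->
  alt_law s nu A <= alt_law s nu B.
Proof.
move=> mA mB AB; rewrite -lee_fin !alt_lawE//; apply: ge0_le_integral => //;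
  try (by move=> t _; rewrite lee_fin normal_mass_ge0);
  try (by apply/measurable_EFinP; exact: measurable_normal_mass_scaled).
by move=> t _; rewrite lee_fin; exact: le_normal_mass.
Qed.

Lemma alt_law_le1 s (A : set R) : measurable A -> alt_law s nu A <= 1.
Proof.
move=> mA; rewrite -lee_fin alt_lawE//.
apply: integral_le_cstT; first exact: measurable_normal_mass_scaled.
by move=> t; rewrite normal_mass_ge0 normal_mass_le1.
Qed.

Lemma alt_lawC s (A : set R) : measurable A ->
  alt_law s nu (~` A) = 1 - alt_law s nu A.
Proof.
move=> mA; apply: EFin_inj; rewrite EFinB.
have mf B : measurable B ->
    measurable_fun setT (fun t : measurableTypeR R => (normal_mass (t / s) 1 B)%:E).
  by move=> mB; apply/measurable_EFinP; exact: measurable_normal_mass_scaled.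
have n0 B (t : R) : (0 <= (normal_mass (t / s) 1 B)%:E)%E.
  by rewrite lee_fin normal_mass_ge0.
have mAC : measurable (~` A) by exact: measurableC.
have : ((alt_law s nu (~` A))%:E + (alt_law s nu A)%:E = 1)%E.
  rewrite !alt_lawE// -ge0_integralD//; [|exact: mf|exact: mf].
  rewrite (eq_integral (cst 1%E)).
    by rewrite integral_cst// mul1e; exact: probability_setT.
  by move=> t _; rewrite normal_massC// -EFinD subrK.
move=> <-; rewrite addeK//.
Qed.

(* Inside [-z, z] the likelihood ratio is below the critical value, so the
   acceptance interval of the oracle contains (-z, z). *)
Lemma ball_sub_acceptance (s odds a b z : R) : a < 0 -> 0 < b ->
  lik nu s a = odds -> lik nu s b = odds ->
  (forall x, `|x| < z -> lik nu s x < odds) -> ball z `<=` `]a, b[%classic.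
Proof.
move=> a0 b0 la lb h x /=; rewrite ltr_norml in_itv/= => /andP[zx xz].
apply/andP; split; rewrite ltNge; apply/negP => hx.
- suff : lik nu s a < odds by rewrite la ltxx.
  by apply: h; rewrite ltr0_norm//; lra.
- suff : lik nu s b < odds by rewrite lb ltxx.
  by apply: h; rewrite gtr0_norm//; lra.
Qed.

Lemma ptail_le_of_norm (z t x : R) : 0 <= z -> 2 * expR (- (z ^+ 2 / 2)) <= t ->
  z <= `|x| -> ptail x <= t.
Proof.
move=> z0 zt zx; apply: le_trans zt; apply: (le_trans (ptail_le_expR x)).
rewrite ler_wpM2l// ler_expR lerN2 ler_wpM2r ?invr_ge0//.
by rewrite -(real_normK (num_real x)) ler_sqr ?nnegrE// normr_ge0.
Qed.

Variables (S : set R) (rho : R -> R) (M : R).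
Hypotheses (mS : measurable S) (mrho : measurable_fun S rho) (M0 : 0 <= M)
  (rho_bound : forall t, S t -> 0 < rho t <= M)
  (nuE : forall A, measurable A -> A `<=` S ->
    nu A = (\int[lebesgue_measure]_(t in A) (rho t)%:E)%E).

(** Makes [kern] at most [K1 * s] near the origin: the first summand comes from the bounded density,
    the 1 from a Gaussian tail that is at most [s]. *)
Let K1 : R := M * Num.sqrt (pi *+ 2) + 1.

Let numass (A : set R) := fine (nu A).

(* The case C = 0.  The p-value is below alpha * p / 16 outside [-z, z] and below
   alpha / m outside [-z1, z1], while the likelihood ratio is below the critical
   odds inside [-z', z']; since z / z' -> 1, the acceptance regions of the
   procedures and of the oracle have nearly the same mass. *)
Section dense_signals.
Variables (m n : nat) (p sigma alpha odds a b eta eps c0 D K2 z z1 z' : R).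
Let s := sigma / Num.sqrt n%:R.
Hypotheses (m1 : (1 < m)%N) (n0 : (0 < n)%N) (p01 : 0 < p < 1)
  (sigma0 : 0 < sigma) (alpha0 : 0 < alpha) (nu0 : nu [set 0] = 0%E)
  (eps0 : 0 < eps) (IS : `[- eps, eps]%classic `<=` S)
  (c00 : 0 < c0) (c0_rho : forall t, 0 < t <= eps -> c0 <= rho t)
  (a0 : a < 0) (b0 : 0 < b) (la : lik nu s a = odds) (lb : lik nu s b = odds)
  (eta0 : 0 < eta) (eta2 : eta <= 2^-1)
  (z0 : 0 <= z) (z10 : 0 <= z1) (z'0 : 0 < z').
Hypotheses (hz : 2 * expR (- (z ^+ 2 / 2)) <= alpha * p / 16)
  (hz1 : 2 * expR (- (z1 ^+ 2 / 2)) <= alpha / m%:R)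
  (hz' : expR (z' ^+ 2 / 2) * (K1 * s) <= odds)
  (sz : s * z <= eps / 2) (sz1 : s * z1 <= eps / 2) (sz' : s * z' <= eps / 2)
  (he : expR (- ((eps / (2 * s)) ^+ 2 / 2)) <= s)
  (hg : 2 * M * (s * z1) + 2 * (K1 * s) <= 2^-1)
  (hfail : (Num.truncn (m%:R * p / 16))%:R * expR (- (m%:R * p / 16)) <= s)
  (hD : D <= K2 * s) (hzz : z <= (1 + eta) * z')
  (hK : 2 * K1 + 1 + K2 <= eta * z')
  (heta : 2 * expR (- ((eta * z') ^+ 2 / 2)) <= eta).

Let s0 : 0 < s. Proof. by rewrite divr_gt0// sqrtr_gt0 ltr0n. Qed.

Let eps2 : eps / 2 <= eps. Proof. by move: eps0; lra. Qed.

Let K10 : 0 < K1.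
Proof. by apply: ltr_wpDl => //; apply: mulr_ge0 => //; exact: sqrtr_ge0. Qed.

Let kern_small x : s * `|x| <= eps / 2 -> kern nu s x <= K1 * s.
Proof.
move=> sx.
have h : s * (`|x| + eps / (2 * s)) <= eps.
  have -> : s * (`|x| + eps / (2 * s)) = s * `|x| + eps / 2 by field; rewrite gt_eqF.
  lra.
have w0 : 0 <= eps / (2 * s) by rewrite ltW// divr_gt0// mulr_gt0.
apply: (le_trans (kern_le_density mS mrho M0 rho_bound nuE s0 w0 IS h)).
apply: (le_trans (lerD (lexx _) he)); rewrite /K1; lra.
Qed.

Let numass_le x y : 0 <= x -> x <= y -> y <= eps ->
  numass [set t | `|t| <= y] <= numass [set t | `|t| <= x] + 2 * M * (y - x).
Proof.
move=> x0 xy ye; apply: (numass_norm_le mS mrho M0 rho_bound nuE) => // t /=;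
  rewrite in_itv/= => /andP[h1 h2]; apply: IS; rewrite /= in_itv/=; apply/andP; split; lra.
Qed.

Let alt_ball_le x : 0 <= x -> s * x <= eps / 2 ->
  alt_law s nu (ball x) <= numass [set t | `|t| <= s * x] + 2 * (K1 * s).
Proof.
move=> x0 sx; apply: (le_trans (alt_law_ball_le_kern nu s0 x0)).
rewrite lerD2l mulr_natl mulr2n; apply: lerD; apply: kern_small.
  by rewrite ger0_norm.
by rewrite normrN ger0_norm.
Qed.

(** With [v] the mass of [|t| <= s * (1 - eta) * z'], the surplus is a multiple of [eta * s * z'];
    the terms of order [s], among them the cost [D] of false rejections, are absorbed because
    [eta * z'] is large. As the density is at least [c0] to the right of 0, [v] is at least
    [c0 * s * z' / 2], and the surplus is a relative error of order [eta]. *)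
Lemma dense_signals_bound : exists k0 v, [/\ (k0 < m)%N, 0 < v,
  D + step_down_bound m n p sigma alpha nu k0 <= (1 + (8 * M + 2) / c0 * eta) * v &
  (1 - eta) * v <= alt_law s nu `]a, b[].
Proof.
have /andP[p0 p1] := p01; have m0 : 0 < m%:R :> R by rewrite ltr0n ltnW.
pose k0 := Num.truncn (m%:R * p / 16).
have mp0 : 0 <= m%:R * p / 16 by rewrite divr_ge0 ?mulr_ge0 ?ltW.
have /andP[k0le k0lt] : k0%:R <= m%:R * p / 16 < k0.+1%:R by exact: truncn_itv.
have k0m : (k0 < m)%N.
  rewrite -(ltr_nat R); apply: (le_lt_trans k0le).
  have : m%:R * p <= m%:R by rewrite ler_piMr// ltW.
  lra.
pose w := eta * z'.
have w0 : 0 < w by rewrite mulr_gt0.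
pose v := numass [set t | `|t| <= s * (z' - w)].
have w2 : w <= 2^-1 * z' by rewrite ler_pM2r.
have zw0 : 0 < z' - w by lra.
have szw : s * (z' - w) <= eps / 2.
  apply: le_trans sz'; rewrite ler_pM2l//; lra.
have vlow : c0 * (s * z' / 2) <= v.
  have h : s * z' / 2 <= s * (z' - w).
    by rewrite -mulrA ler_pM2l//; lra.
  have szw0 : 0 < s * (z' - w) by rewrite mulr_gt0.
  have hS : `]0, s * (z' - w)]%classic `<=` S.
    move=> t /=; rewrite in_itv/= => /andP[h1 h2]; apply: IS.
    by rewrite /= in_itv/=; apply/andP; split; lra.
  apply: (@le_trans _ _ (c0 * (s * (z' - w) - 0))); first by rewrite subr0 ler_pM2l.
  apply: (@le_trans _ _ (numass `]0, s * (z' - w)]%classic)).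
    apply: (numass_itv_ge mS mrho nuE) => //; [exact: ltW|exact: ltW|].
    by move=> t /=; rewrite in_itv/= => /andP[h1 h2]; apply: c0_rho; apply/andP; split; lra.
  apply: le_numass => //; first exact: measurable_norm_le.
  by move=> t /=; rewrite in_itv/= => /andP[h1 h2]; rewrite gtr0_norm.
have szp : 0 < s * z' by rewrite mulr_gt0.
have v0 : 0 < v.
  apply: lt_le_trans vlow; rewrite mulr_gt0//; lra.
exists k0, v; split => //.
  (* The threshold of rank [k0 + 1] exceeds [alpha * p / 16], so only z-scores in the ball of radius
     [z] have a p-value above it. *)
  have first_le : alt_law s nu [set x | k0.+1%:R * alpha / m%:R < ptail x] <=
      v + 4 * M * (eta * (s * z')) + 2 * (K1 * s).
    apply: (@le_trans _ _ (alt_law s nu (ball z))).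
      apply: le_alt_law.
      - rewrite (_ : [set x | _] = ~` [set x | ptail x <= k0.+1%:R * alpha / m%:R]).
          by apply: measurableC; exact: measurable_ptail_le.
        by apply/seteqP; split => x /=; rewrite ltNge => /negP.
      - exact: measurable_norm_lt.
      - move=> x /=; apply: contraTT; rewrite -!leNgt => zx.
        apply: (le_trans (ptail_le_of_norm z0 hz zx)).
        have -> : alpha * p / 16 = (m%:R * p / 16) * alpha / m%:R by field; rewrite gt_eqF.
        by rewrite ler_pM2r ?invr_gt0// ler_pM2r// ltW.
    apply: (le_trans (alt_ball_le z0 sz)); rewrite lerD2r.
    have Meta : 0 <= 4 * M * (eta * (s * z')).
      by rewrite mulr_ge0 ?mulr_ge0// ltW.
    (* Either [v] already covers the interval, or the interval exceeds that of [v] by at most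
       [2 * eta * s * z'] on each side, because [z <= (1 + eta) * z']. *)
    have [zz|zz] := leP (s * z) (s * (z' - w)).
      apply: (@le_trans _ _ v); last lra.
      apply: le_numass; [exact: measurable_norm_le|exact: measurable_norm_le|].
      by move=> t /= /le_trans; apply.
    apply: (@le_trans _ _ (v + 2 * M * (s * z - s * (z' - w)))).
      by apply: numass_le; [apply: ltW; exact: mulr_gt0|exact: ltW|exact: le_trans sz eps2].
    rewrite lerD2l.
    have h : s * z - s * (z' - w) <= 2 * (eta * (s * z')).
      have : s * z <= s * ((1 + eta) * z') by rewrite ler_pM2l.
      by rewrite /w; clear zz; lra.
    have : M * (s * z - s * (z' - w)) <= M * (2 * (eta * (s * z'))) by rewrite ler_wpM2l.
    lra.
  (* Every threshold is at least [alpha / m]; only z-scores in the ball of radius [z1] have a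
     p-value above that, and this ball has alternative mass at most 1 / 2. *)
  have g_half k : (0 < k <= k0)%N ->
      2^-1 <= alt_law s nu [set x | ptail x <= k%:R * alpha / m%:R] <= 1.
    move=> /andP[k_gt0 kk0]; rewrite alt_law_le1 ?andbT; last exact: measurable_ptail_le.
    apply: (@le_trans _ _ (alt_law s nu (~` ball z1))); last first.
      apply: le_alt_law; [by apply: measurableC; exact: measurable_norm_lt|exact: measurable_ptail_le|].
      move=> x /= /negP; rewrite -leNgt => zx.
      apply: (le_trans (ptail_le_of_norm z10 hz1 zx)).
      by rewrite ler_pM2r ?invr_gt0// ler_peMl ?ler1n// ltW.
    rewrite alt_lawC; last exact: measurable_norm_lt.
    have h1 := alt_ball_le z10 sz1.
    have sz10 : 0 <= s * z1 by rewrite mulr_ge0// ltW.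
    have h2 : numass [set t | `|t| <= s * z1] <= 0 + 2 * M * (s * z1 - 0).
      apply: (le_trans (numass_le (lexx 0) sz10 (le_trans sz1 eps2))).
      rewrite lerD2r /numass (_ : [set t | `|t| <= 0] = [set 0]) ?nu0//.
      by apply/seteqP; split => x /=; rewrite normr_le0 => /eqP.
    have arith x1 x2 x3 x4 : x1 <= x2 + 2 * x4 -> x2 <= 0 + 2 * M * (x3 - 0) ->
        2 * M * x3 + 2 * x4 <= 2^-1 -> 2^-1 <= 1 - x1 by lra.
    exact: arith h1 h2 hg.
  have second_le := failure_sum_half m1 (ltW p0) (ltW p1) k0le g_half.
  have B_le : step_down_bound m n p sigma alpha nu k0 <=
      v + 4 * M * (eta * (s * z')) + 2 * (K1 * s) + s.
    exact: lerD first_le (le_trans second_le hfail).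
  have Ks : 2 * (K1 * s) + s + K2 * s <= eta * (s * z').
    have : s * (2 * K1 + 1 + K2) <= s * (eta * z') by rewrite ler_pM2l.
    lra.
  have tot : D + step_down_bound m n p sigma alpha nu k0 <=
      v + (4 * M + 1) * (eta * (s * z')).
    have arith x1 x2 x3 x4 x5 x6 : x1 <= v + 4 * M * x2 + 2 * x3 + x4 ->
        2 * x3 + x4 + x6 <= x2 -> x5 <= x6 -> x5 + x1 <= v + (4 * M + 1) * x2 by lra.
    exact: arith B_le Ks hD.
  apply: (le_trans tot).
  have -> : (1 + (8 * M + 2) / c0 * eta) * v =
      v + (4 * M + 1) * (eta * (2 / c0 * v)) by field; rewrite gt_eqF.
  have M41 : 0 <= 4 * M + 1 by rewrite addr_ge0// mulr_ge0.
  rewrite lerD2l ler_wpM2l//.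
  rewrite ler_pM2l//.
  have : 2 / c0 * (c0 * (s * z' / 2)) <= 2 / c0 * v.
    by rewrite ler_pM2l// divr_gt0.
  have -> : 2 / c0 * (c0 * (s * z' / 2)) = s * z' by field; rewrite gt_eqF.
  by [].
(* The oracle: within [z'] the likelihood ratio is below [expR (z' ^+ 2 / 2) * (K1 * s) <= odds], so
   these z-scores are accepted. *)
apply: (@le_trans _ _ (alt_law s nu (ball z'))); last first.
  apply: le_alt_law; [exact: measurable_norm_lt|exact: measurable_itv|].
  apply: (ball_sub_acceptance a0 b0 la lb) => x xz.
  rewrite (lik_kern _ s0); apply: lt_le_trans hz'.
  have K1s : 0 < K1 * s by rewrite mulr_gt0.
  have xe : expR (x ^+ 2 / 2) < expR (z' ^+ 2 / 2).
    rewrite ltr_expR ltr_pM2r ?invr_gt0// -(real_normK (num_real x)).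
    by rewrite ltr_sqr ?nnegrE// ltW.
  have kx : kern nu s x <= K1 * s.
    apply: kern_small; apply: le_trans sz'.
    by rewrite ler_pM2l// ltW.
  apply: (@le_lt_trans _ _ (expR (x ^+ 2 / 2) * (K1 * s))).
    by rewrite ler_wpM2l ?expR_ge0.
  by rewrite ltr_pM2r.
have e0 : 0 <= 1 - 2 * expR (- (w ^+ 2 / 2)).
  by rewrite subr_ge0 (le_trans heta)// (le_trans eta2)// invf_le1// ler1n.
apply: (le_trans _ (alt_law_ball_ge nu s0 z' (ltW w0) e0)).
by rewrite ler_pM2r// lerD2l lerN2.
Qed.

End dense_signals.

(* The case C > 0.  Non-null z-scores concentrate at |mu| / s with s -> 0, so both
   acceptance regions have mass close to nu [-T, T].  W bounds the likelihood
   ratio from below beyond zup, hence W * t bounds the alternative probability of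
   a p-value at most t. *)
Section sparse_signals.
Variables (m n : nat) (p sigma alpha odds a b eta T W c2 D : R).
Let s := sigma / Num.sqrt n%:R.
Let zup := (T + eta) / s.
Let zlow := (T - eta) / s.
Hypotheses (m1 : (1 < m)%N) (n0 : (0 < n)%N) (p01 : 0 < p < 1)
  (sigma0 : 0 < sigma) (alpha0 : 0 < alpha) (alpha1 : alpha < 1)
  (a0 : a < 0) (b0 : 0 < b) (la : lik nu s a = odds) (lb : lik nu s b = odds)
  (eta0 : 0 < eta) (eta1 : eta <= 1) (etaT : 2 * eta <= T).

Let T0 : 0 < T. Proof. by apply: lt_le_trans etaT; rewrite mulr_gt0. Qed.

Let T2_ge0 : 0 <= T - 2 * eta. Proof. by rewrite subr_ge0. Qed.

Let T2_le : T - 2 * eta <= T + 2 * eta. Proof. by move: eta0; lra. Qed.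

Hypotheses (posS : `[T - 2 * eta, T + 2 * eta]%classic `<=` S)
  (negS : `[- (T + 2 * eta), - (T - 2 * eta)]%classic `<=` S)
  (W1 : 1 <= W) (Wpos : W <= lik nu s zup) (Wneg : W <= lik nu s (- zup))
  (c20 : 0 < c2) (c2v : c2 <= fine (nu [set t | `|t| <= T - 2 * eta]))
  (ht : ptail zup < alpha)
  (hq : 4 * expR (- (p * W * alpha / 4)) <= eta)
  (he : 2 * expR (- ((eta / s) ^+ 2 / 2)) <= eta)
  (hlow : expR (zlow ^+ 2 / 2) <= odds)
  (hD : D <= eta).

Let s0 : 0 < s. Proof. by rewrite divr_gt0// sqrtr_gt0 ltr0n. Qed.

(** Here [v], the mass of [|t| <= T - 2 * eta], is at least the constant [c2], so errors of order
    [eta] are relative errors. They are [8 * M * eta] for the two shells of width [4 * eta] around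
    [T] and [- T], and [eta] each for a Gaussian tail, the Chernoff sum and [D]. *)
Lemma sparse_signals_bound : exists k0 v, [/\ (k0 < m)%N, 0 < v,
  D + step_down_bound m n p sigma alpha nu k0 <= (1 + (8 * M + 3) / c2 * eta) * v &
  (1 - eta) * v <= alt_law s nu `]a, b[].
Proof.
have /andP[p0 p1] := p01; have m0 : 0 < m%:R :> R by rewrite ltr0n ltnW.
have zup0 : 0 < zup by apply: divr_gt0 => //; exact: addr_gt0.
pose t := ptail zup.
have t0 : 0 <= t by rewrite /t ptailE mulr_ge0// normal_mass_ge0.
(* The thresholds up to rank [k0] are at most [t = ptail zup]; the next one exceeds [t]. *)
pose k0 := Num.truncn (m%:R * t / alpha).
have mt0 : 0 <= m%:R * t / alpha by apply: divr_ge0; [apply: mulr_ge0|]; rewrite // ltW.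
have /andP[k0le k0lt] : k0%:R <= m%:R * t / alpha < k0.+1%:R by exact: truncn_itv.
have k0m : (k0 < m)%N.
  rewrite -(ltr_nat R); apply: (le_lt_trans k0le).
  by rewrite ltr_pdivrMr// ltr_pM2l.
pose v := numass [set t | `|t| <= T - 2 * eta].
have v0 : 0 < v by exact: lt_le_trans c20 c2v.
have w0 : 0 <= eta / s by apply: divr_ge0; exact: ltW.
have M83 : 0 <= 8 * M + 3 by rewrite addr_ge0// mulr_ge0.
exists k0, v; split => //.
  have first_le : alt_law s nu [set x | k0.+1%:R * alpha / m%:R < ptail x] <=
      v + 8 * M * eta + eta.
    apply: (@le_trans _ _ (alt_law s nu (ball zup))).
      apply: le_alt_law.
      - rewrite (_ : [set x | _] = ~` [set x | ptail x <= k0.+1%:R * alpha / m%:R]).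
          by apply: measurableC; exact: measurable_ptail_le.
        by apply/seteqP; split => x /=; rewrite ltNge => /negP.
      - exact: measurable_norm_lt.
      - move=> x /=; apply: contraTT; rewrite -!leNgt => zx.
        rewrite -ptail_norm; apply: (le_trans (ptail_anti (ltW zup0) zx)).
        have -> : ptail zup = (m%:R * t / alpha) * alpha / m%:R.
          by rewrite /t; field; rewrite !gt_eqF.
        by rewrite ler_pM2r ?invr_gt0// ler_pM2r// ltW.
    apply: (le_trans (alt_law_ball_le_far nu s0 zup w0)).
    have -> : s * (zup + eta / s) = T + 2 * eta by rewrite /zup; field; rewrite gt_eqF.
    apply: lerD; last first.
      by apply: le_trans he; rewrite ler_peMl ?expR_ge0// ler1n.
    apply: (le_trans (numass_norm_le mS mrho M0 rho_bound nuE T2_ge0 T2_le posS negS)).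
    have -> : 2 * M * (T + 2 * eta - (T - 2 * eta)) = 8 * M * eta by ring.
    exact: lexx.
  have g_low k : (0 < k <= k0)%N ->
      W * (k%:R * alpha / m%:R) <=
      alt_law s nu [set x | ptail x <= k%:R * alpha / m%:R] <= 1.
    move=> /andP[k_gt0 kk0]; rewrite alt_law_le1 ?andbT; last exact: measurable_ptail_le.
    have kt : k%:R * alpha / m%:R <= t.
      have -> : t = (m%:R * t / alpha) * alpha / m%:R by field; rewrite !gt_eqF.
      rewrite ler_pM2r ?invr_gt0// ler_pM2r//; apply: le_trans k0le.
      by rewrite ler_nat.
    rewrite -[X in W * X <= _]gauss_ptail_le; last first.
      have km0 : 0 < k%:R * alpha / m%:R.
        by apply: divr_gt0 => //; apply: mulr_gt0; rewrite // ltr0n.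
      by rewrite km0 (le_lt_trans kt (lt_trans ht alpha1)).
    apply: (alt_law_ge s0); first exact: measurable_ptail_le.
      exact: le_trans W1.
    move=> x /= xt.
    have zx : zup <= `|x|.
      rewrite leNgt; apply/negP => xz.
      have := ptail_lt (normr_ge0 x) xz; rewrite ptail_norm ltNge.
      by rewrite (le_trans xt kt).
    (* [lik] is at most 1 at 0 and at least [W] at [zup] and [- zup]; convexity keeps it at least
       [W] beyond these points. *)
    have l0 : lik nu s 0 <= W by apply: le_trans W1; exact: lik0_le1.
    move: zx; rewrite ler_normr => /orP[zx|zx].
      by apply: (lik_beyond s0 _ l0 Wpos); left; rewrite zup0.
    by apply: (lik_beyond s0 _ l0 Wneg); right; rewrite lerNr zx oppr_lt0.
  have hq' : 2 * expR (- (p * W * alpha / 4)) <= 2^-1.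
    have arith x y : 4 * x <= y -> y <= 1 -> 2 * x <= 2^-1 by lra.
    exact: arith hq eta1.
  have second_le := failure_sum_geometric m1 (ltW p0) (ltW p1)
    (le_trans ler01 W1) (ltW alpha0) g_low hq'.
  have tot : D + step_down_bound m n p sigma alpha nu k0 <= v + (8 * M + 3) * eta.
    have := lerD first_le (le_trans second_le hq).
    have arith x1 x2 : x1 <= v + 8 * M * eta + eta + eta -> x2 <= eta ->
      x2 + x1 <= v + (8 * M + 3) * eta by lra.
    by move=> /arith; apply.
  apply: (le_trans tot).
  have -> : (1 + (8 * M + 3) / c2 * eta) * v =
      v + (8 * M + 3) * eta * (v / c2) by field; rewrite gt_eqF.
  rewrite lerD2l ler_peMr//; last by rewrite ler_pdivlMr// mul1r.
  by rewrite mulr_ge0// ltW.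
(* Within [zlow] the crude bound [lik x <= expR (x ^+ 2 / 2)] suffices, as only exponential rates
   matter when C > 0. *)
apply: (@le_trans _ _ (alt_law s nu (ball zlow))); last first.
  apply: le_alt_law; [exact: measurable_norm_lt|exact: measurable_itv|].
  apply: (ball_sub_acceptance a0 b0 la lb) => x xz.
  apply: lt_le_trans hlow; apply: (le_lt_trans (lik_le_expR _ s0 x)).
  rewrite ltr_expR ltr_pM2r ?invr_gt0// -(real_normK (num_real x)).
  by rewrite ltr_sqr ?nnegrE// ltW// (le_lt_trans _ xz).
have e0 : 0 <= 1 - 2 * expR (- ((eta / s) ^+ 2 / 2)) by rewrite subr_ge0 (le_trans he).
apply: (le_trans _ (alt_law_ball_ge nu s0 zlow w0 e0)).
have -> : s * (zlow - eta / s) = T - 2 * eta by rewrite /zlow; field; rewrite gt_eqF.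
by rewrite ler_pM2r// lerD2l lerN2.
Qed.

End sparse_signals.
End sparse_comparison.

(** * Asymptotics *)

Section elementary.
Context {R : realType}.
Implicit Types x y c k : R.

(** From [expR y >= y]. With x = sqrt n it makes Gaussian tails smaller than any given multiple of
    n^(-1/2). *)
Lemma expRN_sqr_le c k x : 0 < c -> 0 < k -> 0 < x -> (c * k)^-1 <= x ->
  expR (- (c * x ^+ 2)) <= k / x.
Proof.
move=> c0 k0 x0 xB; have ck : 0 < c * k by rewrite mulr_gt0.
have h : c * x ^+ 2 <= expR (c * x ^+ 2).
  by apply: le_trans (expR_ge1Dx _); rewrite lerDr.
rewrite expRN -[k / x]invrK lef_pV2 ?posrE ?expR_gt0 ?invr_gt0 ?divr_gt0//.
apply: le_trans h; rewrite invf_div ler_pdivrMr//.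
rewrite (_ : c * x ^+ 2 * k = x * (c * k * x)); last by ring.
by rewrite ler_peMr ?(ltW x0)// mulrC -ler_pdivrMr// mul1r.
Qed.

Lemma mulr_expRN_le x : 0 <= x -> x * expR (- x) <= 2 * expR (- (x / 2)).
Proof.
move=> x0; have h : x / 2 <= expR (x / 2) by have := expR_ge1Dx (x / 2); lra.
have -> : - x = - (x / 2) - x / 2 by lra.
rewrite expRD mulrA; apply: ler_wpM2r; first exact: expR_ge0.
rewrite expRN ler_pdivrMr ?expR_gt0//; lra.
Qed.

Lemma sqr_le_expR x : 0 <= x -> x ^+ 2 / 2 <= expR x.
Proof.
move=> x0; apply: le_trans (expR_ge1Dxn 1 x0).
by rewrite (_ : 2`! = 2)//; lra.
Qed.

End elementary.

(** * Growth rates of the odds, the sample size and the level *)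

Section growth.
Context {R : realType}.
Variables (n : nat -> nat) (p delta alpha : nat -> R).
Variables (sigma beta gamma2 C K Md : R).
Local Notation N m := ((n m)%:R : R).
Local Notation L m := (ln (m%:R : R)).
Let odds m := delta m * ((1 - p m) / p m).

Hypotheses (sigma0 : 0 < sigma) (beta01 : 0 < beta <= 1)
  (K0 : 0 < K)
  (n0 : forall m, (1 < m)%N -> (0 < n m)%N)
  (p01 : forall m, (1 < m)%N -> 0 < p m < 1)
  (pE : forall m, (1 < m)%N -> p m = m%:R `^ (- beta))
  (delta_gt0 : forall m, (1 < m)%N -> 0 < delta m)
  (n_le : forall m, (1 < m)%N -> N m <= m%:R `^ gamma2)
  (n_cvg : n @ \oo --> \oo)
  (alpha_cvg : alpha m / N m `^ (- 2^-1) @[m --> \oo] --> K)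
  (lnodds_cvg : 2 * ln (odds m) / N m @[m --> \oo] --> C)
  (lndelta : (fun m => ln (delta m)) =o_\oo (fun m => L m)).

Lemma near_gt1 : \forall m \near \oo, (1 < m)%N.
Proof. by exists 2%N. Qed.

Lemma near_sample_size (B : R) : \forall m \near \oo, B <= N m.
Proof. exact: (n_cvg (nbhs_infty_ger B)). Qed.

Lemma near_sqrt (B : R) : \forall m \near \oo, B <= Num.sqrt (N m).
Proof.
near=> m; apply: (le_trans (ler_norm B)); rewrite -sqrtr_sqr ler_wsqrtr//.
by near: m; exact: near_sample_size.
Unshelve. all: by end_near. Qed.

Lemma near_ln (B : R) : \forall m \near \oo, B <= L m.
Proof.
near=> m; rewrite -[B]expRK ler_ln ?posrE ?expR_gt0//.
  by near: m; exact: nbhs_infty_ger.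
by rewrite ltr0n (@ltn_trans 1)//; near: m; exact: near_gt1.
Unshelve. all: by end_near. Qed.

Lemma near_level : \forall m \near \oo,
  K / 2 <= alpha m * Num.sqrt (N m) <= 2 * K.
Proof.
have K2 : 0 < K / 2 by move: K0; lra.
near=> m.
have m1 : (1 < m)%N by near: m; exact: near_gt1.
have N0 : 0 < N m by rewrite ltr0n n0.
have : `|K - alpha m / N m `^ (- 2^-1)| <= K / 2.
  by near: m; exact: (cvgr_dist_le _ _ alpha_cvg _ K2).
have N0' := ltW N0; rewrite powRN invrK (powR12_sqrt N0') ler_norml => /andP[h1 h2].
by apply/andP; split; lra.
Unshelve. all: by end_near. Qed.

Lemma lnp m : (1 < m)%N -> ln (p m) = - (beta * L m).
Proof. by move=> m1; rewrite pE// ln_powR mulNr. Qed.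

(** The logarithm of the odds is ln delta + ln (1 - p) + beta ln m, where the first two terms are
    o(ln m). *)
Lemma near_ln_odds (e : R) : 0 < e ->
  \forall m \near \oo, `|ln (odds m) - beta * L m| <= e * L m.
Proof.
move=> e0; have e2 : 0 < e / 2 by lra.
have /andP[b0 b1] := beta01.
have ln2_gt0 : 0 < ln (2 : R) by rewrite ln_gt0// ltr1n.
near=> m.
have m1 : (1 < m)%N by near: m; exact: near_gt1.
have /andP[p0 p1] := p01 m1.
have L0 : 0 <= L m by near: m; exact: near_ln.
have hd : `|ln (delta m)| <= e / 2 * `|L m|.
  by near: m; move/eqoP : lndelta => /(_ _ e2).
rewrite (ger0_norm L0) in hd.
have p2 : p m <= 2^-1.
  rewrite -ler_ln ?posrE ?invr_gt0// lnp// lnV ?posrE// lerN2.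
  rewrite mulrC -ler_pdivrMr//; near: m; exact: near_ln.
have q0 : - ln 2 <= ln (1 - p m).
  by rewrite -lnV ?posrE// ler_ln ?posrE ?invr_gt0//; lra.
have q1 : ln (1 - p m) <= 0 by apply: ln_le0; lra.
have lo : ln (odds m) = ln (delta m) + (ln (1 - p m) + beta * L m).
  rewrite /odds lnM ?posrE ?delta_gt0 ?divr_gt0 ?subr_gt0//.
  by rewrite lnM ?posrE ?invr_gt0 ?subr_gt0// lnV ?posrE// lnp// opprK.
have l2 : ln 2 <= e / 2 * L m.
  by rewrite mulrC -ler_pdivrMr//; near: m; exact: near_ln.
rewrite lo; move: hd; rewrite !ler_norml => /andP[h1 h2]; apply/andP; split; lra.
Unshelve. all: by end_near. Qed.

Lemma near_odds_ratio (e : R) : 0 < e ->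
  \forall m \near \oo, `|2 * ln (odds m) - C * N m| <= e * N m.
Proof.
move=> e0; near=> m.
have N0 : 0 < N m by rewrite ltr0n n0//; near: m; exact: near_gt1.
have : `|C - 2 * ln (odds m) / N m| <= e.
  by near: m; exact: (cvgr_dist_le _ _ lnodds_cvg _ e0).
rewrite distrC -(ler_pM2r N0) -{2}(gtr0_norm N0) -normrM mulrBl divfK//.
by rewrite gt_eqF.
Unshelve. all: by end_near. Qed.

Lemma near_ln_sample_size (e : R) : 0 < e ->
  \forall m \near \oo, ln (Num.sqrt (N m)) <= e * N m.
Proof.
move=> e0; near=> m.
have N0 : 0 < N m by rewrite ltr0n n0//; near: m; exact: near_gt1.
have sN : 0 < Num.sqrt (N m) by rewrite sqrtr_gt0.
apply: (le_trans (ltW (ln_sublinear sN))).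
rewrite -[X in e * X](sqr_sqrtr (ltW N0)) expr2 mulrA ler_peMl ?sqrtr_ge0//.
have ei : 0 <= e^-1 by rewrite invr_ge0 ltW.
rewrite mulrC -ler_pdivrMr// div1r -[leLHS](ger0_norm ei).
rewrite -sqrtr_sqr ler_wsqrtr//; near: m; exact: near_sample_size.
Unshelve. all: by end_near. Qed.

(** Eventually ln odds is at least [beta * L m / 2] and at most [e * N m / 2]. So ln m = o(n) when C
    = 0, and ln m = O(n) in general. *)
Lemma near_ln_le (e : R) : 0 < e -> C < e ->
  \forall m \near \oo, L m <= e / beta * N m.
Proof.
move=> e0 Ce; have /andP[b0 b1] := beta01.
have b2 : 0 < beta / 2 by lra.
have eC : 0 < e - C by lra.
near=> m.
have h1 : `|ln (odds m) - beta * L m| <= beta / 2 * L m.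
  by near: m; exact: near_ln_odds.
have h2 : `|2 * ln (odds m) - C * N m| <= (e - C) * N m.
  by near: m; exact: near_odds_ratio.
move: h1 h2; rewrite !ler_norml => /andP[h1 _] /andP[_ h2].
have : beta * L m <= e * N m by lra.
by move=> h; rewrite mulrAC ler_pdivlMr// mulrC.
Unshelve. all: by end_near. Qed.

(** If [beta = 1], then [m * p = 1] and the truncation is 0. Otherwise [m * p] is a positive power
    of [m], and the exponential decays faster than any power of [m], in particular faster than
    n^(-1/2), which is at least m^(- gamma2 / 2). *)
Lemma near_no_sparse_failure : \forall m \near \oo,
  (Num.truncn (m%:R * p m / 16))%:R * expR (- (m%:R * p m / 16)) <=
  sigma / Num.sqrt (N m).
Proof.
have /andP[b0 b1] := beta01.
pose q := (1 - beta) ^+ 2 / 128.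
near=> m.
have m1 : (1 < m)%N by near: m; exact: near_gt1.
have m0 : 0 < m%:R :> R by rewrite ltr0n ltnW.
have N0 : 0 < N m by rewrite ltr0n n0.
have sN : 0 < Num.sqrt (N m) by rewrite sqrtr_gt0.
have L0 : 0 <= L m by near: m; exact: near_ln.
have mpE : m%:R * p m = expR ((1 - beta) * L m).
  rewrite pE// -{1}[m%:R]lnK ?posrE// /powR gt_eqF// -expRD; congr expR; ring.
have s_ge0 : 0 <= sigma / Num.sqrt (N m) by rewrite ltW// divr_gt0.
have [bn1|bn1] := eqVneq beta 1.
  have y1 : 0%:R <= m%:R * p m / 16 < 1%:R by rewrite mpE bn1 subrr mul0r expR0; lra.
  by rewrite (truncn_def y1) mul0r.
have q0 : 0 < q by rewrite divr_gt0// exprn_gt0// subr_gt0 lt_neqAle bn1.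
set y := m%:R * p m / 16.
have y0 : 0 <= y by rewrite divr_ge0// mpE expR_ge0.
apply: (@le_trans _ _ (y * expR (- y))).
  rewrite ler_wpM2r ?expR_ge0//.
  by have /andP[] := truncn_itv y0.
apply: (le_trans (mulr_expRN_le y0)).
(* By [expR h >= h ^+ 2 / 2] at [h = (1 - beta) * L m]; a quadratic in ln m already beats the linear
   [gamma2 / 2 * L m]. *)
have yL : q * L m ^+ 2 <= y / 2.
  rewrite /y mpE; have h : 0 <= (1 - beta) * L m by rewrite mulr_ge0// subr_ge0.
  have := sqr_le_expR h; have := expR_ge0 ((1 - beta) * L m).
  rewrite exprMn /q; lra.
have sN_le : Num.sqrt (N m) <= expR (gamma2 / 2 * L m).
  rewrite -[leRHS]ger0_norm ?expR_ge0// -sqrtr_sqr ler_wsqrtr// -expRM_natl.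
  apply: (le_trans (n_le m1)); rewrite /powR gt_eqF// ler_expR; lra.
rewrite ler_pdivlMr// -[leRHS]lnK ?posrE//.
apply: (@le_trans _ _ (expR (ln 2) * expR (- (q * L m ^+ 2)) * expR (gamma2 / 2 * L m))).
  rewrite lnK ?posrE//; apply: ler_pM; rewrite ?mulr_ge0 ?expR_ge0 ?sqrtr_ge0//.
  by rewrite ler_pM2l// ler_expR lerN2.
rewrite -!expRD ler_expR.
have h1 : (gamma2 / 2 + 1) / q <= L m by near: m; exact: near_ln.
have h2 : ln 2 - ln sigma <= L m by near: m; exact: near_ln.
rewrite ler_pdivrMr// in h1.
have : L m * (gamma2 / 2 + 1) <= L m * (L m * q) by rewrite ler_wpM2l.
lra.
Unshelve. all: by end_near. Qed.

End growth.

(** * The case C = 0 for large m *)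

Section dense_growth.
Context {R : realType} (nu : probability (measurableTypeR R) R).
Variables (S : set R) (rho : R -> R) (M : R).
Hypotheses (mS : measurable S) (mrho : measurable_fun S rho) (M0 : 0 <= M)
  (rho_bound : forall t, S t -> 0 < rho t <= M)
  (nuE : forall A, measurable A -> A `<=` S ->
    nu A = (\int[lebesgue_measure]_(t in A) (rho t)%:E)%E).
Variables (n : nat -> nat) (p delta alpha : nat -> R).
Variables (sigma beta gamma2 K Md : R).
Local Notation N m := ((n m)%:R : R).
Local Notation L m := (ln (m%:R : R)).
Local Notation sd m := (sigma / Num.sqrt (N m)).
Local Notation odds m := (delta m * ((1 - p m) / p m)).

Hypotheses (sigma0 : 0 < sigma) (nu0 : nu [set 0] = 0%E)
  (beta01 : 0 < beta <= 1)
  (K0 : 0 < K)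
  (n0 : forall m, (1 < m)%N -> (0 < n m)%N)
  (p01 : forall m, (1 < m)%N -> 0 < p m < 1)
  (alpha01 : forall m, (1 < m)%N -> 0 < alpha m < 1)
  (pE : forall m, (1 < m)%N -> p m = m%:R `^ (- beta))
  (delta_gt0 : forall m, (1 < m)%N -> 0 < delta m)
  (delta_le : forall m, (1 < m)%N -> delta m <= Md)
  (n_le : forall m, (1 < m)%N -> N m <= m%:R `^ gamma2)
  (n_cvg : n @ \oo --> \oo)
  (alpha_cvg : alpha m / N m `^ (- 2^-1) @[m --> \oo] --> K)
  (lnodds_cvg : 2 * ln (odds m) / N m @[m --> \oo] --> (0 : R))
  (lndelta : (fun m => ln (delta m)) =o_\oo (fun m => L m)).

Variables (eps c0 eta : R).
Hypotheses (eps0 : 0 < eps) (IS : `[- eps, eps]%classic `<=` S)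
  (c00 : 0 < c0) (c0_rho : forall t, 0 < t <= eps -> c0 <= rho t)
  (eta0 : 0 < eta) (eta2 : eta <= 2^-1).

Let K1 : R := M * Num.sqrt (pi *+ 2) + 1.
Let K2 : R := 8 * Md * K / sigma.

Let K10 : 0 < K1.
Proof. by apply: ltr_wpDl => //; apply: mulr_ge0 => //; exact: sqrtr_ge0. Qed.

Let scaled_le (m : nat) (x e : R) : (1 < m)%N -> 0 < e ->
  x <= e ^+ 2 / (2 * sigma ^+ 2) * N m -> sd m * Num.sqrt (2 * x) <= e.
Proof.
move=> m1 e0 xe; have N0 : 0 < N m by rewrite ltr0n n0.
have sN : 0 < Num.sqrt (N m) by rewrite sqrtr_gt0.
have sd0 : 0 <= sd m by rewrite ltW// divr_gt0.
rewrite -[sd m]ger0_norm// -sqrtr_sqr -sqrtrM ?sqr_ge0//.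
rewrite -[leRHS](ger0_norm (ltW e0)) -[leRHS]sqrtr_sqr ler_wsqrtr//.
rewrite exprMn exprVn sqr_sqrtr ?(ltW N0)//.
have -> : e ^+ 2 = sigma ^+ 2 / N m * (2 * (e ^+ 2 / (2 * sigma ^+ 2) * N m)).
  by field; rewrite !gt_eqF.
rewrite ler_wpM2l ?ler_wpM2l//.
by rewrite divr_ge0 ?sqr_ge0// ltW.
Qed.

Lemma near_dense_signals_bound : \forall m \near \oo, forall a b,
  a < 0 -> 0 < b -> lik nu (sd m) a = odds m -> lik nu (sd m) b = odds m ->
  exists k0 v, [/\ (k0 < m)%N, 0 < v,
    4 * delta m * alpha m + step_down_bound m (n m) (p m) sigma (alpha m) nu k0
      <= (1 + (8 * M + 2) / c0 * eta) * v &
    (1 - eta) * v <= alt_law (sd m) nu `]a, b[].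
Proof.
have /andP[b0 b1] := beta01.
(* Eventual bound on [s * z], [s * z1] and [s * z']. The first term keeps the intervals where the
   density is controlled; the second gives [M * e1 <= 1 / 8], needed to bound the mass of the ball
   of radius [z1] by 1 / 2. Below, [Y <= kap * N m] amounts to [s * sqrt (2 * Y) <= e1]. *)
pose e1 := Num.min (eps / 2) (8 * (M + 1))^-1.
have M1 : 0 < M + 1 by rewrite ltr_wpDl.
have e10 : 0 < e1 by rewrite lt_min divr_gt0//= invr_gt0 mulr_gt0.
have e1eps : e1 <= eps / 2 by rewrite ge_min lexx.
have e1M : M * e1 <= 8^-1.
  apply: (@le_trans _ _ ((M + 1) * e1)); first by rewrite ler_wpM2r ?lerDl// ltW.
  apply: (@le_trans _ _ ((M + 1) * (8 * (M + 1))^-1)).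
    by rewrite ler_wpM2l ?(ltW M1)// ge_min lexx orbT.
  by rewrite invfM mulrCA mulfV ?mulr1// gt_eqF.
pose kap := e1 ^+ 2 / (2 * sigma ^+ 2).
have kap0 : 0 < kap by rewrite divr_gt0 ?exprn_gt0// mulr_gt0// exprn_gt0.
have kap8 : 0 < kap / 8 by rewrite divr_gt0.
pose cK := ln (K / 2).
pose c2 := ln (K1 * sigma).
pose B1 := (2 * K1 + 1 + K2) / eta.
have K20 : 0 < K / 2 by rewrite divr_gt0.
have eb : 0 < eta * beta / 2 by rewrite divr_gt0// mulr_gt0.
pose ce := eps ^+ 2 / (8 * sigma ^+ 2).
have ce0 : 0 < ce by rewrite divr_gt0 ?exprn_gt0// mulr_gt0// exprn_gt0.
near=> m => a b a0 b0' la lb.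
have m1 : (1 < m)%N by near: m; exact: near_gt1.
have /andP[p0 p1] := p01 m1.
have /andP[al0 al1] := alpha01 m1.
have m0 : 1 < m%:R :> R by rewrite ltr1n.
have m00 : 0 < m%:R :> R by rewrite (lt_trans ltr01).
have N0 : 0 < N m by rewrite ltr0n n0.
have sN : 0 < Num.sqrt (N m) by rewrite sqrtr_gt0.
have d0 := delta_gt0 m1.
have L0 : 0 <= L m by rewrite ln_ge0// ltW.
have s0 : 0 < sd m by rewrite divr_gt0.
have Ks : 0 < K1 * sd m by rewrite mulr_gt0.
have odds0 : 0 < odds m by rewrite mulr_gt0// divr_gt0// subr_gt0.
have lkap : ln (Num.sqrt (N m)) <= kap / 8 * N m.
  by near: m; exact: (near_ln_sample_size n0 n_cvg kap8).
set l := ln (Num.sqrt (N m)) in lkap.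
have l0 : 0 <= l.
  by rewrite ln_ge0// -[leLHS]sqrtr1 ler_wsqrtr// ler1n n0.
have Lkap : L m <= kap / 8 * N m.
  have : L m <= (kap / 8 * beta) / beta * N m.
    near: m; apply: (near_ln_le beta01 n0 p01 pE delta_gt0 lnodds_cvg lndelta) => //;
      exact: mulr_gt0.
  by rewrite mulfK// gt_eqF.
have /andP[/= hal1 hal2] : K / 2 <= alpha m * Num.sqrt (N m) <= 2 * K.
  by near: m; exact: (near_level K0 n0 alpha_cvg).
have lnal : cK - l <= ln (alpha m).
  rewrite lerBlDr -lnM ?posrE// ler_ln ?posrE// mulr_gt0//.
have : `|ln (odds m) - beta * L m| <= eta * beta / 2 * L m.
  by near: m; exact: (near_ln_odds beta01 p01 pE delta_gt0 lndelta eb).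
rewrite ler_norml => /andP[lo1 lo2].
(* Half the squared cutoffs, chosen so that the constraints [hz], [hz1] and [hz'] of
   [dense_signals_bound] hold with equality. *)
pose Y := ln (32 / (alpha m * p m)).
pose Y1 := ln (2 * m%:R / alpha m).
pose Y' := ln (odds m / (K1 * sd m)).
have YE : Y = ln 32 - ln (alpha m) + beta * L m.
  rewrite /Y ln_div ?posrE ?mulr_gt0// lnM ?posrE// (lnp pE m1); ring.
have Y1E : Y1 = ln 2 + L m - ln (alpha m).
  by rewrite /Y1 ln_div ?posrE ?mulr_gt0// lnM ?posrE.
have Y'E : Y' = ln (odds m) - c2 + l.
  rewrite /Y' ln_div ?posrE// mulrA ln_div ?posrE ?mulr_gt0//.
  by rewrite /c2 -/l; ring.
have Yge0 : 0 <= Y.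
  rewrite ln_ge0// ler_pdivlMr ?mulr_gt0// mul1r.
  by apply: (@le_trans _ _ 1); [rewrite mulr_ile1// ltW|rewrite ler1n].
have Y1ge0 : 0 <= Y1.
  rewrite ln_ge0// ler_pdivlMr// mul1r (le_trans (ltW al1))//.
  by move: m0; lra.
have etaL : eta * beta / 2 * L m <= beta * L m / 2.
  have : eta * (beta * L m) <= 1 * (beta * L m).
    by rewrite ler_wpM2r ?mulr_ge0// ?(ltW b0)//; move: eta2; lra.
  lra.
have bL : beta * L m <= L m by rewrite ler_piMl.
have Ykap : Y <= kap * N m.
  have h : ln 32 - cK <= kap / 8 * N m.
    by rewrite mulrC -ler_pdivrMr//; near: m; exact: (near_sample_size n_cvg).
  have h0 : 0 <= kap / 8 * N m by rewrite mulr_ge0 ?(ltW N0)// ltW.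
  rewrite YE; lra.
have Y1kap : Y1 <= kap * N m.
  have h : ln 2 - cK <= kap / 8 * N m.
    by rewrite mulrC -ler_pdivrMr//; near: m; exact: (near_sample_size n_cvg).
  have h0 : 0 <= kap / 8 * N m by rewrite mulr_ge0 ?(ltW N0)// ltW.
  rewrite Y1E; lra.
have Y'kap : Y' <= kap * N m.
  have h : - c2 <= kap / 8 * N m.
    by rewrite mulrC -ler_pdivrMr//; near: m; exact: (near_sample_size n_cvg).
  have h0 : 0 <= kap / 8 * N m by rewrite mulr_ge0 ?(ltW N0)// ltW.
  rewrite Y'E; lra.
have Y'big B : B + c2 <= beta * L m / 2 -> B <= Y'.
  by rewrite Y'E; lra.
have Lbig B : B / (beta / 2) <= L m -> B <= beta * L m / 2.
  by rewrite ler_pdivrMr ?divr_gt0// => h; lra.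
have Y'0 : 1 <= Y'.
  apply: Y'big; apply: Lbig; near: m; exact: near_ln.
have Y'pos : 0 < Y' by exact: lt_le_trans Y'0.
have sqz (x : R) : 0 <= x -> Num.sqrt (2 * x) ^+ 2 / 2 = x.
  by move=> x0; rewrite sqr_sqrtr ?mulr_ge0//; lra.
have B1le : B1 ^+ 2 / 2 <= Y'.
  apply: Y'big; apply: Lbig; near: m; exact: near_ln.
have lnle : ln (2 / eta) / eta ^+ 2 <= Y'.
  apply: Y'big; apply: Lbig; near: m; exact: near_ln.
apply: (dense_signals_bound mS mrho M0 rho_bound nuE (K2 := K2) (eps := eps)
  (z := Num.sqrt (2 * Y)) (z1 := Num.sqrt (2 * Y1)) (z' := Num.sqrt (2 * Y'))
  m1 (n0 m1) (p01 m1) sigma0 al0 nu0 eps0 IS c00 c0_rho a0 b0' la lb eta0 eta2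
  (sqrtr_ge0 _) (sqrtr_ge0 _)).
- by rewrite sqrtr_gt0 mulr_gt0.
- rewrite sqz// expRN lnK ?posrE ?divr_gt0 ?mulr_gt0// invf_div; lra.
- rewrite sqz// expRN lnK ?posrE ?divr_gt0 ?mulr_gt0//.
  rewrite invf_div (_ : 2 * _ = alpha m / m%:R)//.
  by field; rewrite gt_eqF.
- rewrite (sqz _ (ltW Y'pos)) lnK ?posrE ?(divr_gt0 odds0 Ks)//.
  by rewrite divfK// gt_eqF.
- by apply: le_trans e1eps; apply: scaled_le.
- by apply: le_trans e1eps; apply: scaled_le.
- by apply: le_trans e1eps; apply: scaled_le.
- rewrite (_ : (eps / (2 * sd m)) ^+ 2 / 2 = ce * Num.sqrt (N m) ^+ 2); last first.
    by rewrite /ce; field; rewrite !gt_eqF.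
  apply: expRN_sqr_le => //; near: m; exact: (near_sqrt n_cvg).
- have h1 : sd m * Num.sqrt (2 * Y1) <= e1 by apply: scaled_le.
  have h2 : M * (sd m * Num.sqrt (2 * Y1)) <= M * e1 by rewrite ler_wpM2l.
  have h3 : K1 * sd m <= 8^-1.
    rewrite mulrA ler_pdivrMr// [leRHS]mulrC -ler_pdivrMr ?invr_gt0//.
    near: m; exact: (near_sqrt n_cvg).
  have arith x y : M * x <= 8^-1 -> y <= 8^-1 -> 2 * M * x + 2 * y <= 2^-1 by lra.
  exact: arith (le_trans h2 e1M) h3.
- by near: m; exact: (near_no_sparse_failure sigma0 beta01 n0 pE n_le).
- have h : delta m * (alpha m * Num.sqrt (N m)) <= Md * (2 * K).
    by apply: ler_pM => //; [exact: ltW|rewrite ltW// mulr_gt0|exact: delta_le].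
  rewrite (_ : K2 * sd m = 8 * Md * K / Num.sqrt (N m)); last first.
    by rewrite /K2; field; rewrite !gt_eqF.
  by rewrite ler_pdivlMr//; lra.
(* The crux for C = 0. Up to constants and [eta * beta / 2 * L m], both [Y] and [Y'] equal
   [beta * L m + l] with l = ln sqrt n, which enters [Y] through the level and [Y'] through the
   standard deviation in [K1 * sd m]. Hence [Y <= (1 + eta) ^+ 2 * Y'] for large m. *)
- have e1' : 0 <= 1 + eta by rewrite addr_ge0// ltW.
  rewrite -[1 + eta](ger0_norm e1') -sqrtr_sqr -sqrtrM ?sqr_ge0// ler_wsqrtr//.
  have big : 2 * `|c2| + ln 32 - cK <= eta * beta * L m.
    rewrite [leRHS]mulrC -ler_pdivrMr ?mulr_gt0//; near: m; exact: near_ln.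
  have h1 : 0 <= eta * (beta * L m) * (2^-1 - eta).
    by rewrite mulr_ge0 ?subr_ge0// mulr_ge0 ?mulr_ge0// ltW.
  have h2 : 0 <= eta * l by rewrite mulr_ge0// ltW.
  have h3 : (1 + 2 * eta) * (beta * L m - eta * beta / 2 * L m - c2 + l) <=
      (1 + 2 * eta) * Y'.
    by rewrite ler_wpM2l ?addr_ge0 ?mulr_ge0 ?(ltW eta0)// Y'E; lra.
  have h4 : 0 <= eta ^+ 2 * Y' by rewrite mulr_ge0 ?sqr_ge0// ltW.
  have h5 : (1 + 2 * eta) * c2 <= 2 * `|c2|.
    apply: (le_trans (ler_norm _)); rewrite normrM ler_wpM2r//.
    by rewrite ger0_norm ?addr_ge0 ?mulr_ge0 ?(ltW eta0)//; move: eta2; lra.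
  move: h1 h2 h3 h4 h5 big; rewrite YE; nra.
- rewrite [leRHS]mulrC -ler_pdivrMr// -/B1.
  apply: (le_trans (ler_norm _)); rewrite -sqrtr_sqr ler_wsqrtr//.
  by rewrite mulrC -ler_pdivrMr.
- rewrite exprMn -mulrA (sqz _ (ltW Y'pos)).
  have h : ln (2 / eta) <= eta ^+ 2 * Y'.
    by rewrite [leRHS]mulrC -ler_pdivrMr// exprn_gt0.
  rewrite -ler_expR lnK ?posrE ?divr_gt0// in h.
  by rewrite expRN ler_pdivrMr ?expR_gt0// mulrC -ler_pdivrMr.
Unshelve. all: by end_near. Qed.

End dense_growth.

(** * The case C > 0 for large m *)

Section sparse_growth.
Context {R : realType} (nu : probability (measurableTypeR R) R).

Lemma lik_ge (s x c : R) (A : set R) : 0 < s -> measurable A ->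
  (forall t, A t -> c <= t / s * x - (t / s) ^+ 2 / 2) ->
  fine (nu A) * expR c <= lik nu s x.
Proof.
move=> s0 mA cA; rewrite mulrC -lee_fin EFinM numassE// (likE nu s0).
have mf := measurable_lik_integrand s x.
apply: (@le_trans _ _ (\int[nu]_(t in A) (expR (t / s * x - (t / s) ^+ 2 / 2))%:E)%E).
  apply: (@ge0_integral_ge_cst _ _ _ nu A _ _ mA (measurable_funTS mf) (expR_ge0 c)).
  by move=> t At; rewrite ler_expR cA.
apply: ge0_subset_integral => //.
  by apply/measurable_EFinP.
Qed.

Variables (S : set R) (rho : R -> R) (M : R).
Hypotheses (mS : measurable S) (mrho : measurable_fun S rho) (M0 : 0 <= M)
  (rho_bound : forall t, S t -> 0 < rho t <= M)
  (nuE : forall A, measurable A -> A `<=` S ->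
    nu A = (\int[lebesgue_measure]_(t in A) (rho t)%:E)%E).
Variables (n : nat -> nat) (p delta alpha : nat -> R).
Variables (sigma beta C K Md : R).
Local Notation N m := ((n m)%:R : R).
Local Notation L m := (ln (m%:R : R)).
Local Notation sd m := (sigma / Num.sqrt (N m)).
Local Notation odds m := (delta m * ((1 - p m) / p m)).

Hypotheses (sigma0 : 0 < sigma)
  (beta01 : 0 < beta <= 1)
  (K0 : 0 < K) (C0 : 0 <= C)
  (n0 : forall m, (1 < m)%N -> (0 < n m)%N)
  (p01 : forall m, (1 < m)%N -> 0 < p m < 1)
  (alpha01 : forall m, (1 < m)%N -> 0 < alpha m < 1)
  (pE : forall m, (1 < m)%N -> p m = m%:R `^ (- beta))
  (delta_gt0 : forall m, (1 < m)%N -> 0 < delta m)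
  (delta_le : forall m, (1 < m)%N -> delta m <= Md)
  (n_cvg : n @ \oo --> \oo)
  (alpha_cvg : alpha m / N m `^ (- 2^-1) @[m --> \oo] --> K)
  (lnodds_cvg : 2 * ln (odds m) / N m @[m --> \oo] --> C)
  (lndelta : (fun m => ln (delta m)) =o_\oo (fun m => L m)).

Variables (T c2 eta : R).
Hypotheses (TE : T ^+ 2 = C * sigma ^+ 2)
  (eta0 : 0 < eta) (eta1 : eta <= 1) (etaT : 2 * eta <= T)
  (posS : `[T - 2 * eta, T + 2 * eta]%classic `<=` S)
  (negS : `[- (T + 2 * eta), - (T - 2 * eta)]%classic `<=` S)
  (c20 : 0 < c2) (c2v : c2 <= fine (nu [set t | `|t| <= T - 2 * eta])).

Lemma near_sparse_signals_bound : \forall m \near \oo, forall a b,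
  a < 0 -> 0 < b -> lik nu (sd m) a = odds m -> lik nu (sd m) b = odds m ->
  exists k0 v, [/\ (k0 < m)%N, 0 < v,
    4 * delta m * alpha m + step_down_bound m (n m) (p m) sigma (alpha m) nu k0
      <= (1 + (8 * M + 3) / c2 * eta) * v &
    (1 - eta) * v <= alt_law (sd m) nu `]a, b[].
Proof.
have /andP[b0 b1] := beta01.
have e0 := eta0; have eT := etaT; have CC0 := C0.
have T0 : 0 < T by lra.
have sigma20 : 0 < sigma ^+ 2 by rewrite exprn_gt0.
(* The effects just beyond [T] and [- T] make the likelihood ratio large at the z-scores
   [(T + eta) / s] and [- (T + eta) / s]. *)
pose w1 := fine (nu `]T, T + eta]%classic).
pose w2 := fine (nu `]- T - eta, - T]%classic).
have w10 : 0 < w1.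
  apply: (numass_itv_gt0 mS mrho rho_bound nuE); first lra.
  move=> t /=; rewrite in_itv/= => /andP[h1 h2]; apply: posS.
  by rewrite /= in_itv/=; apply/andP; split; lra.
have w20 : 0 < w2.
  apply: (numass_itv_gt0 mS mrho rho_bound nuE); first lra.
  move=> t /=; rewrite in_itv/= => /andP[h1 h2]; apply: negS.
  by rewrite /= in_itv/=; apply/andP; split; lra.
pose w0 := Num.min w1 w2.
have w00 : 0 < w0 by rewrite lt_min w10 w20.
(* Exponential rate in n of [lik] at these z-scores: for [T < t <= T + eta], the exponent
   [t * (T + eta) - t ^+ 2 / 2], in units of n / sigma^2, is at least [T ^+ 2 / 2 + T * eta]. *)
pose Q := (T ^+ 2 / 2 + T * eta) / sigma ^+ 2.
have Q0 : 0 < Q by rewrite divr_gt0// ltr_wpDl ?mulr_gt0// divr_ge0// sqr_ge0.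
(* A unit of slack. The rate [Q] exceeds [C / 2] by four units; three of them pay for ln sqrt n, for
   the gap between [beta * L m] and ln odds, and for the gap between ln odds and [C * N m / 2], so
   [p * W * alpha] still grows at least like [expR (g * N m)]. *)
pose g := T * eta / (4 * sigma ^+ 2).
have g0 : 0 < g by rewrite divr_gt0 ?mulr_gt0.
have QE : Q = C / 2 + 4 * g.
  by rewrite /Q /g TE; field; rewrite gt_eqF.
pose cK := ln (K / 2).
have K20 : 0 < K / 2 by rewrite divr_gt0.
have C10 : 0 < C + 1 by lra.
(* Makes [eb * L m <= g * N m], given [L m <= (C + 1) / beta * N m]. *)
pose eb := g * beta / (C + 1).
have eb0 : 0 < eb by rewrite divr_gt0// mulr_gt0.
have g20 : 0 < 2 * g by rewrite mulr_gt0.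
pose cu := (T + eta) ^+ 2 / (2 * sigma ^+ 2).
have cu0 : 0 < cu by apply: divr_gt0; [apply: exprn_gt0; exact: addr_gt0|exact: mulr_gt0].
pose ce := eta ^+ 2 / (2 * sigma ^+ 2).
have ce0 : 0 < ce by apply: divr_gt0; [exact: exprn_gt0|exact: mulr_gt0].
pose B := ln (4 / eta).
near=> m => a b a0 b0' la lb.
have m1 : (1 < m)%N by near: m; exact: near_gt1.
have /andP[p0 p1] := p01 m1.
have /andP[al0 al1] := alpha01 m1.
have N0 : 0 < N m by rewrite ltr0n n0.
have sN : 0 < Num.sqrt (N m) by rewrite sqrtr_gt0.
have sN2 : Num.sqrt (N m) ^+ 2 = N m by rewrite sqr_sqrtr ?(ltW N0).
have d0 := delta_gt0 m1.
have s0 : 0 < sd m by rewrite divr_gt0.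
have odds0 : 0 < odds m by rewrite mulr_gt0// divr_gt0// subr_gt0.
have lg : ln (Num.sqrt (N m)) <= g * N m.
  by near: m; exact: (near_ln_sample_size n0 n_cvg g0).
set l := ln (Num.sqrt (N m)) in lg.
have Lg : L m <= (C + 1) / beta * N m.
  near: m; apply: (near_ln_le beta01 n0 p01 pE delta_gt0 lnodds_cvg lndelta C10).
  by rewrite ltrDl.
have /andP[/= hal1 hal2] : K / 2 <= alpha m * Num.sqrt (N m) <= 2 * K.
  by near: m; exact: (near_level K0 n0 alpha_cvg).
have lnal : cK - l <= ln (alpha m).
  by rewrite lerBlDr -lnM ?posrE// ler_ln ?posrE// mulr_gt0.
have : `|ln (odds m) - beta * L m| <= eb * L m.
  by near: m; exact: (near_ln_odds beta01 p01 pE delta_gt0 lndelta eb0).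
rewrite ler_norml => /andP[lo1 _].
have : `|2 * ln (odds m) - C * N m| <= 2 * g * N m.
  by near: m; exact: (near_odds_ratio n0 lnodds_cvg g20).
rewrite ler_norml => /andP[lr1 lr2].
have ebL : eb * L m <= g * N m.
  have -> : g * N m = eb * ((C + 1) / beta * N m).
    by rewrite /eb; field; rewrite !gt_eqF.
  by rewrite ler_pM2l.
pose W := w0 * expR (Q * N m).
have sdE x : (x / sd m) ^+ 2 / 2 = x ^+ 2 / (2 * sigma ^+ 2) * Num.sqrt (N m) ^+ 2.
  by field; rewrite !gt_eqF.
have QN : Q * N m = (T ^+ 2 / 2 + T * eta) * (Num.sqrt (N m) / sigma) ^+ 2.
  by rewrite /Q -{1}sN2; field; rewrite gt_eqF.
have r0 : 0 <= (Num.sqrt (N m) / sigma) ^+ 2 by exact: sqr_ge0.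
apply: (@sparse_signals_bound _ nu S rho M mS mrho M0 rho_bound nuE m (n m) (p m)
  sigma (alpha m) (odds m) a b eta T W c2 (4 * delta m * alpha m)) => //.
- exact: n0.
- exact: p01.
- have h : ln w0^-1 <= Q * N m.
    by rewrite [leRHS]mulrC -ler_pdivrMr//; near: m; exact: (near_sample_size n_cvg).
  rewrite -ler_expR lnK ?posrE ?invr_gt0// in h.
  by rewrite /W -ler_pdivrMl// mulr1.
- apply: (@le_trans _ _ (w1 * expR (Q * N m))).
    by rewrite ler_pM2r ?expR_gt0// ge_min lexx.
  apply: lik_ge => // t /=; rewrite in_itv/= => /andP[h1 h2].
  have -> : t / sd m * ((T + eta) / sd m) - (t / sd m) ^+ 2 / 2 =
      (t * (T + eta) - t ^+ 2 / 2) * (Num.sqrt (N m) / sigma) ^+ 2.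
    by field; rewrite !gt_eqF.
  rewrite QN ler_wpM2r//.
  (* The exponents differ by [(t - T) * (T + eta - t) + (t - T) ^+ 2 / 2]. *)
  have : 0 <= (t - T) * (T + eta - t) by rewrite mulr_ge0//; lra.
  have : 0 <= (t - T) * (t - T) by rewrite -expr2 sqr_ge0.
  lra.
- apply: (@le_trans _ _ (w2 * expR (Q * N m))).
    by rewrite ler_pM2r ?expR_gt0// ge_min lexx orbT.
  apply: lik_ge => // t /=; rewrite in_itv/= => /andP[h1 h2].
  have -> : t / sd m * - ((T + eta) / sd m) - (t / sd m) ^+ 2 / 2 =
      (- t * (T + eta) - t ^+ 2 / 2) * (Num.sqrt (N m) / sigma) ^+ 2.
    by field; rewrite !gt_eqF.
  rewrite QN ler_wpM2r//.
  have : 0 <= (- t - T) * (T + eta + t) by rewrite mulr_ge0//; lra.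
  have : 0 <= (- t - T) * (- t - T) by rewrite -expr2 sqr_ge0.
  lra.
- apply: (le_lt_trans (ptail_le_expR _)); rewrite sdE.
  have h : expR (- (cu * Num.sqrt (N m) ^+ 2)) <= K / 8 / Num.sqrt (N m).
    apply: expRN_sqr_le => //; first by rewrite divr_gt0.
    near: m; exact: (near_sqrt n_cvg).
  apply: (@le_lt_trans _ _ (2 * (K / 8 / Num.sqrt (N m)))); first by rewrite ler_pM2l.
  rewrite mulrA ltr_pdivrMr//; lra.
- have h : B <= p m * W * alpha m / 4.
    have h1 : w0 * expR (g * N m + cK) <= p m * W * alpha m.
      have pe : p m = expR (- (beta * L m)) by rewrite -(lnp pE m1) lnK.
      have ae : expR (cK - l) <= alpha m by rewrite -[leRHS]lnK ?posrE// ler_expR.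
      apply: (@le_trans _ _ (p m * W * expR (cK - l))).
        rewrite pe /W.
        have -> : expR (- (beta * L m)) * (w0 * expR (Q * N m)) * expR (cK - l) =
            w0 * expR (- (beta * L m) + Q * N m + (cK - l)) by rewrite !expRD; ring.
        rewrite ler_pM2l// ler_expR QE; lra.
      by rewrite ler_pM2l// mulr_gt0// mulr_gt0// expR_gt0.
    have h2 : 4 * B / w0 <= expR (g * N m + cK).
      apply: le_trans (expR_ge1Dx _).
      have : (4 * B / w0 - cK) / g <= N m by near: m; exact: (near_sample_size n_cvg).
      by rewrite ler_pdivrMr// => h3; lra.
    rewrite ler_pdivrMr// in h2; lra.
  rewrite -ler_expR lnK ?posrE ?divr_gt0// ler_pdivrMr// in h.
  by rewrite expRN ler_pdivrMr ?expR_gt0// mulrC.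
- rewrite sdE.
  have h : expR (- (ce * Num.sqrt (N m) ^+ 2)) <= eta / 2 / Num.sqrt (N m).
    apply: expRN_sqr_le => //; first by rewrite divr_gt0.
    near: m; exact: (near_sqrt n_cvg).
  have sN1 : 1 <= Num.sqrt (N m) by near: m; exact: (near_sqrt n_cvg).
  apply: (@le_trans _ _ (2 * (eta / 2 / Num.sqrt (N m)))); first by rewrite ler_pM2l.
  rewrite mulrA ler_pdivrMr//.
  have : eta * 1 <= eta * Num.sqrt (N m) by rewrite ler_pM2l.
  lra.
- rewrite sdE sN2 -[leRHS]lnK ?posrE// ler_expR.
  (* As [eta <= T], the rate at [zlow] is at least two units [g] below [C / 2], whereas ln odds is
     within one. *)
  have : (T - eta) ^+ 2 / (2 * sigma ^+ 2) <= C / 2 - 2 * g.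
    rewrite /g ler_pdivrMr ?mulr_gt0//.
    have -> : (C / 2 - 2 * (T * eta / (4 * sigma ^+ 2))) * (2 * sigma ^+ 2) =
        C * sigma ^+ 2 - T * eta by field; rewrite gt_eqF.
    rewrite -TE; have : eta * eta <= eta * T by rewrite ler_pM2l//; lra.
    lra.
  rewrite -(ler_pM2r N0) => /le_trans; apply; lra.
- have h : delta m * (alpha m * Num.sqrt (N m)) <= Md * (2 * K).
    by apply: ler_pM => //; [exact: ltW|rewrite ltW// mulr_gt0|exact: delta_le].
  have h1 : 8 * Md * K / eta <= Num.sqrt (N m) by near: m; exact: (near_sqrt n_cvg).
  rewrite ler_pdivrMr// in h1.
  rewrite -(ler_pM2r sN); lra.
Unshelve. all: by end_near. Qed.

End sparse_growth.

(** * Both cases together and the conclusion *)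

Lemma ratio_cvg1 (R : realType) (r o : nat -> R) :
  (\forall m \near \oo, 0 < o m) -> (\forall m \near \oo, o m <= r m) ->
  (forall e, 0 < e -> \forall m \near \oo, r m <= (1 + e) * o m) ->
  r m / o m @[m --> \oo] --> (1 : R).
Proof.
move=> o0 or ro; apply/cvgrPdist_le => e e0; near=> m.
have om : 0 < o m by near: m.
have h1 : 1 <= r m / o m by rewrite ler_pdivlMr// mul1r; near: m.
have h2 : r m / o m <= 1 + e by rewrite ler_pdivrMr//; near: m; exact: ro.
by rewrite ler_norml; apply/andP; split; lra.
Unshelve. all: by end_near. Qed.

Section comparison.
Context {R : realType} (nu : probability (measurableTypeR R) R).
Variables (n : nat -> nat) (p delta alpha : nat -> R).
Variables (sigma beta gamma2 C K Md : R).
Local Notation N m := ((n m)%:R : R).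
Local Notation L m := (ln (m%:R : R)).
Local Notation sd m := (sigma / Num.sqrt (N m)).
Local Notation odds m := (delta m * ((1 - p m) / p m)).

Hypotheses (sigma0 : 0 < sigma) (nu0 : nu [set 0] = 0%E)
  (nuC : assumption_C nu sigma C)
  (beta01 : 0 < beta <= 1) (K0 : 0 < K) (C0 : 0 <= C)
  (n0 : forall m, (1 < m)%N -> (0 < n m)%N)
  (p01 : forall m, (1 < m)%N -> 0 < p m < 1)
  (alpha01 : forall m, (1 < m)%N -> 0 < alpha m < 1)
  (pE : forall m, (1 < m)%N -> p m = m%:R `^ (- beta))
  (delta_gt0 : forall m, (1 < m)%N -> 0 < delta m)
  (delta_le : forall m, (1 < m)%N -> delta m <= Md)
  (n_le : forall m, (1 < m)%N -> N m <= m%:R `^ gamma2)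
  (n_cvg : n @ \oo --> \oo)
  (alpha_cvg : alpha m / N m `^ (- 2^-1) @[m --> \oo] --> K)
  (lnodds_cvg : 2 * ln (odds m) / N m @[m --> \oo] --> C)
  (lndelta : (fun m => ln (delta m)) =o_\oo (fun m => L m)).

(** [A] and [eta1] depend on neither [m] nor [eta], so [eta] can be adapted afterwards to the
    tolerance on the risk ratio. All cutoffs are treated at once because those of the oracle vary
    with [m]. *)
Lemma near_step_down_bound : exists A eta1 : R, [/\ 0 <= A, 0 < eta1 &
  forall eta, 0 < eta -> eta <= eta1 -> \forall m \near \oo, forall a b,
  a < 0 -> 0 < b -> lik nu (sd m) a = odds m -> lik nu (sd m) b = odds m ->
  exists k0 v, [/\ (k0 < m)%N, 0 < v,
    4 * delta m * alpha m + step_down_bound m (n m) (p m) sigma (alpha m) nu k0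
      <= (1 + A * eta) * v &
    (1 - eta) * v <= alt_law (sd m) nu `]a, b[]].
Proof.
move: nuC; rewrite /assumption_C; set T := sigma * Num.sqrt C.
move=> [eps [rho [M]]].
set S : set R := `[- T - eps, - T + eps] `|` `[T - eps, T + eps].
move=> /= [eps0 mrho rho_bound nuE rho0].
have mS : measurable S by apply: measurableU; exact: measurable_itv.
have M0 : 0 <= M.
  have /andP[h1 h2] : 0 < rho T <= M.
    by apply: rho_bound; right; rewrite /= in_itv/=; apply/andP; split; lra.
  exact: ltW (lt_le_trans h1 h2).
have [CE|Cneq0] := eqVneq C 0.
  have TE : T = 0 by rewrite /T CE sqrtr0 mulr0.
  (* Here [T = 0], and the positive limit of the density on the right of 0 provides the lower bound
     [c0 = l / 2]. *)
  have [_ [l l0 rho_l]] := rho0 CE.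
  have l2 : 0 < l / 2 by lra.
  have : \forall t \near (0 : R)^'+, l / 2 <= rho t.
    by apply: (cvgr_ge _ rho_l); lra.
  move=> /nbhs_ballP[e /= e0 he].
  pose eps1 := Num.min eps (e / 2).
  have eps10 : 0 < eps1 by rewrite lt_min eps0 divr_gt0.
  have eps1e : eps1 <= e / 2 by rewrite ge_min lexx orbT.
  have eps1eps : eps1 <= eps by rewrite ge_min lexx.
  have IS : `[- eps1, eps1]%classic `<=` S.
    move=> t /=; rewrite in_itv/= => /andP[h1 h2]; right.
    by rewrite /= in_itv/= TE; apply/andP; split; lra.
  have c0_rho t : 0 < t <= eps1 -> l / 2 <= rho t.
    move=> /andP[t0 te]; apply: he => //=.
    by rewrite /ball/= sub0r normrN gtr0_norm//; lra.
  exists ((8 * M + 2) / (l / 2)), 2^-1; split => //.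
    by rewrite divr_ge0 ?(ltW l2)// addr_ge0// mulr_ge0.
  move=> eta eta0 eta2; have lo := lnodds_cvg; rewrite CE in lo.
  exact: (near_dense_signals_bound mS mrho M0 rho_bound nuE sigma0 nu0 beta01 K0
    n0 p01 alpha01 pE delta_gt0 delta_le n_le n_cvg alpha_cvg lo lndelta eps10 IS
    l2 c0_rho eta0 eta2).
have Cgt0 : 0 < C by rewrite lt_neqAle eq_sym Cneq0.
have T0 : 0 < T by rewrite mulr_gt0// sqrtr_gt0.
have TE : T ^+ 2 = C * sigma ^+ 2 by rewrite exprMn sqr_sqrtr// mulrC.
pose e1 := Num.min eps T.
have e10 : 0 < e1 by rewrite lt_min eps0.
have e1eps : e1 <= eps by rewrite ge_min lexx.
have e1T : e1 <= T by rewrite ge_min lexx orbT.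
(* As [2 * eta <= e1 / 2] and [e1 <= T], this interval lies in [|t| <= T - 2 * eta] for every
   admissible [eta]: its mass is a lower bound free of [eta]. *)
pose c2 := fine (nu `]T - e1, T - e1 / 2]%classic).
have c20 : 0 < c2.
  apply: (numass_itv_gt0 mS mrho rho_bound nuE); first lra.
  move=> t /=; rewrite in_itv/= => /andP[h1 h2]; right; rewrite /= in_itv/=.
  by apply/andP; split; lra.
exists ((8 * M + 3) / c2), (Num.min 1 (e1 / 4)); split => //.
- by rewrite divr_ge0 ?(ltW c20)// addr_ge0// mulr_ge0.
- by rewrite lt_min ltr01 divr_gt0.
move=> eta eta0; rewrite le_min => /andP[eta1 etae].
have etaT : 2 * eta <= T by lra.
apply: (@near_sparse_signals_bound _ nu S rho M mS mrho M0 rho_bound nuE n p delta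
  alpha sigma beta C K Md sigma0 beta01 K0 C0 n0 p01 alpha01 pE delta_gt0 delta_le
  n_cvg alpha_cvg lnodds_cvg lndelta T c2 eta) => //.
- move=> t /=; rewrite in_itv/= => /andP[h1 h2]; right; rewrite /= in_itv/=.
  by apply/andP; split; lra.
- move=> t /=; rewrite in_itv/= => /andP[h1 h2]; left; rewrite /= in_itv/=.
  by apply/andP; split; lra.
- apply: le_numass => //; first exact: measurable_norm_le.
  by move=> t /=; rewrite in_itv/= => /andP[h1 h2]; rewrite gtr0_norm; lra.
Qed.

End comparison.

Unset Implicit Arguments.
Set Strict Implicit.

Theorem corollary2p4 (R : realType)
  (sigma : R) (nu : probability (measurableTypeR R) R)
  (n : nat -> nat) (p delta0 deltaA alpha : nat -> R)
  (d : nat -> measure_display) (Omega : forall m, measurableType (d m))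
  (P : forall m, probability (Omega m) R)
  (mu : forall m, 'I_m -> {RV (P m) >-> R})
  (X : forall m, 'I_(n m) -> 'I_m -> {RV (P m) >-> R})
  (a b : nat -> R) (C beta gamma2 : R) :
  let delta := fun m => delta0 m / deltaA m in
  let f := fun m => (1 - p m) / p m in
  0 < sigma ->
  nu [set 0] = 0%E ->
  (0 < nu `]-oo, 0%R[%classic)%E -> (0 < nu `]0%R, +oo[%classic)%E ->
  (forall m, (1 < m)%N ->
     [/\ (0 < n m)%N, 0 < p m < 1, 0 < delta0 m, 0 < deltaA m
       & 0 < alpha m < 1]) ->
  (forall m, (1 < m)%N -> two_groups_model (p m) sigma nu (mu m) (X m)) ->
  (\forall m \near \oo,
     oracle_cutoffs (n m) (p m) (delta0 m) (deltaA m) sigma nu (a m) (b m)) ->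
  assumption_A n delta f C ->
  assumption_C nu sigma C ->
  0 < beta <= 1 ->
  (forall m, (1 < m)%N -> p m = m%:R `^ (- beta)) ->
  0 < gamma2 ->
  (forall m, (1 < m)%N -> (n m)%:R <= m%:R `^ gamma2 :> R) ->
  (exists M : R, forall m, (1 < m)%N -> delta m <= M) ->
  (fun m => ln (delta m)) =o_\oo (fun m => ln (m%:R : R)) ->
  propto alpha (fun m => (n m)%:R `^ (- 2^-1)) ->
  let rk (rule : forall m, testing_rule m (n m)) (m : nat) :=
    risk (delta0 m) (deltaA m) (mu m) (X m) (rule m) in
  let RB := rk (fun m => bayes_oracle (a m) (b m)) in
  ABOS (rk (fun m => BH_rule sigma (alpha m))) RB /\
  ABOS (rk (fun m => SD_rule sigma (alpha m))) RB.
Proof.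
move=> delta f sigma0 nu0 _ _ pos model cutoffs asA nuC beta01 pE _ n_le [Md delta_le]
  lndelta [K K0 alpha_cvg] rk RB.
have [n_cvg _ lnodds_cvg C0] := asA.
have n0 m : (1 < m)%N -> (0 < n m)%N by move=> /pos[].
have p01 m : (1 < m)%N -> 0 < p m < 1 by move=> /pos[].
have delta00 m : (1 < m)%N -> 0 < delta0 m by move=> /pos[].
have deltaA0 m : (1 < m)%N -> 0 < deltaA m by move=> /pos[].
have alpha01 m : (1 < m)%N -> 0 < alpha m < 1 by move=> /pos[].
have delta_gt0 m : (1 < m)%N -> 0 < delta m.
  by move=> m1; rewrite divr_gt0 ?delta00 ?deltaA0.
have [A [eta1 [A0 eta10 cmp]]] := near_step_down_bound sigma0 nu0 nuC beta01 K0 C0 n0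
  p01 alpha01 pE delta_gt0 delta_le n_le n_cvg alpha_cvg lnodds_cvg lndelta.
pose bound m k0 := delta0 m * (2 * alpha m * (1 + m%:R * p m)) +
  deltaA m * (m%:R * p m * step_down_bound m (n m) (p m) sigma (alpha m) nu k0).
have near_bound e : 0 < e -> \forall m \near \oo, 0 < RB m /\
    exists2 k0, (k0 < m)%N & bound m k0 <= (1 + e) * RB m.
  move=> e0; have Ae : 0 < A + 1 + e by rewrite -addrA ltr_wpDl// addr_gt0.
  (* Chosen so that [1 + A * eta <= (1 + e) * (1 - eta)], which amounts to
     [eta * (A + 1 + e) <= e]. *)
  pose eta := Num.min eta1 (e / (A + 1 + e)).
  have eta0 : 0 < eta by rewrite lt_min eta10 divr_gt0.
  have etae : eta * (A + 1 + e) <= e by rewrite -ler_pdivlMr// ge_min lexx orbT.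
  have etaeta1 : eta <= eta1 by rewrite ge_min lexx.
  have etalt1 : eta < 1.
    apply: (@le_lt_trans _ _ (e / (A + 1 + e))); first by rewrite ge_min lexx orbT.
    by rewrite ltr_pdivrMr//; lra.
  near=> m.
  have m1 : (1 < m)%N by near: m; exact: near_gt1.
  have [/= a0 b0 ea eb] : oracle_cutoffs (n m) (p m) (delta0 m) (deltaA m) sigma nu
    (a m) (b m) by near: m.
  have /andP[p0 p1] := p01 _ m1; have /andP[al0 _] := alpha01 _ m1.
  have d0 := delta00 _ m1; have dA := deltaA0 _ m1.
  have N0 : 0 < (n m)%:R :> R by rewrite ltr0n n0.
  have sN : 0 < Num.sqrt (n m)%:R :> R by rewrite sqrtr_gt0.
  have oddsE : (1 - p m) * delta0 m / (p m * deltaA m) = delta m * ((1 - p m) / p m).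
    by rewrite /delta; field; rewrite !gt_eqF.
  have la := lik_cutoff sigma0 (n0 _ m1) (p01 _ m1) dA ea.
  have lb := lik_cutoff sigma0 (n0 _ m1) (p01 _ m1) dA eb.
  rewrite /= oddsE in la lb.
  set a' := Num.sqrt (n m)%:R * a m / sigma in la.
  set b' := Num.sqrt (n m)%:R * b m / sigma in lb.
  have a'0 : a' < 0 by rewrite /a' pmulr_llt0 ?invr_gt0// pmulr_rlt0.
  have b'0 : 0 < b' by rewrite /b' divr_gt0// mulr_gt0.
  have [k0 [v [k0m v0 up low]]] : exists k0 v, [/\ (k0 < m)%N, 0 < v,
      4 * delta m * alpha m + step_down_bound m (n m) (p m) sigma (alpha m) nu k0
        <= (1 + A * eta) * v &
      (1 - eta) * v <= alt_law (sigma / Num.sqrt (n m)%:R) nu `]a', b'[].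
    move: a'0 b'0 la lb; move: (a') (b'); near: m; exact: cmp.
  have RB_ge := risk_oracle_ge (a m) (b m) sigma0 (n0 _ m1) (p01 _ m1) d0 dA al0 nu0
    (model _ m1).
  rewrite /= -/a' -/b' in RB_ge.
  (* As [beta <= 1], the number [m * p] is at least 1 and [1 + m * p <= 2 * (m * p)]: per signal and
     in units of [deltaA], false rejections cost at most [4 * delta * alpha]. *)
  have mp1 : 1 <= m%:R * p m.
    have m0 : 0 < m%:R :> R by rewrite ltr0n ltnW.
    rewrite pE// powRN ler_pdivlMr ?powR_gt0// mul1r -[leRHS]powRr1 ?(ltW m0)//.
    have /andP[_ b1] := beta01.
    by apply: ler_powR => //; rewrite ler1n ltnW.
  have mp0 : 0 < m%:R * p m by exact: lt_le_trans mp1.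
  have dmp : 0 < deltaA m * (m%:R * p m) by rewrite mulr_gt0.
  have low' : deltaA m * (m%:R * p m) * ((1 - eta) * v) <= RB m.
    by apply: le_trans RB_ge; rewrite [leRHS]mulrA ler_pM2l.
  have eta1_gt0 : 0 < 1 - eta by rewrite subr_gt0.
  split; first by apply: lt_le_trans low'; apply: mulr_gt0 => //; exact: mulr_gt0.
  exists k0 => //; rewrite /bound.
  have h1 : (1 + A * eta) * v <= (1 + e) * ((1 - eta) * v).
    by rewrite mulrA ler_pM2r//; lra.
  have h2 : deltaA m * (m%:R * p m) * ((1 + A * eta) * v) <=
      (1 + e) * (deltaA m * (m%:R * p m) * ((1 - eta) * v)).
    by rewrite [leRHS]mulrCA ler_pM2l.
  apply: (@le_trans _ _ ((1 + e) * (deltaA m * (m%:R * p m) * ((1 - eta) * v)))); last first.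
    by rewrite ler_pM2l// addr_gt0.
  apply: le_trans h2.
  apply: (@le_trans _ _ (deltaA m * (m%:R * p m) * (4 * delta m * alpha m +
    step_down_bound m (n m) (p m) sigma (alpha m) nu k0))); last by rewrite ler_pM2l.
  rewrite [leRHS]mulrDr [X in _ + X <= _]mulrA lerD2r.
  have -> : deltaA m * (m%:R * p m) * (4 * delta m * alpha m) =
      delta0 m * (2 * alpha m * (2 * (m%:R * p m))).
    by rewrite /delta; field; rewrite gt_eqF.
  by rewrite ler_pM2l// ler_pM2l ?mulr_gt0//; lra.
have near_alpha : \forall m \near \oo, alpha m <= 4^-1.
  near=> m.
  have N0 : 0 < Num.sqrt (n m)%:R :> R.
    by rewrite sqrtr_gt0 ltr0n n0//; near: m; exact: near_gt1.
  have /andP[/= _ h] : K / 2 <= alpha m * Num.sqrt (n m)%:R <= 2 * K.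
    by near: m; exact: (near_level K0 n0 alpha_cvg).
  have h1 : 8 * K <= Num.sqrt (n m)%:R by near: m; exact: (near_sqrt n_cvg).
  by rewrite -(ler_pM2r N0); lra.
have RB0 : \forall m \near \oo, 0 < RB m.
  by have := near_bound 1 ltr01; apply: filterS => m [].
(* Squeeze: the ratio to the oracle risk is at least 1 by optimality and eventually at most
   [1 + e]. *)
have abos (r : nat -> R) : (\forall m \near \oo, RB m <= r m) ->
    (forall m k0, (1 < m)%N -> 0 < alpha m -> alpha m <= 4^-1 -> (k0 < m)%N ->
      r m <= bound m k0) -> ABOS r RB.
  move=> RBr r_bound; apply: ratio_cvg1 => // e e0; near=> m.
  have m1 : (1 < m)%N by near: m; exact: near_gt1.
  have /andP[al0 _] := alpha01 _ m1.
  have al4 : alpha m <= 4^-1 by near: m.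
  have [_ [k0 k0m]] : 0 < RB m /\ exists2 k0, (k0 < m)%N & bound m k0 <= (1 + e) * RB m.
    by near: m; exact: near_bound.
  exact: le_trans (r_bound _ _ m1 al0 al4 k0m).
split; apply: abos.
- near=> m.
  have m1 : (1 < m)%N by near: m; exact: near_gt1.
  have /andP[al0 _] := alpha01 _ m1.
  apply: (risk_oracle_le_BH sigma0 (n0 _ m1) (p01 _ m1) (delta00 _ m1) (deltaA0 _ m1) al0
    nu0 (model _ m1)).
  by near: m.
- move=> m k0 m1 al0 al4 k0m.
  exact: (risk_BH_le (a m) (b m) sigma0 (n0 _ m1) (p01 _ m1) (delta00 _ m1)
    (deltaA0 _ m1) al0 al4 nu0 (model _ m1) k0m).
- near=> m.
  have m1 : (1 < m)%N by near: m; exact: near_gt1.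
  have /andP[al0 _] := alpha01 _ m1.
  apply: (risk_oracle_le_SD sigma0 (n0 _ m1) (p01 _ m1) (delta00 _ m1) (deltaA0 _ m1) al0
    nu0 (model _ m1)).
  by near: m.
- move=> m k0 m1 al0 al4 k0m.
  exact: (risk_SD_le (a m) (b m) sigma0 (n0 _ m1) (p01 _ m1) (delta00 _ m1)
    (deltaA0 _ m1) al0 al4 nu0 (model _ m1) k0m).
Unshelve. all: by end_near. Qed.
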